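(* Let $N\ge 1$, $Q=2N+2$, $0<s<1<p<Q$, $\delta\in(0,1)$, $\alpha>0$, and let $\Omega\subset\mathbb{H}^N$ be a bounded smooth domain. Let $p^*=\frac{Qp}{Q-p}$ and $m=\left(\frac{p^*}{1-\delta}\right)'$, and let $f\in L^m(\Omega)\setminus\{0\}$ be nonnegative. Let $u_\delta\in HW_0^{1,p}(\Omega)$ be the unique weak solution of $$-\Delta_{H,p}u+\alpha(-\Delta_{H,p})^s u=f(x)u^{-\delta}\ \text{in }\Omega,\qquad u>0\ \text{in }\Omega,\qquad u=0\ \text{in }\mathbb{H}^N\setminus\Omega,$$ and let $$\Theta(\Omega):=\inf_{v\in HW_0^{1,p}(\Omega)\setminus\{0\}}\left\{\int_\Omega|\nabla_H v|^p\,dx+\alpha\int_{\mathbb{H}^N}\int_{\mathbb{H}^N}|v(x)-v(y)|^p\,d\mu\ :\ \int_\Omega|v|^{1-\delta}f\,dx=1\right\}.$$ Then the following hold. (a) (Extremal) $$\Theta(\Omega)=\left(\int_\Omega|\nabla_H u_\delta|^p\,dx+\alpha\int_{\mathbb{H}^N}\int_{\mathbb{H}^N}|u_\delta(x)-u_\delta(y)|^p\,d\mu\right)^{\frac{1-\delta-p}{1-\delta}}.$$ (b) (Sobolev-type inequality) For a real constant $C$, the inequality $$C\left(\int_\Omega|v|^{1-\delta}f\,dx\right)^{\frac{p}{1-\delta}}\le\int_\Omega|\nabla_H v|^p\,dx+\alpha\int_{\mathbb{H}^N}\int_{\mathbb{H}^N}|v(x)-v(y)|^p\,d\mu$$ holds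 for every $v\in HW_0^{1,p}(\Omega)$ if and only if $C\le\Theta(\Omega)$. (c) (Simplicity) If for some $w\in HW_0^{1,p}(\Omega)$ the equality $$\Theta(\Omega)\left(\int_\Omega|w|^{1-\delta}f\,dx\right)^{\frac{p}{1-\delta}}=\int_\Omega|\nabla_H w|^p\,dx+\alpha\int_{\mathbb{H}^N}\int_{\mathbb{H}^N}|w(x)-w(y)|^p\,d\mu$$ holds, then $w=ku_\delta$ for some constant $k$.
   Context: The Heisenberg group $\mathbb{H}^N$ is $\mathbb{R}^{2N+1}$ with the group law $\xi\circ\eta=\left(x_1+y_1,\dots,x_{2N}+y_{2N},\tau+\tau'+\frac12\sum_{i=1}^N(x_iy_{N+i}-x_{N+i}y_i)\right)$ for $\xi=(x_1,\dots,x_{2N},\tau)$, $\eta=(y_1,\dots,y_{2N},\tau')$. Horizontal vector fields: $X_i=\partial_{x_i}-\frac{x_{N+i}}{2}\partial_\tau$, $X_{N+i}=\partial_{x_{N+i}}+\frac{x_i}{2}\partial_\tau$ ($1\le i\le N$); horizontal gradient $\nabla_H u=(X_1u,\dots,X_{2N}u)$ (in the weak sense). Norm: $|\xi|=\left(\left(\sum_{i=1}^{2N}x_i^2\right)^2+\tau^2\right)^{1/4}$. Integration is with respect to Lebesgue measure on $\mathbb{R}^{2N+1}$ (the Haar measure). $d\mu=\frac{dx\,dy}{|y^{-1}\circ x|^{Q+sp}}$. $J_p(t)=|t|^{p-2}t$. For $l>1$, $l'=\frac{l}{l-1}$. $HW^{1,p}(\mathbb{H}^N)=\{u\in L^p(\mathbb{H}^N):\nabla_H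 u\in L^p(\mathbb{H}^N)\}$ and $HW_0^{1,p}(\Omega)=\{u\in HW^{1,p}(\mathbb{H}^N):u=0\text{ in }\mathbb{H}^N\setminus\Omega\}$. For $u\in HW_0^{1,p}(\Omega)$ the double integral $\int_{\mathbb{H}^N}\int_{\mathbb{H}^N}|u(x)-u(y)|^p\,d\mu$ is finite. Operators: $\Delta_{H,p}u=\mathrm{div}_H(|\nabla_H u|^{p-2}\nabla_H u)$ is the $p$-sub-Laplacian and $(-\Delta_{H,p})^su(x)=\mathrm{P.V.}\int_{\mathbb{H}^N}\frac{J_p(u(x)-u(y))}{|y^{-1}\circ x|^{Q+sp}}\,dy$; equations are understood only in the following weak sense. Weak solution: $u\in HW_0^{1,p}(\Omega)$ is a weak solution of the problem $-\Delta_{H,p}u+\alpha(-\Delta_{H,p})^s u=f(x)u^{-\delta}$ in $\Omega$, $u>0$ in $\Omega$, $u=0$ in $\mathbb{H}^N\setminus\Omega$, if for every $\omega\Subset\Omega$ there is $C=C(\omega)>0$ with $u\ge C$ a.e. in $\omega$, and for every $\varphi\in C_c^1(\Omega)$, $$\int_\Omega|\nabla_H u|^{p-2}\nabla_H u\cdot\nabla_H\varphi\,dx+\alpha\int_{\mathbb{H}^N}\int_{\mathbb{H}^N}J_p(u(x)-u(y))(\varphi(x)-\varphi(y))\,d\mu=\int_\Omega f u^{-\delta}\varphi\,dx.$$ For nonnegative $f\in L^m(\Omega)\setminus\{0\}$ with $m=\left(\frac{p^*}{1-\delta}\right)'$, existence and uniqueness of the weak solution $u_\delta$ in $HW_0^{1,p}(\Omega)$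 are known. *)

(* Defs.v *)
From HB Require Import structures.
From mathcomp Require Import all_boot all_order all_algebra.
From mathcomp Require Import all_classical all_reals all_analysis.

Set Implicit Arguments.
Unset Strict Implicit.
Unset Printing Implicit Defensive.

Import Order.TTheory GRing.Theory Num.Theory.
Import numFieldNormedType.Exports.

Local Open Scope classical_set_scope.
Local Open Scope ring_scope.

(* Product sigma-algebra on row vectors, built like the library's one on
   n.-tuple T; for T = R it is the Borel sigma-algebra of R^n. *)
Section measurable_rV.
Context {d} {T : sigmaRingType d} (n : nat).

Let coors : 'I_n -> 'rV[T]_n -> T := fun i v => v ord0 i.

Let rV_set0 : g_sigma_preimage coors set0.
Proof. exact: sigma_algebra0. Qed.

Let rV_setC A : g_sigma_preimage coors A -> g_sigma_preimage coors (~` A).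
Proof. exact: sigma_algebraC. Qed.

Let rV_bigcup (F : (set 'rV[T]_n)^nat) :
  (forall i, g_sigma_preimage coors (F i)) ->
  g_sigma_preimage coors (\bigcup_i (F i)).
Proof. exact: sigma_algebra_bigcup. Qed.

HB.instance Definition _ := @isMeasurable.Build (measure_tuple_display d)
  'rV[T]_n (g_sigma_preimage coors) rV_set0 rV_setC rV_bigcup.

End measurable_rV.

Lemma measurable_fun_rV d d' (S : measurableType d) (T : measurableType d') n
    (f : S -> 'rV[T]_n) :
  (forall i, measurable_fun [set: S] (fun x => f x ord0 i)) ->
  measurable_fun [set: S] f.
Proof.
move=> mf.
have H : g_sigma_preimage (fun i (x : S) => f x ord0 i) `<=` measurable.
  apply: smallest_sub; first exact: sigma_algebra_measurable.
  case: n f mf => [|n] f mf; first by rewrite big_ord0.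
  rewrite -bigcup_mkord_ord => A -[i _ mA].
  by case: mA => B mB <-; exact: mf.
move=> _ A mA; rewrite setTI.
move: A mA; apply: smallest_sub.
  split => [|A|F] /=.
  - by rewrite preimage_set0.
  - by move=> mA; rewrite setTD preimage_setC; exact: measurableC.
  - by move=> mF; rewrite preimage_bigcup; exact: bigcup_measurable.
case: n f mf {H} => [|n] f mf; first by rewrite big_ord0.
rewrite -bigcup_mkord_ord => A -[i _ [B mB <-]] /=.
by rewrite setTI -[X in measurable X]setTI; exact: (mf (inord i)).
Qed.

Lemma measurable_coord_rV d (T : measurableType d) n (i : 'I_n) :
  measurable_fun [set: 'rV[T]_n] (fun v => v ord0 i).
Proof.
move=> _ Y mY; rewrite setTI; apply: sub_sigma_algebra => /=.
rewrite -bigcup_seq/=; exists i => /=; first by rewrite mem_index_enum.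
by exists Y => //; rewrite setTI.
Qed.

Section lebesgue_rV.
Context {R : realType}.

Definition rV_cons n (z : 'rV[R]_n * R) : 'rV[R]_n.+1 :=
  \row_i (if unlift ord0 i is Some j then z.1 ord0 j else z.2).

Definition rV_uncons n (v : 'rV[R]_n.+1) : 'rV[R]_n * R :=
  (\row_j v ord0 (lift ord0 j), v ord0 ord0).

Lemma rV_consK n : cancel (@rV_cons n) (@rV_uncons n).
Proof.
move=> [v r]; rewrite /rV_uncons mxE unlift_none; congr (_, _).
by apply/rowP => j; rewrite !mxE liftK.
Qed.

Lemma measurable_rV_cons n : measurable_fun [set: 'rV[R]_n * R] (@rV_cons n).
Proof.
apply: measurable_fun_rV => i.
under eq_fun do rewrite mxE.
case: (unlift ord0 i) => [j|]; last exact: measurable_snd.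
exact: (measurableT_comp (measurable_coord_rV j) measurable_fst).
Qed.

Lemma measurable_rV_uncons n : measurable_fun [set: 'rV[R]_n.+1] (@rV_uncons n).
Proof.
apply: measurable_fun_pair; last exact: measurable_coord_rV.
apply: measurable_fun_rV => j; under eq_fun do rewrite mxE.
exact: measurable_coord_rV.
Qed.

Let cons_measure n (m : {measure set 'rV[R]_n -> \bar R}) :
    {measure set 'rV[R]_n.+1 -> \bar R} :=
  measure_function_pushforward__canonical__measure_function_Measure
    (m \x @lebesgue_measure R)%E (@measurable_rV_cons n).

(* Lebesgue measure on R^n as the n-fold product of lebesgue_measure. *)
Fixpoint lebesgue_rV_rec n : {measure set 'rV[R]_n -> \bar R} :=
  match n with
  | 0 => dirac (0 : 'rV[R]_0)
  | n'.+1 => cons_measure (lebesgue_rV_rec n')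
  end.

Definition lebesgue_rV n : set 'rV[R]_n -> \bar R := lebesgue_rV_rec n.

HB.instance Definition _ n := Measure.on (@lebesgue_rV n).

Let lebesgue_rV_sigma_finite n : sigma_finite [set: 'rV[R]_n] (@lebesgue_rV n).
Proof.
elim: n => [|n IHn].
  exists (fun=> setT) => [|_]; first by rewrite bigcup_const.
  by split=> //; rewrite /lebesgue_rV /= diracT ltry.
have /sigma_finiteP[F [TF ndF Foo]] := IHn.
have /sigma_finiteP[G [TG ndG Goo]] :=
  sigma_finiteT (@lebesgue_measure R : {sigma_finite_measure set _ -> \bar R}).
exists (fun k => @rV_uncons n @^-1` (F k `*` G k)).
  rewrite -preimage_bigcup -[LHS](preimage_setT (@rV_uncons n)); congr (_ @^-1` _).
  rewrite -setXTT TF TG predeqE => -[x y]; split.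
    move=> [/= [a _ Fax] [b _ Gby]]; exists (maxn a b) => //; split.
    - by move: x Fax; exact/subsetPset/ndF/leq_maxl.
    - by move: y Gby; exact/subsetPset/ndG/leq_maxr.
  by move=> [a _ []/= ? ?]; split; exists a.
move=> k; have [mF Fk] := Foo k; have [mG Gk] := Goo k.
have mFG : measurable (F k `*` G k) by exact: measurableX.
split.
  by rewrite -[X in measurable X]setTI; exact: measurable_rV_uncons.
rewrite /lebesgue_rV /= /pushforward -comp_preimage.
rewrite (_ : _ \o _ = id); last by apply/funext => z /=; rewrite rV_consK.
rewrite preimage_id.
by rewrite product_measure1E// lte_mul_pinfty// ge0_fin_numE.
Qed.

HB.instance Definition _ n := Measure_isSigmaFinite.Build _ _ _
  (@lebesgue_rV n) (@lebesgue_rV_sigma_finite n).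

Lemma lebesgue_rV_box n (A : 'I_n -> set R) :
  (forall i, measurable (A i)) ->
  lebesgue_rV [set v | forall i, A i (v ord0 i)] =
  (\prod_(i < n) lebesgue_measure (A i))%E.
Proof.
elim: n A => [|n IHn] A mA.
  by rewrite big_ord0 /lebesgue_rV /= /dirac/= indicE mem_set// => -[].
rewrite big_ord_recl /lebesgue_rV /= /pushforward.
rewrite (_ : _ @^-1` _ =
  [set v : 'rV[R]_n | forall j, A (lift ord0 j) (v ord0 j)] `*` A ord0); last first.
  apply/seteqP; split=> -[v r] /=.
    move=> Avr; split=> [j|]; first by have := Avr (lift ord0 j); rewrite mxE liftK.
    by have := Avr ord0; rewrite mxE unlift_none.
  move=> [Av Ar] i; rewrite mxE; case: unliftP => [j ->|->] //.
have mB : measurable [set v : 'rV[R]_n | forall j, A (lift ord0 j) (v ord0 j)].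
  rewrite (_ : [set _ | _] = \bigcap_(j in [set: 'I_n])
      ((fun v : 'rV[R]_n => v ord0 j) @^-1` A (lift ord0 j))); last first.
    by apply/seteqP; split=> v /= Av => [j _|j]; [exact: Av|exact: (Av j I)].
  apply: fin_bigcap_measurable => // j _.
  by rewrite -[X in measurable X]setTI; exact: measurable_coord_rV.
rewrite product_measure1E//; last exact: mA.
by rewrite muleC -IHn.
Qed.

End lebesgue_rV.

Section euclidean_calculus.
Context {R : realType} {n : nat}.
Implicit Types (f : 'rV[R]_n -> R) (Omega : set 'rV[R]_n).

Definition partial (i : 'I_n) f : 'rV[R]_n -> R :=
  fun x => 'D_(delta_mx ord0 i : 'rV[R]_n) f x.

Fixpoint continuously_differentiable (k : nat) f : Prop :=
  continuous f /\
  if k is k'.+1 then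
    forall i : 'I_n,
      (forall x, derivable f x (delta_mx ord0 i : 'rV[R]_n)) /\
      continuously_differentiable k' (partial i f)
  else True.

Definition smooth f := forall k, continuously_differentiable k f.

Definition compact_support Omega f :=
  compact (closure [set x | f x != 0]) /\ closure [set x | f x != 0] `<=` Omega.

Definition compactly_contained (omega Omega : set 'rV[R]_n) :=
  compact (closure omega) /\ closure omega `<=` Omega.

(* Near each boundary point, Omega is the sublevel set {rho < 0} of a smooth
   function rho whose differential does not vanish there. *)
Definition smooth_boundary Omega :=
  forall x, (closure Omega `\` interior Omega) x ->
    exists rho : 'rV[R]_n -> R,
      [/\ smooth rho, exists i, partial i rho x != 0 &
          \forall y \near x, Omega y <-> rho y < 0].

Definition bounded_smooth_domain Omega :=
  [/\ Omega !=set0, open Omega, connected Omega, bounded_set Omega &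
      smooth_boundary Omega].

End euclidean_calculus.

Notation heis R N := 'rV[R]_(N + N + 1) (only parsing).

Section heisenberg.
Context {R : realType} {N : nat}.
Implicit Types (xi eta : heis R N) (u g phi : heis R N -> R).

(* xi = (x_1, ..., x_2N, tau); for i : 'I_N, lshift N i and rshift N i are the
   indices of x_i and x_(N+i). *)
Definition hx (i : 'I_(N + N)) xi : R := xi ord0 (lshift 1 i).
Definition htau xi : R := xi ord0 (rshift (N + N) ord0).

Definition hmul xi eta : heis R N :=
  row_mx (\row_i (hx i xi + hx i eta))
    (const_mx (htau xi + htau eta + 2^-1 * \sum_(i < N)
      (hx (lshift N i) xi * hx (rshift N i) eta
       - hx (rshift N i) xi * hx (lshift N i) eta))).

Definition hinv xi : heis R N := - xi.

Lemma hmulVx xi : hmul (hinv xi) xi = 0.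
Proof.
apply/rowP => k; rewrite !mxE; case: splitP => j _; rewrite !mxE.
  by rewrite /hx !mxE addNr.
rewrite /htau /hx !mxE addNr add0r big1 ?mulr0// => i _.
by rewrite !mxE !mulNr opprK mulrC addNr.
Qed.

Definition hnorm xi : R :=
  ((\sum_(i < N + N) hx i xi ^+ 2) ^+ 2 + htau xi ^+ 2) `^ 4^-1.

(* homogeneous dimension Q *)
Definition hdim : nat := (2 * N + 2)%N.

Definition mu_heis : {sigma_finite_measure set (heis R N) -> \bar R} :=
  @lebesgue_rV R (N + N + 1).

Definition partial_tau : (heis R N -> R) -> heis R N -> R :=
  partial (rshift (N + N) ord0).

(* The horizontal fields X_1, ..., X_2N, acting classically. *)
Definition Xfield (i : 'I_(N + N)) phi : heis R N -> R := fun xi =>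
  partial (lshift 1 i) phi xi +
  match fintype.split i with
  | inl j => - (hx (rshift N j) xi / 2) * partial_tau phi xi
  | inr j => hx (lshift N j) xi / 2 * partial_tau phi xi
  end.

Definition test_function phi := smooth phi /\ compact_support setT phi.

(* The library's locally_integrable is only stated on R. *)
Definition loc_integrable g :=
  measurable_fun setT g /\
  forall K, compact K -> (\int[mu_heis]_(x in K) `|g x|%:E < +oo)%E.

(* The fields X_i are divergence free, so that their formal adjoint is - X_i. *)
Definition is_weak_X (i : 'I_(N + N)) u g :=
  loc_integrable g /\
  forall phi, test_function phi ->
    (\int[mu_heis]_x (u x * Xfield i phi x)%:E =
     - \int[mu_heis]_x (g x * phi x)%:E)%E.

(* A choice of weak derivative X_i u (unique almost everywhere), 0 by default. *)
Definition weak_X (i : 'I_(N + N)) u : heis R N -> R :=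
  xget (fun=> 0) [set g | is_weak_X i u g].

Definition hgrad_norm u : heis R N -> R :=
  fun x => Num.sqrt (\sum_(i < N + N) weak_X i u x ^+ 2).

Definition HW1 (p : R) : set (heis R N -> R) :=
  [set u | u \in Lfun mu_heis p%:E /\
    forall i, (exists g, is_weak_X i u g) /\ weak_X i u \in Lfun mu_heis p%:E].

Definition HW1_0 (p : R) (Omega : set (heis R N)) : set (heis R N -> R) :=
  [set u | HW1 p u /\ {ae mu_heis, forall x, ~ Omega x -> u x = 0}].

Definition Jp (p t : R) : R := `|t| `^ (p - 2) * t.

(* |y^-1 o x|^(Q + sp) for z = (x, y) *)
Definition gagliardo_weight (s p : R) (z : heis R N * heis R N) : R :=
  hnorm (hmul (hinv z.2) z.1) `^ (hdim%:R + s * p).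

(* Integral over H x H of F dmu, where dmu = dx dy / |y^-1 o x|^(Q + sp);
   on the null diagonal x = y the weight is 0 and the integrand is 0 as well. *)
Definition int_dmu (s p : R) (F : heis R N * heis R N -> R) : \bar R :=
  (\int[mu_heis \x mu_heis]_z (F z / gagliardo_weight s p z)%:E)%E.

Section problem.
Variables (Omega : set (heis R N)) (p s alpha delta : R) (f : heis R N -> R).

Definition weak_solution u :=
  [/\ HW1_0 p Omega u,
      forall omega, compactly_contained omega Omega ->
        exists2 C : R, 0 < C & {ae mu_heis, forall x, omega x -> C <= u x} &
      forall phi,
        continuously_differentiable 1 phi -> compact_support Omega phi ->
        (\int[mu_heis]_(x in Omega) (hgrad_norm u x `^ (p - 2) *
            \sum_(i < N + N) weak_X i u x * Xfield i phi x)%:E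
         + alpha%:E * int_dmu s p
             (fun z => Jp p (u z.1 - u z.2) * (phi z.1 - phi z.2))%R =
         \int[mu_heis]_(x in Omega) (f x * u x `^ (- delta) * phi x)%:E)%E].

Definition energy u : \bar R :=
  (\int[mu_heis]_(x in Omega) (hgrad_norm u x `^ p)%:E
   + alpha%:E * int_dmu s p (fun z => `|u z.1 - u z.2| `^ p)%R)%E.

Definition weighted_mass u : \bar R :=
  (\int[mu_heis]_(x in Omega) (`|u x| `^ (1 - delta) * f x)%:E)%E.

Definition Theta : \bar R :=
  ereal_inf [set energy v | v in
    [set v | [/\ HW1_0 p Omega v, ~ {ae mu_heis, forall x, v x = 0} &
                 weighted_mass v = 1%E]]].

End problem.

(* p^* = Qp / (Q - p) *)
Definition sobolev_conjugate (p : R) : R := hdim%:R * p / (hdim%:R - p).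

Definition conjugate_exponent (l : R) : R := l / (l - 1).

End heisenberg.

Arguments hdim N : clear implicits.
Arguments sobolev_conjugate {R} N p.

(* Main.v *)
From HB Require Import structures.
From mathcomp Require Import all_boot all_order all_algebra.
From mathcomp Require Import all_classical all_reals all_analysis.
From mathcomp Require Import measurable_realfun ring lra.
Require Import Defs.

Set Implicit Arguments.
Unset Strict Implicit.
Unset Printing Implicit Defensive.

Import Order.TTheory GRing.Theory Num.Theory.
Import numFieldNormedType.Exports.

Local Open Scope classical_set_scope.
Local Open Scope ring_scope.

(** Write E(v) for the energy of v, M(v) for the weighted mass, that is, the
    integral of |v|^(1-d) f over Omega with d = delta, and <Au, phi> for the
    left-hand side of the weak formulation.  The proof rests on the convexity of
    E and the concavity of t |-> t^(1-d).

    Young's inequality, applied to the integrands of <Au, psi>, where psi has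
    smaller horizontal gradient and smaller increments than phi, gives
      <Au, psi> + D <= (1 - 1/p) E(u) + E(phi) / p,
    where D >= 0 is the integral of the remainder of Young's inequality in the
    nonlocal term.  Taking psi close to |phi| and phi close to v, the weak
    formulation turns this into
      int f u^(-d) |v| + D(v) <= (1 - 1/p) E(u) + E(v) / p
    ([weak_young_inequality]).  For v = u it says M(u) <= E(u); testing with
    approximations of u gives the converse ([solution_energy_le]), so that
    M(u) = E(u).  As |v|^(1-d) <= (1-d) u^(-d) |v| + d u^(1-d),
      M(v) + (1-d) D(v) <= (1-d) ((1 - 1/p) E(u) + E(v) / p) + d E(u)
    ([mass_le]), whose right-hand side is E(u) as soon as E(v) = E(u).  Thus
    M(v) <= E(u) on the sphere E(v) = E(u), and homogeneity yields the sharp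
    inequality with the constant E(u)^((1-d-p)/(1-d)) ([sharp_inequality]),
    attained by the multiple of u of mass one: this is (a) and (b).  Let equality
    hold for w.  If E(w) = 0 then w = 0; otherwise D vanishes at the multiple v
    of w on that sphere, so that |v(x)| - |v(y)| = u(x) - u(y) and
    |v(x) - v(y)| = |u(x) - u(y)| for almost all (x, y).  Choosing x outside
    Omega gives |v| = u, and choosing x inside Omega shows that v has a constant
    sign ([rigidity]): this is (c).

    The weak formulation only admits test functions of class C^1 with compact
    support in Omega, and f u^(-d) is a priori only integrable against those.
    One therefore needs that every element of HW_0^(1,p)(Omega) is a limit of
    such functions, in energy and almost everywhere ([HW1_0_admissible]); Fatou's
    lemma then passes inequalities to the limit.  The local part of the
    approximation is a mollification by group convolution on the left, which
    commutes with the left-invariant fields X_i ([Xfield_mol]).  Near a boundary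
    point the mollifier is supported away from the origin, so that it also
    translates the function into Omega ([push_inside], [density]).  The nonlocal
    part follows from the estimate of the Gagliardo seminorm by the L^p norms of
    the function and of its horizontal gradient ([gagliardo_bound]): a step of
    the group of size t is a product of boundedly many horizontal steps of size
    O(t), and |h|^(-Q-sp) min(1, |h|^p) is integrable because 0 < s < 1. *)

Local Notation cd := continuously_differentiable.

(** * Lebesgue measure on row vectors and on the Heisenberg group *)

Lemma ler_coord_norm (R : realType) n (v : 'rV[R]_n) i : `|v ord0 i| <= `|v|.
Proof.
rewrite [leRHS]/Num.norm /= mx_normrE; apply/bigmax_geP; right => /=.
by exists (ord0, i).
Qed.

Lemma rV_norm_le (R : realType) n (v : 'rV[R]_n) (e : R) :
  0 <= e -> (forall i, `|v ord0 i| <= e) -> `|v| <= e.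
Proof.
move=> e0 ve; rewrite /Num.norm /= mx_normrE; apply/bigmax_leP; split => // -[i j] _.
by rewrite (ord1 i).
Qed.

Lemma rV_norm_lt (R : realType) n (v : 'rV[R]_n) (e : R) :
  0 < e -> (forall i, `|v ord0 i| < e) -> `|v| < e.
Proof.
move=> e0 ve; rewrite /Num.norm /= mx_normrE; apply/bigmax_ltP; split => // -[i j] _.
by rewrite (ord1 i).
Qed.

Lemma continuous_coord (R : realType) n (i : 'I_n) :
  continuous (fun v : 'rV[R]_n => v ord0 i).
Proof. by move=> v; exact/differentiable_continuous/differentiable_coord. Qed.

Lemma rV_continuous (R : realType) (T : topologicalType) n (F : T -> 'rV[R]_n) :
  (forall i, continuous (fun x => F x ord0 i)) -> continuous F.
Proof.
move=> cF x; apply/cvgrPdist_lt => e e0; near=> y.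
suff H0 : forall i, `|F x ord0 i - F y ord0 i| < e.
  by apply: rV_norm_lt => // i; rewrite !mxE; exact: H0.
near: y.
suff H : forall i : 'I_n, \forall t \near x, `|F x ord0 i - F t ord0 i| < e.
  by apply: filter_forall => j; exact: H.
by move=> j; have /cvgrPdist_lt := cF j x; exact.
Unshelve. all: by end_near. Qed.

Section rV_measure.
Context {R : realType} {n : nat}.
Local Notation V := 'rV[R]_n.

Definition rV_boxes : set (set V) :=
  [set [set v : V | forall i, A i (v ord0 i)] |
    A in [set A : 'I_n -> set R | forall i, measurable (A i)]].

Lemma measurable_rV_box (A : 'I_n -> set R) : (forall i, measurable (A i)) ->
  measurable [set v : V | forall i, A i (v ord0 i)].
Proof.
move=> mA; rewrite (_ : [set _ | _] = \bigcap_(j in [set: 'I_n])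
    ((fun v : V => v ord0 j) @^-1` A j)); last first.
  by apply/seteqP; split=> v /= Av => [j _|j]; [exact: Av|exact: (Av j I)].
apply: fin_bigcap_measurable => // j _.
by rewrite -[X in measurable X]setTI; exact: measurable_coord_rV.
Qed.

Lemma rV_boxesI : setI_closed rV_boxes.
Proof.
move=> _ _ [A mA <-] [B mB <-]; exists (fun i => A i `&` B i).
  by move=> i; apply: measurableI; [exact: mA|exact: mB].
by apply/seteqP; split => v /= => [H|[HA HB] i]; [split => i; have [] := H i|].
Qed.

Lemma rV_measurable_boxes : @measurable _ V = <<s rV_boxes >>.
Proof.
apply/seteqP; split; last first.
  apply: smallest_sub; first exact: sigma_algebra_measurable.
  by move=> _ [A mA <-]; exact: measurable_rV_box.
apply: smallest_sub; first exact: smallest_sigma_algebra.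
rewrite -bigcup_seq/= => _ [i _ [B mB <-]].
apply: sub_sigma_algebra; exists (fun j => if j == i then B else setT).
  by move=> j; case: ifP.
rewrite setTI; apply/seteqP; split => v /=; first by move=> /(_ i); rewrite eqxx.
by move=> Bv j; case: ifP => // /eqP ->.
Qed.

Definition rV_cube (k : nat) : set V :=
  [set v | forall i, `[- k%:R, k%:R]%classic (v ord0 i)].

Lemma rV_cube_boxes k : rV_boxes (rV_cube k).
Proof. by exists (fun=> `[- k%:R, k%:R]%classic). Qed.

Lemma rV_cubeP k v : rV_cube k v <-> `|v| <= k%:R.
Proof.
split => [vk|vk i] /=.
  by apply: rV_norm_le => // i; have := vk i; rewrite /= in_itv/= -ler_norml.
by rewrite in_itv/= -ler_norml (le_trans (ler_coord_norm v i)).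
Qed.

Lemma rV_cube_cover : \bigcup_k rV_cube k = [set: V].
Proof.
rewrite -subTset => v _; exists (Num.truncn `|v|).+1 => //; apply/rV_cubeP.
exact/ltW/truncnS_gt.
Qed.

(** Boxes are stable under intersections, generate the measurable sets, and the cubes
    exhaust the space: two measures that agree on boxes and are finite on cubes coincide. *)
Lemma rV_measure_unique (m1 m2 : {measure set V -> \bar R}) :
  (forall A, rV_boxes A -> m1 A = m2 A) ->
  (forall k, (m1 (rV_cube k) < +oo)%E) ->
  forall A, measurable A -> m1 A = m2 A.
Proof.
move=> m12 m1oo; apply: (measure_unique rV_boxes rV_cube) => //.
- exact: rV_measurable_boxes.
- exact: rV_boxesI.
- exact: rV_cube_boxes.
- exact: rV_cube_cover.
Qed.

(** The measurable sets are those of the product sigma-algebra; an open set is the union of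
    the countably many boxes with rational centre and inverse integer radius that it contains. *)
Lemma open_measurable_rV (U : set V) : open U -> measurable U.
Proof.
move=> oU.
pose B (q : 'rV[rat]_n * nat) : set V :=
  [set v | forall i, ball (ratr (q.1 ord0 i) : R) (q.2.+1%:R^-1) (v ord0 i)].
have -> : U = \bigcup_(q in setT) (if `[< B q `<=` U >] then B q else set0).
  apply/seteqP; split => [v Uv|v [q _]]; last by case: asboolP => // + Bv; exact.
  have /nbhs_ballP[e /= e0 eU] := open_nbhs_nbhs (conj oU Uv).
  have [k ke] : exists k : nat, 2 * k.+1%:R^-1 < e.
    exists (Num.truncn (2 / e)); rewrite -ltr_pdivlMl//.
    rewrite invf_plt ?posrE ?mulr_gt0 ?invr_gt0//.
    by rewrite invfM invrK truncnS_gt.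
  have /choice[q Hq] : forall i : 'I_n, exists q : rat,
      `|ratr q - v ord0 i| < k.+1%:R^-1.
    move=> i.
    have : v ord0 i - k.+1%:R^-1 < v ord0 i + k.+1%:R^-1.
      by rewrite ltrD2l gt0_cp// ?invr_gt0.
    move=> /rat_in_itvoo[q]; rewrite in_itv/= -ltr_distl => qv; by exists q.
  exists (\row_i q i, k) => //.
  have Bv : B (\row_i q i, k) v.
    by move=> i; rewrite /ball/= mxE; exact: Hq.
  case: asboolP => // -[] w Bw; apply: eU.
  rewrite -ball_normE /=; apply: rV_norm_lt => // i; rewrite !mxE.
  have := Bw i; rewrite /ball/= mxE => Hw.
  rewrite (le_lt_trans (ler_distD (ratr (q i)) _ _))//.
  rewrite (lt_trans _ ke)// mulr2n mulrDl mul1r ltrD//.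
  by rewrite distrC.
apply: countable_bigcupT_measurable => // q; case: asboolP => // _.
apply: (@measurable_rV_box (fun i => ball (ratr (q.1 ord0 i) : R) q.2.+1%:R^-1)) => i.
exact: measurable_ball.
Qed.

Lemma continuous_measurable_rV (g : V -> R) : continuous g -> measurable_fun setT g.
Proof.
move=> /continuousP cg; apply: (measurability _ (measurable_realfun.RGenOpens.measurableE R)).
by move=> _ [_ [a [b ->] <-]]; rewrite setTI; apply: open_measurable_rV; exact: cg.
Qed.

End rV_measure.

Section invariant_integral.
Local Open Scope ereal_scope.
Context d (T : measurableType d) (R : realType) (m : {measure set T -> \bar R}).
Variables (S : T -> T) (mS : measurable_fun setT S).
Hypothesis invS : forall A, measurable A -> m (S @^-1` A) = m A.

Lemma ge0_integral_invariant (f : T -> \bar R) : measurable_fun [set: T] f ->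
  (forall x, 0 <= f x) -> \int[m]_x f (S x) = \int[m]_x f x.
Proof.
move=> mf f0.
rewrite -[LHS]/(\int[m]_(x in S @^-1` setT) (f \o S) x).
rewrite -(ge0_integral_pushforward mS)//.
by apply: eq_measure_integral => A mA _; exact: invS.
Qed.

Lemma integral_invariant (f : T -> \bar R) : measurable_fun [set: T] f ->
  \int[m]_x f (S x) = \int[m]_x f x.
Proof.
move=> mf; rewrite integralE [RHS]integralE; congr (_ - _).
  rewrite -[RHS]ge0_integral_invariant//; last exact: measurable_funepos.
  by apply: eq_integral => x _; rewrite !funeposE.
rewrite -[RHS]ge0_integral_invariant//; last exact: measurable_funeneg.
by apply: eq_integral => x _; rewrite !funenegE.
Qed.

End invariant_integral.

Lemma lebesgue_measure_shift (R : realType) (c : R) (A : set R) : measurable A ->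
  lebesgue_measure ((fun x => x + c) @^-1` A) = lebesgue_measure A.
Proof.
move=> mA.
have mf : @measurable_fun _ _ (measurableTypeR R) (measurableTypeR R)
  setT (fun x : R => x + c) by exact: measurable_funD.
pose m : {measure set (measurableTypeR R) -> \bar R} :=
  measure_function_pushforward__canonical__measure_function_Measure
    (@lebesgue_measure R) mf.
rewrite -[LHS]/(m A); apply/esym.
apply: (@lebesgue_measure_unique R m) => //.
move=> _ [[a b] _ <-] /=; rewrite /m /= /pushforward.
rewrite (_ : _ @^-1` _ = `]a - c, b - c]%classic); last first.
  by apply/seteqP; split => x /=; rewrite !in_itv/= ltrBlDr lerBrDr.
rewrite !lebesgue_measure_itv/= !lte_fin ltrD2r; case: ifPn => // _.
by rewrite -!EFinB; congr _%:E; ring.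
Qed.

Lemma lebesgue_rV_cube_fin (R : realType) n k :
  (@lebesgue_rV R n (rV_cube k) < +oo)%E.
Proof.
rewrite (lebesgue_rV_box (A := fun=> `[- k%:R, k%:R]%classic))//.
rewrite ltey_eq; apply/orP; left; elim/big_ind : _ => // [x y|i _].
  by move=> ? ?; rewrite fin_numM.
by rewrite lebesgue_measure_itv/=; case: ifP.
Qed.

Section rV_translate.
Context {R : realType} {n : nat}.
Local Notation V := 'rV[R]_n.

Lemma measurable_translate (a : V) : measurable_fun setT (fun x : V => x + a).
Proof.
apply: measurable_fun_rV => i; under eq_fun do rewrite mxE.
by apply: measurable_funD => //; exact: measurable_coord_rV.
Qed.

Lemma lebesgue_rV_translate (a : V) (A : set V) : measurable A ->
  lebesgue_rV ((fun x => x + a) @^-1` A) = lebesgue_rV A.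
Proof.
move=> mA.
pose m := measure_function_pushforward__canonical__measure_function_Measure
  (@lebesgue_rV R n) (measurable_translate a).
rewrite -[LHS]/(m A); apply/esym.
apply: (@rV_measure_unique R n (@lebesgue_rV R n) m) => // [_ [B mB <-]|k].
  rewrite /m/= /pushforward.
  rewrite (_ : _ @^-1` _ =
    [set v : V | forall i, ((fun x => x + a ord0 i) @^-1` B i) (v ord0 i)]).
    rewrite lebesgue_rV_box//.
    rewrite (lebesgue_rV_box (A := fun i => (fun x => x + a ord0 i) @^-1` B i)).
      by apply: eq_bigr => i _; rewrite lebesgue_measure_shift.
    move=> i; rewrite -[X in measurable X]setTI.
    by apply: measurable_funD => //; exact: mB.
  by apply/seteqP; split => v /= + i => /(_ i); rewrite mxE.
exact: lebesgue_rV_cube_fin.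
Qed.

Definition rV_snoc (z : V * R) : 'rV[R]_(n + 1) := row_mx z.1 (const_mx z.2).

Lemma measurable_rV_snoc : measurable_fun setT rV_snoc.
Proof.
apply: measurable_fun_rV => i; under eq_fun do rewrite mxE.
case: (fintype.split i) => j.
  exact: (measurableT_comp (measurable_coord_rV j) measurable_fst).
by under eq_fun do rewrite mxE; exact: measurable_snd.
Qed.

(** The measure is defined by adding coordinates at the front, while the group law singles
    out the last coordinate; both products agree on boxes. *)
Lemma lebesgue_rV_snoc (A : set 'rV[R]_(n + 1)) : measurable A ->
  lebesgue_rV A =
  (@lebesgue_rV R n \x @lebesgue_measure R)%E (rV_snoc @^-1` A).
Proof.
move=> mA.
pose m := measure_function_pushforward__canonical__measure_function_Measure
  (@lebesgue_rV R n \x @lebesgue_measure R)%E measurable_rV_snoc.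
rewrite -[RHS]/(m A).
apply: (@rV_measure_unique R (n + 1) (@lebesgue_rV R (n + 1)) m) => //; last first.
  exact: lebesgue_rV_cube_fin.
move=> _ [B mB <-]; transitivity (\prod_(i < n + 1) lebesgue_measure (B i))%E.
  exact: lebesgue_rV_box.
rewrite /m/= /pushforward.
rewrite (_ : _ @^-1` _ = [set v : V | forall i, B (lshift 1 i) (v ord0 i)] `*`
  B (rshift n ord0)).
  rewrite product_measure1E; last exact: mB; last first.
    by apply: (@measurable_rV_box R n (fun i => B (lshift 1 i))) => i; exact: mB.
  rewrite big_split_ord/= big_ord1; congr (_ * _)%E.
  by rewrite (lebesgue_rV_box (A := fun i => B (lshift 1 i)))// => i; exact: mB.
apply/seteqP; split => -[v t] /=.
  move=> H; split=> [i|].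
    by have := H (lshift 1 i); rewrite /rV_snoc/= row_mxEl.
  by have := H (rshift n ord0); rewrite /rV_snoc/= row_mxEr mxE.
move=> [H1 H2] i; rewrite /rV_snoc; case: (split_ordP i) => j ->.
  by rewrite row_mxEl; exact: H1.
by rewrite row_mxEr mxE/= (ord1 j).
Qed.

(** Translation of the first n coordinates followed by a shift of the last one which depends
    on them: left and right translations of the group have this form. *)
Definition rV_shear (a : V) (l : V -> R) (v : 'rV[R]_(n + 1)) : 'rV[R]_(n + 1) :=
  rV_snoc (lsubmx v + a, v ord0 (rshift n ord0) + l (lsubmx v)).

Lemma measurable_lsubmx : measurable_fun setT (@lsubmx R 1 n 1).
Proof.
apply: measurable_fun_rV => i; under eq_fun do rewrite mxE.
exact: measurable_coord_rV.
Qed.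

Lemma measurable_rV_shear a l : measurable_fun setT l ->
  measurable_fun setT (rV_shear a l).
Proof.
move=> ml; apply: measurableT_comp; first exact: measurable_rV_snoc.
apply: measurable_fun_pair.
  apply: (measurableT_comp (measurable_translate a)); exact: measurable_lsubmx.
apply: measurable_funD; first exact: measurable_coord_rV.
by apply: measurableT_comp => //; exact: measurable_lsubmx.
Qed.

(** By Tonelli: each section in the last coordinate is only shifted, and the base is
    only translated. *)
Lemma lebesgue_rV_shear a l A : measurable_fun setT l -> measurable A ->
  lebesgue_rV (rV_shear a l @^-1` A) = lebesgue_rV A.
Proof.
move=> ml mA; have mS := measurable_rV_shear a ml.
have mSA : measurable (rV_shear a l @^-1` A).
  by rewrite -[X in measurable X]setTI; exact: mS.
have mJA : measurable (rV_snoc @^-1` A).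
  by rewrite -[X in measurable X]setTI; exact: measurable_rV_snoc.
rewrite (lebesgue_rV_snoc mSA) (lebesgue_rV_snoc mA) /product_measure1.
pose g x := lebesgue_measure (xsection (rV_snoc @^-1` A) x).
have mg : measurable_fun [set: V] g by exact: measurable_fun_xsection.
have g0 x : (0 <= g x)%E by exact: measure_ge0.
rewrite -[RHS]/(\int[@lebesgue_rV R n]_x g x)%E.
rewrite -(ge0_integral_invariant (measurable_translate a) _ mg g0); last first.
  by move=> B mB; exact: lebesgue_rV_translate.
apply: eq_integral => x _; rewrite /g /=.
have mX : measurable (xsection (rV_snoc @^-1` A) (x + a)).
  exact: measurable_xsection.
rewrite -(@lebesgue_measure_shift R (l x) _ mX); congr lebesgue_measure; apply/seteqP; split => t; rewrite /xsection/= !inE/=;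
  rewrite /rV_shear /rV_snoc/= row_mxKl row_mxEr mxE; exact.
Qed.

End rV_translate.

Section heis_measure.
Context {R : realType} {N : nat}.
Local Notation V := 'rV[R]_(N + N + 1).
Implicit Types x y h : V.

(** Half of the standard symplectic form, so that the group law is
    x o y = x + y + symp x y e_tau. *)
Definition symp (x y : V) : R := 2^-1 * \sum_(i < N)
  (hx (lshift N i) x * hx (rshift N i) y - hx (rshift N i) x * hx (lshift N i) y).

Definition etau : V := delta_mx ord0 (rshift (N + N) ord0).

Lemma hmulE x y : hmul x y = x + y + symp x y *: etau.
Proof.
apply/rowP => k; case: (split_ordP k) => j ->; rewrite /hmul.
  rewrite row_mxEl !mxE eqxx /= eq_lrshift mulr0 addr0//.
by rewrite row_mxEr !mxE /htau (ord1 j) !eqxx mulr1.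
Qed.

Lemma hxD (i : 'I_(N + N)) x y : hx i (x + y) = hx i x + hx i y.
Proof. by rewrite /hx !mxE. Qed.

Lemma hxZ (i : 'I_(N + N)) a x : hx i (a *: x) = a * hx i x.
Proof. by rewrite /hx !mxE. Qed.

Lemma hx_etau (i : 'I_(N + N)) : hx i etau = 0.
Proof. by rewrite /hx /etau mxE eqxx/= eq_lrshift. Qed.

Lemma sympDl x y z : symp (x + y) z = symp x z + symp y z.
Proof.
rewrite /symp -mulrDr -big_split/=; congr (_ * _).
by apply: eq_bigr => i _; rewrite !hxD; ring.
Qed.

Lemma sympZl a x z : symp (a *: x) z = a * symp x z.
Proof.
rewrite /symp [RHS]mulrCA; congr (_ * _); rewrite mulr_sumr.
by apply: eq_bigr => i _; rewrite !hxZ; ring.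
Qed.

Lemma symp_sym x y : symp x y = - symp y x.
Proof.
rewrite /symp -mulrN -sumrN; congr (_ * _).
by apply: eq_bigr => i _; rewrite opprB mulrC [hx (lshift N i) y * _]mulrC.
Qed.

Lemma sympDr x y z : symp x (y + z) = symp x y + symp x z.
Proof. by rewrite symp_sym sympDl opprD -!symp_sym. Qed.

Lemma sympZr a x z : symp x (a *: z) = a * symp x z.
Proof. by rewrite symp_sym sympZl -mulrN -symp_sym. Qed.

Lemma symp_etaul x : symp etau x = 0.
Proof.
by rewrite /symp big1 ?mulr0// => i _; rewrite !hx_etau !mul0r subrr.
Qed.

Lemma symp_etaur x : symp x etau = 0.
Proof. by rewrite symp_sym symp_etaul oppr0. Qed.

Lemma sympNl x y : symp (- x) y = - symp x y.
Proof. by rewrite -scaleN1r sympZl mulN1r. Qed.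

Lemma sympNr x y : symp x (- y) = - symp x y.
Proof. by rewrite -scaleN1r sympZr mulN1r. Qed.

Lemma sympxx x : symp x x = 0.
Proof. by have := symp_sym x x; lra. Qed.

Definition sympE := (sympDl, sympDr, sympZl, sympZr, sympNl, sympNr, symp_etaul, symp_etaur, sympxx).

Lemma hmulA x y z : hmul x (hmul y z) = hmul (hmul x y) z.
Proof.
rewrite !hmulE !sympE !mulr0 !addr0.
apply/rowP => k; rewrite !mxE; ring.
Qed.

Lemma hmul0x x : hmul 0 x = x.
Proof. by rewrite hmulE add0r -(scale0r x) sympZl mul0r scale0r addr0. Qed.

Lemma hmulx0 x : hmul x 0 = x.
Proof. by rewrite hmulE addr0 -(scale0r x) sympZr mul0r scale0r addr0. Qed.

Lemma hmulNx x : hmul (- x) x = 0.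
Proof. by rewrite hmulE sympNl sympxx oppr0 scale0r addNr addr0. Qed.

Lemma hmulxN x : hmul x (- x) = 0.
Proof. by rewrite hmulE sympNr sympxx oppr0 scale0r subrr addr0. Qed.

Lemma hmulKx x y : hmul (- x) (hmul x y) = y.
Proof. by rewrite hmulA hmulNx hmul0x. Qed.

Lemma hmulxK x y : hmul (hmul y x) (- x) = y.
Proof. by rewrite -hmulA hmulxN hmulx0. Qed.

Lemma hmulNKx x y : hmul x (hmul (- x) y) = y.
Proof. by rewrite hmulA hmulxN hmul0x. Qed.

Lemma measurable_hx (i : 'I_(N + N)) : measurable_fun [set: V] (hx i).
Proof. exact: measurable_coord_rV. Qed.

Lemma measurable_symp d (T : measurableType d) (F G : T -> V) :
  measurable_fun setT F -> measurable_fun setT G ->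
  measurable_fun setT (fun t => symp (F t) (G t)).
Proof.
move=> mF mG; apply: measurable_funM => //.
have H (i : 'I_(N + N)) (K : T -> V) : measurable_fun setT K ->
    measurable_fun setT (fun t => hx i (K t)).
  by move=> mK; apply: measurableT_comp => //; exact: measurable_hx.
apply: measurable_sum => i.
by apply: measurable_funB; apply: measurable_funM; exact: H.
Qed.

Lemma measurable_hmul d (T : measurableType d) (F G : T -> V) :
  measurable_fun setT F -> measurable_fun setT G ->
  measurable_fun setT (fun t => hmul (F t) (G t)).
Proof.
move=> mF mG; apply: measurable_fun_rV => i.
have H (K : T -> V) : measurable_fun setT K -> measurable_fun setT (fun t => K t ord0 i).
  by move=> mK; exact: (measurableT_comp (measurable_coord_rV i) mK).
under eq_fun do rewrite hmulE !mxE.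
apply: measurable_funD; first by apply: measurable_funD; exact: H.
by apply: measurable_funM => //; exact: measurable_symp.
Qed.

Let shearE a l x : rV_shear a l x = x + row_mx a (const_mx (l (lsubmx x))).
Proof.
apply/rowP => k; rewrite /rV_shear /rV_snoc/=; case: (split_ordP k) => j ->.
  by rewrite row_mxEl [RHS]mxE row_mxEl !mxE.
by rewrite row_mxEr [RHS]mxE row_mxEr !mxE (ord1 j).
Qed.

(** Lebesgue measure is a left Haar measure since x |-> h o x is a shear. *)
Lemma mu_heis_lmul h A : measurable A -> mu_heis ((hmul h) @^-1` A) = mu_heis A.
Proof.
move=> mA; pose l (v : 'rV[R]_(N + N)) := htau h + symp h (row_mx v 0).
have -> : hmul h = rV_shear (lsubmx h) l.
  apply/funext => x; rewrite shearE hmulE /l.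
  have -> : symp h (row_mx (lsubmx x) 0) = symp h x.
    by rewrite /symp /hx; congr (_ * _); apply: eq_bigr => i _; rewrite !row_mxEl !mxE.
  apply/rowP => k; rewrite !mxE; case: splitP => j kj.
    rewrite !mxE eqxx/=; have -> : k = lshift 1 j by exact: val_inj.
    by rewrite eq_lrshift mulr0 addr0 addrC.
  rewrite !mxE eqxx /=; have -> : k = rshift (N + N) j by exact: val_inj.
  by rewrite (ord1 j) eqxx /htau mulr1 -addrA addrCA.
apply: lebesgue_rV_shear => //.
apply: measurable_funD => //; apply: measurable_symp => //.
apply: measurable_fun_rV => i; under eq_fun do rewrite mxE.
case: (fintype.split i) => j; first exact: measurable_coord_rV.
exact: measurable_cst.
Qed.

Lemma hmul_opp x y : hmul x y = - hmul (- y) (- x).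
Proof. by rewrite !hmulE !sympE symp_sym; apply/rowP => k; rewrite !mxE; ring. Qed.

(** The group is unimodular: right translations are shears as well. *)
Lemma mu_heis_rmul h A : measurable A -> mu_heis ((hmul^~ h) @^-1` A) = mu_heis A.
Proof.
move=> mA; pose l (v : 'rV[R]_(N + N)) := htau h - symp h (row_mx v 0).
have -> : hmul^~ h = rV_shear (lsubmx h) l.
  apply/funext => x; rewrite shearE hmulE /l.
  have -> : symp h (row_mx (lsubmx x) 0) = symp h x.
    by rewrite /symp /hx; congr (_ * _); apply: eq_bigr => i _; rewrite !row_mxEl !mxE.
  rewrite (symp_sym x h).
  apply/rowP => k; rewrite !mxE; case: splitP => j kj.
    rewrite !mxE eqxx/=; have -> : k = lshift 1 j by exact: val_inj.
    by rewrite eq_lrshift mulr0 addr0.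
  rewrite !mxE eqxx /=; have -> : k = rshift (N + N) j by exact: val_inj.
  by rewrite (ord1 j) eqxx /htau mulr1 -addrA.
apply: lebesgue_rV_shear => //.
apply: measurable_funB => //; apply: measurable_symp => //.
apply: measurable_fun_rV => i; under eq_fun do rewrite mxE.
case: (fintype.split i) => j; first exact: measurable_coord_rV.
exact: measurable_cst.
Qed.

Lemma measurable_lmul h : measurable_fun [set: V] (hmul h).
Proof. exact: measurable_hmul. Qed.

Lemma measurable_rmul h : measurable_fun [set: V] (hmul^~ h).
Proof. exact: measurable_hmul. Qed.

Lemma ge0_integral_lmul h (F : V -> \bar R) : measurable_fun setT F ->
  (forall x, (0 <= F x)%E) ->
  (\int[mu_heis]_x F (hmul h x) = \int[mu_heis]_x F x)%E.
Proof.
by move=> mF F0; apply: ge0_integral_invariant => //;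
  [exact: measurable_lmul|exact: mu_heis_lmul].
Qed.

Lemma integral_rmul h (F : V -> \bar R) : measurable_fun setT F ->
  (\int[mu_heis]_x F (hmul x h) = \int[mu_heis]_x F x)%E.
Proof.
by move=> mF; apply: (integral_invariant (measurable_rmul h)) => //;
  exact: mu_heis_rmul.
Qed.

Lemma mu_heis_bounded (A : set V) : measurable A -> bounded_set A ->
  (mu_heis A < +oo)%E.
Proof.
move=> mA [M [Mr HM]].
pose k := (Num.truncn (M + 1)).+1.
apply: (@le_lt_trans _ _ (mu_heis (@rV_cube R _ k))); last exact: lebesgue_rV_cube_fin.
apply: le_measure; rewrite ?inE//.
  by rewrite rV_measurable_boxes; apply: sub_sigma_algebra; exact: rV_cube_boxes.
move=> x Ax; apply/rV_cubeP; apply: (HM k%:R) => //.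
by rewrite (lt_trans _ (truncnS_gt _))// ltrDl.
Qed.

End heis_measure.

(** * Functions of class C^k and the horizontal fields *)

Lemma continuous_sumr (R : realType) (T : topologicalType) (I : Type) (r : seq I)
    (F : I -> T -> R) :
  (forall i, continuous (F i)) -> continuous (fun x => \sum_(i <- r) F i x).
Proof.
move=> cF; apply: continuous_big => //; exact: add_continuous.
Qed.

Section continuous_operations.
Context {R : realType} {T : topologicalType}.
Implicit Types A B : T -> R.

Lemma ctsD A B : continuous A -> continuous B -> continuous (fun t => A t + B t).
Proof. by move=> cA cB t; exact: (cvgD (cA t) (cB t)). Qed.

Lemma ctsB A B : continuous A -> continuous B -> continuous (fun t => A t - B t).
Proof. by move=> cA cB t; exact: (cvgB (cA t) (cB t)). Qed.

Lemma ctsM A B : continuous A -> continuous B -> continuous (fun t => A t * B t).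
Proof. by move=> cA cB t; exact: (cvgM (cA t) (cB t)). Qed.

Lemma ctsN A : continuous A -> continuous (fun t => - A t).
Proof. by move=> cA t; exact: (cvgN (cA t)). Qed.

Lemma cts_cst (c : R) : continuous (fun _ : T => c).
Proof. by move=> t; exact: cvg_cst. Qed.

End continuous_operations.

Section line.
Context {R : realType} {V : normedModType R}.
Implicit Types (f : V -> R) (v y : V).

Lemma line_quotient f y v (s : R) :
  (fun h : R => h^-1 *: (((fun t : R => f (t *: v + y)) \o shift s) (h *: (1 : R))
     - f (s *: v + y))) =
  (fun h : R => h^-1 *: ((f \o shift (s *: v + y)) (h *: v) - f (s *: v + y))).
Proof.
by apply/funext => h /=; rewrite [h *: 1]mulr1 scalerDl addrA.
Qed.

Lemma line_derivable f y v s :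
  derivable f (s *: v + y) v -> derivable (fun t : R => f (t *: v + y)) s 1.
Proof.
by rewrite /derivable line_quotient.
Qed.

Lemma line_derive f y v s :
  'D_1 (fun t : R => f (t *: v + y)) s = 'D_v f (s *: v + y).
Proof.
by rewrite /derive line_quotient.
Qed.

(** Mean value theorem along a line, also for negative times. *)
Lemma MVT_line f v y t : (forall z, derivable f z v) ->
  exists2 c : R, `|c| <= `|t| & f (t *: v + y) - f y = t * 'D_v f (c *: v + y).
Proof.
move=> df; pose g (s : R) := f (s *: v + y).
have dg s : derivable g s 1 by exact: line_derivable.
have isd s : is_derive s (1 : R) g ('D_v f (s *: v + y)).
  by apply: DeriveDef => //; rewrite line_derive.
have cg : continuous g.
  by move=> s; apply: differentiable_continuous; exact/derivable1_diffP.
have cw a b : {within `[a, b], continuous g} by exact: continuous_subspaceT.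
have g0 : g 0 = f y by rewrite /g scale0r add0r.
have [t0|t0] := leP 0 t.
  have [c cI E] := MVT_segment t0 (fun x _ => isd x) (cw 0 t).
  exists c; last by rewrite -/(g t) -g0 E subr0 mulrC.
  by move: cI; rewrite in_itv/= => /andP[c0 ct]; rewrite !ger0_norm.
have [c cI E] := MVT_segment (ltW t0) (fun x _ => isd x) (cw t 0).
exists c.
  by move: cI; rewrite in_itv/= => /andP[tc c0]; rewrite !ler0_norm ?lerN2// ltW.
by rewrite -/(g t) -g0 -[LHS]opprB E sub0r mulrN opprK mulrC.
Qed.

End line.

Section C1_differentiable.
Context {R : realType} {n : nat}.
Local Notation V := 'rV[R]_n.
Implicit Types f : V -> R.

Lemma cd_continuous k f : cd k f -> continuous f.
Proof. by case: k => [|k] []. Qed.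

Lemma cdS k f : cd k.+1 f -> cd k f.
Proof.
elim: k f => [|k IHk] f [cf df]; split => // i.
by have [H1 H2] := df i; split => //; exact: IHk.
Qed.

Lemma cd_le k m f : (k <= m)%N -> cd m f -> cd k f.
Proof.
elim: m => [|m IHm]; first by rewrite leqn0 => /eqP ->.
by rewrite leq_eqVlt => /predU1P[->//|km] /cdS; exact: IHm.
Qed.

(** First-order expansion with uniform remainder: move from x to x + h one coordinate at a
    time and apply the mean value theorem to each step. *)
Lemma C1_approx f (x : V) (e : R) : cd 1 f -> 0 < e ->
  \forall h \near (0 : V), `|f (h + x) - f x - \sum_i h ord0 i * partial i f x|
    <= e * `|h|.
Proof.
move=> [_ df] e0.
pose e' := e / n.+1%:R; have e'0 : 0 < e' by rewrite divr_gt0.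
have H : \forall y \near x, forall i : 'I_n, `|partial i f x - partial i f y| < e'.
  suff H' : forall i : 'I_n, \forall y \near x, `|partial i f x - partial i f y| < e'.
    exact: (filter_forall (f := fun i y => `|partial i f x - partial i f y| < e') _ H').
  move=> i; have [_ [/(_ x) /cvgrPdist_lt ci _]] := df i.
  exact: ci.
have /nbhs_ballP[d /= d0 dH] := H.
near=> h.
have hd : `|h| < d.
  near: h; apply/nbhs_ballP; exists d => // z.
  by rewrite -ball_normE /= sub0r normrN.
pose u (k : nat) : V := \row_i (if (i < k)%N then h ord0 i else 0).
have u0 : u 0%N = 0 by apply/rowP => i; rewrite !mxE.
have un : u n = h by apply/rowP => i; rewrite !mxE ltn_ord.
have uS (k : 'I_n) : u k.+1 = h ord0 k *: delta_mx ord0 k + u k.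
  apply/rowP => i; rewrite !mxE eqxx/= ltnS leq_eqVlt.
  rewrite -val_eqE/=; have [/val_inj ->|ik] := eqVneq (i : nat) k; last by rewrite mulr0 add0r.
  by rewrite ltnn mulr1 addr0.
have ukd (k : 'I_n) c : `|c| <= `|h ord0 k| -> `|c *: delta_mx ord0 k + u k| <= `|h|.
  move=> ck; apply: rV_norm_le => // i; rewrite !mxE eqxx/=.
  have [->|ik] := eqVneq i k; last first.
    rewrite mulr0 add0r; case: ifP => _; last by rewrite normr0.
    exact: ler_coord_norm.
  by rewrite mulr1 ltnn addr0 (le_trans ck)// ler_coord_norm.
have -> : f (h + x) - f x = \sum_(i < n) (f (u i.+1 + x) - f (u i + x)).
  rewrite -(big_mkord xpredT (fun i => f (u i.+1 + x) - f (u i + x))).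
  by rewrite telescope_sumr// un u0 add0r.
rewrite -sumrB (le_trans (ler_norm_sum _ _ _))//.
have -> : e * `|h| = \sum_(i < n.+1) e' * `|h|.
  rewrite sumr_const card_ord -[RHS]mulr_natr /e' mulrAC -mulrA.
  by rewrite mulrA divfK// pnatr_eq0.
rewrite big_ord_recr/= -[leLHS]addr0 lerD//; last by rewrite mulr_ge0// ltW.
apply: ler_sum => i _.
have dfi z : derivable f z (delta_mx ord0 i) by have [+ _] := df i; exact.
have [c ci] := MVT_line (u i + x) (h ord0 i) dfi.
rewrite addrA -uS => ->; rewrite -mulrBr normrM mulrC.
rewrite ler_pM//; last exact: ler_coord_norm.
rewrite -/(partial i f _) distrC ltW// addrA; apply: dH.
rewrite -ball_normE /= opprD addrCA subrr addr0 normrN.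
exact: le_lt_trans (ukd _ _ ci) hd.
Unshelve. all: by end_near. Qed.

(** Continuous partial derivatives give a total derivative, hence linear dependence of the
    directional derivatives on the direction. *)
Lemma C1_differentiable f x : cd 1 f ->
  differentiable f x /\ forall w, 'd f x w = \sum_i w ord0 i * partial i f x.
Proof.
move=> cf.
have @L : {linear V -> R}.
  exists (fun w : V => \sum_i w ord0 i * partial i f x).
  do 2![eexists]; do ?[constructor].
  - by apply: big1 => i _; rewrite mxE mul0r.
  - move=> a b /=; rewrite -big_split/=; apply: eq_bigr => i _.
    by rewrite mxE mulrDl.
  - move=> a b /=; rewrite scaler_sumr; apply: eq_bigr => i _.
    by rewrite mxE -scalerAl.
have cL : continuous L.
  apply: continuous_sumr => i y.
  exact: (cvgM (@continuous_coord R n i y) (cvg_cst _)).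
have E : f \o shift x = cst (f x) + L +o_ 0 id.
  apply/eqaddoP => e e0; near=> h.
  rewrite /= !fctE /= opprD addrA; near: h.
  exact: C1_approx.
have dE := diff_unique cL E.
split; last by move=> w; rewrite dE.
by apply/diff_locallyP; rewrite dE.
Unshelve. all: by end_near. Qed.

Lemma C1_derivable f x w : cd 1 f -> derivable f x w.
Proof. by move=> /C1_differentiable -/(_ x)[d _]; exact: diff_derivable. Qed.

Lemma C1_deriveE f x w : cd 1 f -> 'D_w f x = \sum_i w ord0 i * partial i f x.
Proof. by move=> /C1_differentiable -/(_ x)[d <-]; rewrite deriveE. Qed.

End C1_differentiable.

Section closure_properties.
Context {R : realType} {n : nat}.
Local Notation V := 'rV[R]_n.
Implicit Types f g : V -> R.

Lemma cd_cst k (c : R) : cd k (fun _ : V => c).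
Proof.
elim: k c => [|k IHk] c; split; rewrite //; try exact: cst_continuous.
move=> i; split; first by move=> x; exact: derivable_cst.
rewrite (_ : partial i _ = fun=> 0); first exact: IHk.
by apply/funext => x; rewrite /partial derive_cst.
Qed.

Lemma cdD k f g : cd k f -> cd k g -> cd k (fun x => f x + g x).
Proof.
elim: k f g => [|k IHk] f g [cf df] [cg dg]; split => //.
- by move=> x; exact: (cvgD (cf x) (cg x)).
- by move=> x; exact: (cvgD (cf x) (cg x)).
move=> i; have [dfi pfi] := df i; have [dgi pgi] := dg i; split.
  by move=> x; exact: derivableD.
rewrite (_ : partial i _ = fun x => partial i f x + partial i g x); first exact: IHk.
by apply/funext => x; rewrite /partial deriveD.
Qed.

Lemma cdM k f g : cd k f -> cd k g -> cd k (fun x => f x * g x).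
Proof.
elim: k f g => [|k IHk] f g [cf df] [cg dg]; split => //.
- by move=> x; exact: (cvgM (cf x) (cg x)).
- by move=> x; exact: (cvgM (cf x) (cg x)).
move=> i; have [dfi pfi] := df i; have [dgi pgi] := dg i; split.
  by move=> x; exact: derivableM.
rewrite (_ : partial i _ = fun x => f x * partial i g x + g x * partial i f x).
  by apply: cdD; apply: IHk => //; apply: cdS; split.
by apply/funext => x; rewrite /partial deriveM.
Qed.

Lemma cdZ k (c : R) f : cd k f -> cd k (fun x => c * f x).
Proof. by move=> cf; apply: cdM => //; exact: cd_cst. Qed.

Lemma cdN k f : cd k f -> cd k (fun x => - f x).
Proof.
move=> /(cdZ (-1)); congr (cd _ _); apply/funext => x; exact: mulN1r.
Qed.

Lemma cdB k f g : cd k f -> cd k g -> cd k (fun x => f x - g x).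
Proof. by move=> cf cg; apply: cdD => //; exact: cdN. Qed.

Lemma cd_sum k (I : Type) (r : seq I) (F : I -> V -> R) :
  (forall i, cd k (F i)) -> cd k (fun x => \sum_(i <- r) F i x).
Proof.
move=> cF; elim: r => [|a r IHr].
  rewrite (_ : (fun _ => _) = fun=> 0); first exact: cd_cst.
  by apply/funext => x; rewrite big_nil.
rewrite (_ : (fun _ => _) = fun x => F a x + \sum_(i <- r) F i x).
  exact: cdD.
by apply/funext => x; rewrite big_cons.
Qed.

Lemma cd_coord k (i : 'I_n) : cd k (fun x : V => x ord0 i).
Proof.
case: k => [|k]; split => //; try exact: continuous_coord.
move=> j; split => [x|]; first exact/diff_derivable/differentiable_coord.
rewrite (_ : partial j _ = fun=> (delta_mx ord0 j : V) ord0 i); first exact: cd_cst.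
apply/funext => x; rewrite /partial /derive.
apply/cvg_lim => //.
suff E : {near (0 : R)^', cst ((delta_mx ord0 j : V) ord0 i) =1 (fun h : R => h^-1 *: (((fun x0 : V => x0 ord0 i) \o shift x) (h *: (delta_mx ord0 j : V)) - x ord0 i))}.
  exact: (cvg_trans (near_eq_cvg E) (cvg_cst _)).
near=> h => /=.
have h0 : h != 0 by near: h; exact: nbhs_dnbhs_neq.
rewrite mxE [in RHS]mxE addrK mxE.
by rewrite [RHS](mulKf h0) mxE.
Unshelve. all: by end_near. Qed.

Lemma cdV k f : (forall x, f x != 0) -> cd k f -> cd k (fun x => (f x)^-1).
Proof.
move=> f0; elim: k => [|k IHk] [cf df]; split => //.
- by move=> x; exact: (cvgV (f0 x) (cf x)).
- by move=> x; exact: (cvgV (f0 x) (cf x)).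
move=> i; have [dfi pfi] := df i; split.
  by move=> x; exact: derivableV.
rewrite (_ : partial i _ = fun x => - ((f x)^-1 * (f x)^-1 * partial i f x)).
  have cfk : cd k f by apply: cdS; split.
  by apply: cdN; apply: cdM => //; apply: cdM; exact: IHk.
apply/funext => x; rewrite /partial deriveV//.
by rewrite -exprVn expr2 -[RHS]mulNr.
Qed.

Lemma partial_comp1 (phi : R -> R) f i x :
  derivable f x (delta_mx ord0 i : V) -> derivable phi (f x) 1 ->
  derivable (phi \o f) x (delta_mx ord0 i : V) /\
  partial i (phi \o f) x = 'D_1 phi (f x) * partial i f x.
Proof.
move=> df dphi; set e : V := delta_mx ord0 i.
pose g (t : R) := f (t *: e + x).
have g0 : g 0 = f x by rewrite /g scale0r add0r.
have dg : derivable g (0 : R) (1 : R).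
  by apply: (@line_derivable _ _ f x e 0); rewrite scale0r add0r.
have dphi' : derivable phi (g 0) 1 by rewrite g0.
have dc : derivable (phi \o g) (0 : R) (1 : R).
  apply/derivable1_diffP; apply: differentiable_comp.
    exact/derivable1_diffP.
  exact/derivable1_diffP.
split.
  move: dc; rewrite /derivable.
  by rewrite (line_quotient (phi \o f) x e 0) scale0r add0r.
have := derive1_comp dg dphi'; rewrite !derive1E g0.
have -> : 'D_1 g 0 = partial i f x by rewrite line_derive scale0r add0r.
by move=> <-; rewrite /partial (line_derive (phi \o f)) scale0r add0r.
Qed.

Lemma cd_comp_sub k m (f : 'rV[R]_m -> R) (A : V -> 'rV[R]_m) (L : V -> 'rV[R]_m) :
  (forall t v x, A (t *: v + x) = t *: L v + A x) -> continuous A ->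
  cd k f -> cd k (f \o A).
Proof.
move=> AL cA; elim: k f => [|k IHk] f [cf df]; split => //.
- by move=> x; apply: continuous_comp; [exact: cA|exact: cf].
- by move=> x; apply: continuous_comp; [exact: cA|exact: cf].
have c1 : cd 1 f by apply: (@cd_le _ _ _ k.+1) => //; split.
have E x v : (fun h : R => h^-1 *: ((f \o A \o shift x) (h *: v) - (f \o A) x)) =
    (fun h : R => h^-1 *: ((f \o shift (A x)) (h *: L v) - f (A x))).
  by apply/funext => h /=; rewrite AL.
move=> i; split.
  by move=> x; rewrite /derivable E; exact: C1_derivable.
rewrite (_ : partial i _ =
  fun x => \sum_j (L (delta_mx ord0 i)) ord0 j * (partial j f \o A) x).
  apply: cd_sum => j; apply: cdZ; apply: IHk; exact: (df j).2.
by apply/funext => x; rewrite /partial /derive E -/(derive _ _ _) C1_deriveE.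
Qed.

End closure_properties.

Section bump.
Context {R : realType}.

(** The functions t^-m exp(-1/t), extended by 0 to t <= 0.  They are closed under
    differentiation up to linear combinations, which makes smoothness an induction. *)
Definition flat (m : nat) (t : R) : R :=
  if 0 < t then t^-1 ^+ m * expR (- t^-1) else 0.

Lemma flat_ge0 m t : 0 <= flat m t.
Proof.
by rewrite /flat; case: ifP => // t0; rewrite mulr_ge0 ?expR_ge0// exprn_ge0// invr_ge0 ltW.
Qed.

Lemma flat0_gt0 t : (0 < flat 0 t) = (0 < t).
Proof. by rewrite /flat; case: ifP => // t0; rewrite ?ltxx// expr0 mul1r expR_gt0. Qed.

(** Quadratic decay at 0, enough for differentiability there: exp(y) >= (y/k)^k with
    k = m + 2. *)
Lemma flat_le m : exists2 C : R, 0 < C & forall t, flat m t <= C * t ^+ 2.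
Proof.
exists (m.+2%:R ^+ m.+2) => [|t]; first by rewrite exprn_gt0.
rewrite /flat; case: ifP => [t0|]; last by rewrite mulr_ge0// ?sqr_ge0 ?exprn_ge0.
pose y := t^-1; have y0 : 0 < y by rewrite invr_gt0.
have H : (y / m.+2%:R) ^+ m.+2 <= expR y.
  have -> : expR y = expR (y / m.+2%:R) ^+ m.+2.
    by rewrite -expRM_natr divfK.
  rewrite lerXn2r ?nnegrE ?expR_ge0 ?divr_ge0 ?ltW//.
  by rewrite (le_lt_trans _ (expR_gt1Dx _))// ?lerDr// gt_eqF// divr_gt0.
rewrite -/y expRN ler_pdivrMr ?expR_gt0//.
have -> : y ^+ m = m.+2%:R ^+ m.+2 * t ^+ 2 * (y / m.+2%:R) ^+ m.+2.
  have K0 : (m.+2%:R ^+ m.+2 : R) != 0 by rewrite expf_neq0// pnatr_eq0.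
  rewrite expr_div_n [RHS]mulrC mulrA divfK// -[t]invrK -/y exprVn.
  rewrite -[in RHS](addn2 m) exprD /y -mulrA exprVn -exprMn invrK mulVf ?gt_eqF//.
  by rewrite expr1n mulr1.
by rewrite ler_wpM2l// mulr_ge0 ?exprn_ge0 ?sqr_ge0// ltW.
Qed.

Lemma derive_powexp m (G : R -> R) (t : R) : derivable G t 1 ->
  derivable (fun s => G s ^+ m * expR (- G s)) t 1 /\
  'D_1 (fun s => G s ^+ m * expR (- G s)) t =
  (m%:R * G t ^+ m.-1 - G t ^+ m) * expR (- G t) * 'D_1 G t.
Proof.
move=> dG.
have dX : derivable (G ^+ m) t 1 by exact: derivableX.
have dN : derivable (- G) t 1 by exact: derivableN.
have dx : derivable expR ((- G) t) 1 by exact: derivable_expR.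
have dE : derivable (expR \o (- G)) t 1.
  apply/derivable1_diffP; apply: differentiable_comp; exact/derivable1_diffP.
have E : (fun s => G s ^+ m * expR (- G s)) = (G ^+ m) * (expR \o (- G)).
  by apply/funext => s /=; rewrite [RHS]/GRing.mul/= exprfctE.
have HM := deriveM dX dE; have HdM := derivableM dX dE.
rewrite -E in HM HdM; split; first exact: HdM.
rewrite {}HM (deriveX _ dG) -[X in _ *: X + _]derive1E (derive1_comp dN dx).
rewrite !derive1E (deriveN dG) (derive_val (is_derive := is_derive_expR _)) /GRing.scale/= exprfctE.
rewrite [X in expR X](_ : _ = - G t)//; ring.
Qed.

Lemma is_derive_flat m (t : R) :
  is_derive t (1 : R) (flat m) (flat m.+2 t - m%:R * flat m.+1 t).
Proof.
have [t0|t0|t0] := ltgtP 0 t; last (rewrite -{t}t0).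
- have E : \near t, t^-1 ^+ m * expR (- t^-1) = flat m t.
    near=> s; rewrite /flat; suff -> : 0 < s by [].
    by near: s; exact: lt_nbhsr.
  apply: near_eq_is_derive E _.
  have ? : t != 0 by rewrite gt_eqF.
  have dG : derivable (fun s : R => s^-1) t 1.
    by apply: derivableV; [|exact: derivable_id].
  have vG : 'D_1 (fun s : R => s^-1) t = - t^-1 ^+ 2.
    rewrite deriveV; [|by []|exact: derivable_id].
    by rewrite derive_id -exprVn [_ *: _]mulr1.
  have [dF vF] := derive_powexp m dG.
  apply: DeriveDef; first exact: dF.
  rewrite vF vG /flat t0 /=.
  by case: (m) => [|k]; rewrite ?mul0r /= !exprS; ring.
- have E : \near t, (cst (0 : R)) t = flat m t.
    near=> s; rewrite /flat; case: ifPn => // s0; exfalso; move: s0; apply/negP.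
    by rewrite -leNgt ltW//; near: s; exact: lt_nbhsl.
  apply: near_eq_is_derive E _; rewrite /flat !ltNge ltW//=.
  by rewrite mulr0 subrr; exact: is_derive_cst.
rewrite /flat ltxx mulr0 subrr -/(flat m).
have [C C0 HC] := flat_le m.
have L : h^-1 *: ((flat m \o shift 0) (h *: (1 : R)) - flat m 0) @[h --> (0 : R)^'] --> (0 : R).
  apply/cvgrPdist_le => e e0; have eC0 : 0 < e / C by rewrite divr_gt0.
  near=> h; have h0 : h != 0 by near: h; exact: nbhs_dnbhs_neq.
  rewrite sub0r normrN /= [h *: 1]mulr1 addr0 {2}/flat ltxx subr0.
  rewrite normrM normfV ler_pdivrMl ?normr_gt0// (ger0_norm (flat_ge0 _ _)).
  rewrite (le_trans (HC h))// -real_normK ?num_real// expr2 mulrA [leRHS]mulrC ler_wpM2r//.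
  rewrite mulrC -ler_pdivlMr//.
  by near: h; exact: dnbhs0_le.
apply: DeriveDef; first by apply/cvg_ex; exists 0.
exact/cvg_lim.
Unshelve. all: by end_near. Qed.

Context {n : nat}.
Local Notation V := 'rV[R]_n.

Lemma cd_flat k m (f : V -> R) : cd k f -> cd k (fun x => flat m (f x)).
Proof.
have df t : derivable (flat m) t 1 by have := is_derive_flat m t; case.
have cflat m' : continuous (flat m').
  move=> t; apply/differentiable_continuous/derivable1_diffP.
  by have := is_derive_flat m' t; case.
elim: k m f df => [|k IHk] m f df [cf pf]; split => //.
- by move=> x; apply: continuous_comp; [exact: cf|exact: cflat].
- by move=> x; apply: continuous_comp; [exact: cf|exact: cflat].
move=> i; have [pfi pfi'] := pf i; split.
  by move=> x; have [] := partial_comp1 (pfi x) (df (f x)).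
rewrite (_ : partial i _ =
  fun x => (flat m.+2 (f x) - m%:R * flat m.+1 (f x)) * partial i f x).
  have dflat m' t : derivable (flat m') t 1 by have := is_derive_flat m' t; case.
  have fk : cd k f by apply: cdS; split.
  apply: cdM => //; apply: cdB; first exact: IHk.
  by apply: cdZ; exact: IHk.
apply/funext => x; have [_] := partial_comp1 (pfi x) (df (f x)).
by rewrite /comp => ->; congr (_ * _); have := is_derive_flat m (f x); case.
Qed.

Definition bump (r : R) (c x : V) : R :=
  flat 0 (r ^+ 2 - \sum_i (x ord0 i - c ord0 i) ^+ 2).

Lemma smooth_bump r c : smooth (bump r c).
Proof.
move=> k; apply: cd_flat; apply: cdB; first exact: cd_cst.
apply: cd_sum => i.
have cdi : cd k (fun x : V => x ord0 i - c ord0 i).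
  by apply: cdB; [exact: cd_coord|exact: cd_cst].
have := cdM cdi cdi; congr (cd _ _); apply/funext => x; by rewrite expr2.
Qed.

Lemma bump_ge0 r c x : 0 <= bump r c x. Proof. exact: flat_ge0. Qed.

Lemma bump_center r c : 0 < r -> 0 < bump r c c.
Proof.
move=> r0; rewrite /bump flat0_gt0 big1 ?subr0 ?exprn_gt0// => i _.
by rewrite subrr expr0n.
Qed.

Lemma bump_support r c x : 0 < r -> bump r c x != 0 -> `|x - c| < r.
Proof.
move=> r0; rewrite neq_lt ltNge bump_ge0/= /bump flat0_gt0 subr_gt0 => H.
apply: rV_norm_lt => // i; rewrite !mxE.
rewrite -ltr_sqr ?nnegrE ?normr_ge0 ?ltW// real_normK ?num_real//.
apply: le_lt_trans H; rewrite (bigD1 i)//= lerDl sumr_ge0// => j _.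
exact: sqr_ge0.
Qed.

End bump.

Section horizontal.
Context {R : realType} {N : nat}.
Local Notation V := 'rV[R]_(N + N + 1).
Implicit Types (f : V -> R) (x y v : V).

Definition evec (i : 'I_(N + N)) : V := delta_mx ord0 (lshift 1 i).

(** Velocity at x of the curve t |-> x o (t e_i). *)
Definition xdir (i : 'I_(N + N)) x : V := evec i + symp x (evec i) *: etau.

Lemma symp_evec x i : symp x (evec i) =
  match fintype.split i with
  | inl j => - (hx (rshift N j) x / 2)
  | inr j => hx (lshift N j) x / 2
  end.
Proof.
have E (k : 'I_(N + N)) : hx k (evec i) = (k == i)%:R.
  by rewrite /hx /evec mxE eqxx/= (inj_eq (@lshift_inj _ _)).
rewrite /symp; case: split_ordP => j ij; rewrite ij in E *.
  rewrite (bigD1 j)//= big1 ?addr0 => [|k kj].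
    by rewrite !E eqxx eq_rlshift mulr0 mulr1 sub0r mulrN mulrC.
  by rewrite !E eq_rlshift (inj_eq (@lshift_inj _ _)) (negbTE kj) !mulr0 subrr.
rewrite (bigD1 j)//= big1 ?addr0 => [|k kj].
  by rewrite !E eqxx eq_lrshift mulr0 mulr1 subr0 mulrC.
by rewrite !E eq_lrshift (inj_eq (@rshift_inj _ _)) (negbTE kj) !mulr0 subrr.
Qed.

Lemma deriveDZ f x v w (c : R) : cd 1 f ->
  'D_(v + c *: w) f x = 'D_v f x + c * 'D_w f x.
Proof.
move=> cf; rewrite !C1_deriveE// mulr_sumr -big_split/=; apply: eq_bigr => i _.
by rewrite !mxE mulrDl mulrA.
Qed.

(** The field X_i is the derivative in the direction xdir i x; this needs the linearity of
    the differential, hence class C^1. *)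
Lemma XfieldE i f x : cd 1 f -> Xfield i f x = 'D_(xdir i x) f x.
Proof.
move=> cf; rewrite deriveDZ// symp_evec /Xfield /partial_tau /partial.
by case: (fintype.split i).
Qed.

Lemma continuous_hx (i : 'I_(N + N)) : continuous (@hx R N i).
Proof. exact: continuous_coord. Qed.

Lemma continuous_symp (T : topologicalType) (F G : T -> V) :
  continuous F -> continuous G -> continuous (fun t => symp (F t) (G t)).
Proof.
move=> cF cG.
have H (i : 'I_(N + N)) (K : T -> V) : continuous K -> continuous (fun t => hx i (K t)).
  by move=> cK t; apply: continuous_comp; [exact: cK|exact: continuous_hx].
apply: ctsM; first exact: cts_cst.
by apply: continuous_sumr => i; apply: ctsB; apply: ctsM; exact: H.
Qed.

Lemma continuous_hmul (T : topologicalType) (F G : T -> V) :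
  continuous F -> continuous G -> continuous (fun t => hmul (F t) (G t)).
Proof.
move=> cF cG; apply: rV_continuous => i.
have H (K : T -> V) : continuous K -> continuous (fun t => K t ord0 i).
  by move=> cK t; exact: (continuous_comp (cK t) (@continuous_coord R _ i (K t))).
rewrite (_ : (fun t => _) = fun t => F t ord0 i + G t ord0 i + symp (F t) (G t) * etau ord0 i).
  apply: ctsD; first by apply: ctsD; exact: H.
  by apply: ctsM; [exact: continuous_symp|exact: cts_cst].
by apply/funext => t; rewrite hmulE !mxE.
Qed.

Lemma continuous_Xfield i f : cd 1 f -> continuous (Xfield i f).
Proof.
move=> [cf df]; rewrite /Xfield.
have c1 j : continuous (partial j f) by have [_ []] := df j.
apply: ctsD; first exact: c1.
have ch j : continuous (fun x => @hx R N j x / 2).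
  by apply: ctsM; [exact: continuous_hx|exact: cts_cst].
case: (fintype.split i) => j; apply: ctsM; rewrite ?/partial_tau; try exact: c1.
  exact: ctsN.
exact: ch.
Qed.

Lemma XfieldD i f g x : cd 1 f -> cd 1 g ->
  Xfield i (fun y => f y + g y) x = Xfield i f x + Xfield i g x.
Proof.
move=> cf cg; rewrite !XfieldE//; last exact: cdD.
by rewrite deriveD//; exact: C1_derivable.
Qed.

Lemma XfieldM i f g x : cd 1 f -> cd 1 g ->
  Xfield i (fun y => f y * g y) x = f x * Xfield i g x + g x * Xfield i f x.
Proof.
move=> cf cg; rewrite !XfieldE//; last exact: cdM.
by rewrite deriveM//; exact: C1_derivable.
Qed.

Lemma XfieldZ i f (c : R) x : cd 1 f -> Xfield i (fun y => c * f y) x = c * Xfield i f x.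
Proof.
move=> cf; rewrite !XfieldE//; last exact: cdZ.
by rewrite -[RHS](deriveZ c (@C1_derivable _ _ f x (xdir i x) cf)).
Qed.

Lemma XfieldB i f g x : cd 1 f -> cd 1 g ->
  Xfield i (fun y => f y - g y) x = Xfield i f x - Xfield i g x.
Proof.
move=> cf cg; rewrite !XfieldE//; last exact: cdB.
by rewrite deriveB//; exact: C1_derivable.
Qed.

Lemma Xfield_comp1 (phi : R -> R) i f x : cd 1 f -> cd 1 (phi \o f) ->
  derivable phi (f x) 1 ->
  Xfield i (phi \o f) x = 'D_1 phi (f x) * Xfield i f x.
Proof.
move=> cf cpf dphi; rewrite !XfieldE// !C1_deriveE// mulr_sumr.
apply: eq_bigr => j _.
have [_ ->] := partial_comp1 (@C1_derivable _ _ f x (delta_mx ord0 j) cf) dphi.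
by rewrite mulrCA.
Qed.

End horizontal.

(** * Integrals of p-th powers, translations and mollification *)

(** Convexity of t^p at the point (1-e) (a/(1-e)) + e (b/e).  As e tends to 0 the first
    constant tends to 1, which later compares the energies of close functions. *)
Lemma powR_quasiconvex (R : realType) (p e a b : R) : 1 <= p -> 0 < e -> e < 1 ->
  `|a + b| `^ p <= (1 - e) `^ (1 - p) * `|a| `^ p + e `^ (1 - p) * `|b| `^ p.
Proof.
move=> p1 e0 e1; have p0 : 0 <= p by rewrite (le_trans _ p1).
have e1' : 0 < 1 - e by rewrite subr_gt0.
have H c x : 0 < c -> 0 <= x -> c * (x / c) `^ p = c `^ (1 - p) * x `^ p.
  move=> c0 x0; rewrite powRM ?invr_ge0 ?(ltW c0)// mulrCA mulrC; congr (_ * _).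
  by rewrite -powR_inv1 ?ltW// -powRrM mulN1r powRD ?powRr1 ?ltW// (gt_eqF c0) implybT.
rewrite -!H//.
apply: (@le_trans _ _ (((1 - e) * (`|a| / (1 - e)) + e * (`|b| / e)) `^ p)).
  have q c x : 0 <= c -> 0 <= x -> 0 <= c * (x / c).
    by move=> c0 x0; rewrite mulr_ge0// divr_ge0.
  rewrite ge0_ler_powR ?nnegrE ?addr_ge0 ?q ?(ltW e0) ?(ltW e1')//.
  rewrite mulrCA divff ?gt_eqF// mulr1 [e * _]mulrCA divff ?gt_eqF// mulr1.
  exact: ler_normD.
have e1'' : 1 - e <= 1 by rewrite gerBl ltW.
have := @convex_powR R p p1 (Itv01 (ltW e1') e1'') (`|a| / (1 - e)) (`|b| / e).
have i0 c x : 0 <= c -> 0 <= x -> x / c \in `[0 : R, +oo[%classic.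
  by move=> c0 x0; rewrite inE /= in_itv/= andbT divr_ge0.
rewrite !i0 ?(ltW e0) ?(ltW e1')// => /(_ isT isT).
move=> H1; apply: (le_trans (y := ((1 - e) * (`|a| / (1 - e)) +
    unstable.onem (1 - e) * (`|b| / e)) `^ p)).
  by rewrite /unstable.onem subKr.
apply: (le_trans H1).
by rewrite convRE /= /unstable.onem subKr.
Qed.

(** Integral of the p-th power of |g|.  It is locked because unification would otherwise
    unfold it into the integral of a composite function. *)
HB.lock Definition pint {d} {T : measurableType d} {R : realType}
    (mu : {measure set T -> \bar R}) (p : R) (D : set T) (g : T -> R) : \bar R :=
  (\int[mu]_(x in D) (`|g x| `^ p)%:E)%E.
Canonical locked_pint := Unlockable pint.unlock.

Lemma cvg_powR0 (R : realType) (p : R) (u : (R^o)^nat) : 0 < p ->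
  u n @[n --> \oo] --> (0 : R) -> `|u n| `^ p @[n --> \oo] --> (0 : R).
Proof.
move=> p0 u0; apply/cvgrPdist_le => e e0.
have e1 : 0 < e `^ p^-1 by exact: powR_gt0.
move/cvgrPdist_le : u0 => /(_ _ e1)[n _ H]; exists n => // m /H.
rewrite !sub0r !normrN [X in _ -> X <= _]ger0_norm ?powR_ge0// => ue.
have -> : e = (e `^ p^-1) `^ p by rewrite -powRrM mulVf ?gt_eqF// powRr1// ltW.
by apply: ge0_ler_powR; rewrite ?nnegrE// ltW.
Qed.

Section pint.
Context d {T : measurableType d} {R : realType} (mu : {measure set T -> \bar R}).
Local Open Scope ereal_scope.
Implicit Types (D : set T) (f g h w : T -> R).

Local Notation pint := (pint mu).

Lemma pintE p D g : pint p D g = \int[mu]_(x in D) (`|g x| `^ p)%:E.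
Proof. by rewrite unlock. Qed.

Lemma measurable_powR_norm p D (g : T -> R) : measurable_fun D g ->
  measurable_fun D (fun x => (`|g x| `^ p)%R).
Proof.
move=> mg; apply: (measurableT_comp (measurable_powR p)).
exact: measurableT_comp.
Qed.

Lemma measurable_EFin_powR p D (g : T -> R) : measurable_fun D g ->
  measurable_fun D (fun x => (`|g x| `^ p)%:E).
Proof. by move=> mg; apply/measurable_EFinP; exact: measurable_powR_norm. Qed.

Lemma pint_ge0 p D g : 0 <= pint p D g.
Proof. by rewrite pintE; apply: integral_ge0 => x _; rewrite lee_fin powR_ge0. Qed.

Lemma pint_eq0 p g : (0 < p)%R -> measurable_fun setT g ->
  pint p setT g = 0 -> {ae mu, forall x, g x = 0%R}.
Proof.
move=> p0 mg; rewrite pintE => H.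
have : {ae mu, forall x, [set: T] x -> (`|g x| `^ p)%:E = 0}.
  apply/(@ae_eq_integral_abs _ _ _ mu setT measurableT) => //.
    exact: measurable_EFin_powR.
  rewrite -[RHS]H; apply: eq_integral => x _.
  by rewrite gee0_abs// lee_fin powR_ge0.
apply: filterS => x /(_ I) [/eqP]; rewrite powR_eq0 => /andP[/eqP/normr0_eq0].
by [].
Qed.

Variables (p : R) (p1 : (1 <= p)%R).

Let p0 : (0 < p)%R. Proof. exact: lt_le_trans p1. Qed.

Lemma pint_le D f g : measurable D -> measurable_fun D f -> measurable_fun D g ->
  (forall x, D x -> `|f x| <= `|g x|)%R -> pint p D f <= pint p D g.
Proof.
move=> mD mf mg fg; rewrite !pintE; apply: ge0_le_integral => //.
- exact: measurable_EFin_powR.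
- exact: measurable_EFin_powR.
by move=> x Dx; rewrite lee_fin ge0_ler_powR ?nnegrE// ?fg// ltW.
Qed.

Lemma pintN D f : pint p D (fun x => - f x)%R = pint p D f.
Proof. by rewrite !pintE; apply: eq_integral => x _; rewrite normrN. Qed.

Lemma pintBC D f g : pint p D (fun x => f x - g x)%R = pint p D (fun x => g x - f x)%R.
Proof. by rewrite !pintE; apply: eq_integral => x _; rewrite distrC. Qed.

Lemma pintZ D (c : R) f : measurable D -> measurable_fun D f ->
  pint p D (fun x => c * f x)%R = (`|c| `^ p)%:E * pint p D f.
Proof.
move=> mD mf; rewrite !pintE -ge0_integralZl//.
- by apply: eq_integral => x _; rewrite normrM powRM// EFinM.
- exact: measurable_EFin_powR.
Qed.

Lemma pint_quasiconvex D f g (e : R) : measurable D ->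
  measurable_fun D f -> measurable_fun D g -> (0 < e)%R -> (e < 1)%R ->
  pint p D (fun x => f x + g x)%R <=
  ((1 - e) `^ (1 - p))%:E * pint p D f + (e `^ (1 - p))%:E * pint p D g.
Proof.
move=> mD mf mg e0 e1.
rewrite !pintE -!ge0_integralZl_EFin ?powR_ge0//; try exact: measurable_EFin_powR.
rewrite -ge0_integralD//;
  try by apply: measurable_funeM; exact: measurable_EFin_powR.
apply: ge0_le_integral => //.
- by apply: measurable_EFin_powR; exact: measurable_funD.
- by apply: emeasurable_funD; apply: measurable_funeM; exact: measurable_EFin_powR.
- by move=> x _; rewrite -!EFinM -EFinD lee_fin; exact: powR_quasiconvex.
- by move=> x _; rewrite -EFinM lee_fin mulr_ge0 ?powR_ge0.
- by move=> x _; rewrite -EFinM lee_fin mulr_ge0 ?powR_ge0.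
Qed.

(** Constant of the quasi-triangle inequality, 2^(p-1). *)
Definition pK : R := (2^-1 `^ (1 - p))%R.

Lemma pK_gt0 : (0 < pK)%R. Proof. exact: powR_gt0. Qed.

Lemma pintD D f g : measurable D -> measurable_fun D f -> measurable_fun D g ->
  pint p D (fun x => f x + g x)%R <= pK%:E * (pint p D f + pint p D g).
Proof.
move=> mD mf mg; have := @pint_quasiconvex D f g (2^-1)%R mD mf mg.
rewrite (_ : (1 - 2^-1 = 2^-1)%R); last by lra.
rewrite -ge0_muleDr ?pint_ge0// => -> //; lra.
Qed.

Lemma pintB D f g h : measurable D -> measurable_fun D f -> measurable_fun D g ->
  measurable_fun D h ->
  pint p D (fun x => f x - g x)%R <=
  pK%:E * (pint p D (fun x => f x - h x)%R + pint p D (fun x => h x - g x)%R).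
Proof.
move=> mD mf mg mh.
rewrite (_ : (fun x => f x - g x)%R = (fun x => (f x - h x) + (h x - g x))%R).
  by apply: pintD => //; exact: measurable_funB.
by apply/funext => x; ring.
Qed.

Lemma pint_dominated_cvg D (w : T -> R) (wn : nat -> T -> R) : measurable D ->
  measurable_fun D w -> (forall n, measurable_fun D (wn n)) ->
  (forall x, D x -> (wn n x @[n --> \oo] --> w x)%R) ->
  (forall n x, D x -> `|wn n x| <= `|w x|)%R -> pint p D w < +oo ->
  forall e : R, (0 < e)%R -> exists n, pint p D (fun x => w x - wn n x)%R <= e%:E.
Proof.
move=> mD mw mwn cw dw woo e e0.
have mdiff n : measurable_fun D (fun x => (`|w x - wn n x| `^ p)%:E).
  by apply: measurable_EFin_powR; exact: measurable_funB.
have H := @dominated_cvg _ _ _ mu D mD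
  (fun n x => (`|w x - wn n x| `^ p)%:E) (cst 0)
  (fun x => (2 `^ p * `|w x| `^ p)%:E) mdiff.
have : (\int[mu]_(x in D) (`|w x - wn n x| `^ p)%:E) @[n --> \oo] --> (0 : \bar R).
  rewrite -[X in _ --> X](integral0 mu D); apply: H => //.
  - move=> x Dx; apply: cvg_EFin; first exact: nearW.
    apply: (@cvg_powR0 R p (fun n => w x - wn n x)%R p0).
    rewrite -[X in _ --> X](subrr (w x)).
    by apply: cvgB; [exact: cvg_cst|exact: cw].
  - apply/integrableP; split.
      apply/measurable_EFinP/measurable_funM => //; exact: measurable_powR_norm.
    under eq_integral do rewrite gee0_abs ?lee_fin ?mulr_ge0 ?powR_ge0// EFinM.
    rewrite ge0_integralZl_EFin ?powR_ge0//; last exact: measurable_EFin_powR.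
    by rewrite pintE in woo; rewrite lte_mul_pinfty ?lee_fin ?powR_ge0.
  - move=> n x Dx; rewrite gee0_abs ?lee_fin ?powR_ge0// -powRM//.
    rewrite ge0_ler_powR ?nnegrE ?mulr_ge0// ?(ltW p0)//.
    rewrite (le_trans (ler_normB _ _))// mulr_natl mulr2n lerD2l.
    exact: dw.
move=> /fine_cvgP[fin /cvgrPdist_le /(_ _ e0) H'].
near \oo => n; exists n.
have fn : \int[mu]_(x in D) (`|w x - wn n x| `^ p)%:E \is a fin_num by near: n.
rewrite pintE -(fineK fn) lee_fin.
have : (`|0 - fine (\int[mu]_(x in D) (`|w x - wn n x| `^ p)%:E)| <= e)%R.
  by near: n.
by rewrite sub0r normrN; apply: le_trans; exact: ler_norm.
Unshelve. all: by end_near. Qed.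

End pint.

Opaque lebesgue_rV mu_heis hmul symp.

Section translation_continuity.
Context {R : realType} {N : nat}.
Local Notation V := 'rV[R]_(N + N + 1).
Local Notation mu := (@mu_heis R N).
Variables (p : R) (p1 : (1 <= p)%R).
Local Open Scope ereal_scope.
Implicit Types (w : V -> R) (h : V).

Let p0 : (0 < p)%R. Proof. exact: lt_le_trans p1. Qed.

(** Continuity of left translations at the identity, in L^p. *)
Definition tcont w := forall e : R, (0 < e)%R -> exists2 d : R, (0 < d)%R &
  forall h, (`|h| < d)%R -> pint mu p setT (fun x => w (hmul h x) - w x)%R <= e%:E.

Lemma measurable_comp_lmul w h : measurable_fun setT w ->
  measurable_fun setT (fun x => w (hmul h x)).
Proof. by move=> mw; apply: measurableT_comp => //; exact: measurable_lmul. Qed.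

Lemma pint_lmul w h : measurable_fun setT w ->
  pint mu p setT (fun x => w (hmul h x)) = pint mu p setT w.
Proof.
move=> mw; rewrite !pintE.
rewrite -(@ge0_integral_lmul R N h (fun x => (`|w x| `^ p)%:E))//.
exact: measurable_EFin_powR.
Qed.

Lemma tcont_lim w : measurable_fun setT w ->
  (forall e : R, (0 < e)%R -> exists w', [/\ measurable_fun setT w', tcont w' &
     pint mu p setT (fun x => w x - w' x)%R <= e%:E]) -> tcont w.
Proof.
move=> mw H e e0.
have K0 := pK_gt0 p; set K := pK p in K0.
pose e' : R := (e / (K * (1 + K * 2)))%R.
have D0 : (0 < K * (1 + K * 2))%R by rewrite mulr_gt0// addr_gt0// mulr_gt0.
have e'0 : (0 < e')%R by rewrite divr_gt0.
have [w' [mw' tw' ww']] := H _ e'0.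
have [d d0 Hd] := tw' _ e'0; exists d => // h /Hd Hh.
have mwh := measurable_comp_lmul h mw; have mwh' := measurable_comp_lmul h mw'.
apply: (le_trans (pintB mu p1 measurableT mwh mw mwh')).
rewrite (@pint_lmul (fun x => w x - w' x)%R h (measurable_funB mw mw')).
apply: (@le_trans _ _ (K%:E * (e'%:E + K%:E * (e'%:E + e'%:E)))).
  rewrite lee_pmul2l//= leeD//.
  apply: (le_trans (pintB mu p1 measurableT mwh' mw mw')).
  by rewrite lee_pmul2l//= leeD// pintBC.
rewrite -[leLHS]/((K * (e' + K * (e' + e')))%:E) lee_fin /e'.
rewrite [leLHS](_ : _ = e)//; field.
by rewrite !gt_eqF// addr_gt0// mulr_gt0.
Qed.

Lemma tcontD w1 w2 : measurable_fun setT w1 -> measurable_fun setT w2 ->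
  tcont w1 -> tcont w2 -> tcont (fun x => w1 x + w2 x)%R.
Proof.
move=> m1 m2 t1 t2 e e0.
have K0 := pK_gt0 p; set K := pK p in K0.
have e'0 : (0 < e / (K * 2))%R by rewrite divr_gt0// mulr_gt0.
have [d1 d10 H1] := t1 _ e'0; have [d2 d20 H2] := t2 _ e'0.
exists (Num.min d1 d2) => [|h]; first by rewrite lt_min d10.
rewrite lt_min => /andP[/H1 {}H1 /H2 {}H2].
have mB w : measurable_fun setT w -> measurable_fun setT (fun x => w (hmul h x) - w x)%R.
  by move=> mw; apply: measurable_funB => //; exact: measurable_comp_lmul.
rewrite (_ : (fun x => _) = (fun x => (w1 (hmul h x) - w1 x) + (w2 (hmul h x) - w2 x))%R).
  apply: (le_trans (pintD mu p1 measurableT (mB _ m1) (mB _ m2))).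
  apply: (@le_trans _ _ (K%:E * ((e / (K * 2))%:E + (e / (K * 2))%:E))).
    by rewrite lee_pmul2l//= leeD.
  rewrite -EFinD -EFinM lee_fin [leLHS](_ : _ = e)//; field.
  by rewrite gt_eqF.
by apply/funext => x; ring.
Qed.

Lemma tcontZ (c : R) w : measurable_fun setT w -> tcont w -> tcont (fun x => c * w x)%R.
Proof.
move=> mw tw e e0.
have e'0 : (0 < e / (`|c| `^ p + 1))%R by rewrite divr_gt0// ltr_wpDl// powR_ge0.
have [d d0 H] := tw _ e'0; exists d => // h /H {}H.
rewrite (_ : (fun x => _) = (fun x => c * (w (hmul h x) - w x))%R); last first.
  by apply/funext => x; ring.
rewrite pintZ//; last first.
  by apply: measurable_funB => //; exact: measurable_comp_lmul.
apply: (@le_trans _ _ ((`|c| `^ p)%:E * (e / (`|c| `^ p + 1))%:E)).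
  by rewrite lee_wpmul2l// lee_fin powR_ge0.
rewrite -EFinM lee_fin mulrCA ger_pMr// ler_pdivrMr ?mul1r ?lerDl//.
Qed.

Lemma tcontB w1 w2 : measurable_fun setT w1 -> measurable_fun setT w2 ->
  tcont w1 -> tcont w2 -> tcont (fun x => w1 x - w2 x)%R.
Proof.
move=> m1 m2 t1 t2.
rewrite (_ : (fun x => _) = (fun x => w1 x + (-1) * w2 x)%R).
  by apply: tcontD => //; [exact: measurable_funM|exact: tcontZ].
by apply/funext => x; rewrite mulN1r.
Qed.

Lemma tcont0 : tcont (fun=> 0%R).
Proof.
move=> e e0; exists 1%R => // h _.
rewrite !pintE integral0_eq ?lee_fin ?ltW// => x _.
by rewrite subrr normr0 powR0// gt_eqF.
Qed.

Lemma tcont_sum (I : Type) (r : seq I) (F : I -> V -> R) :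
  (forall i, measurable_fun setT (F i)) -> (forall i, tcont (F i)) ->
  tcont (fun x => \sum_(i <- r) F i x)%R.
Proof.
move=> mF tF; elim: r => [|a r IHr].
  rewrite (_ : (fun _ => _) = fun=> 0%R); first exact: tcont0.
  by apply/funext => x; rewrite big_nil.
rewrite (_ : (fun _ => _) = fun x => F a x + \sum_(i <- r) F i x)%R.
  by apply: tcontD => //; exact: measurable_sum.
by apply/funext => x; rewrite big_cons.
Qed.

(** Translations preserve the measure, so that the p-th power of the L^p distance of an
    indicator to its translate is twice the measure of the part of U that leaves U; this part
    shrinks to nothing pointwise because U is open. *)
Lemma tcont_open (U : set V) : open U -> mu U < +oo -> tcont (\1_U : V -> R).
Proof.
move=> oU Uoo; apply: contrapT => nt.
have mU := open_measurable_rV oU.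
have [e [e0 He]] : exists e : R, (0 < e)%R /\ forall d : R, (0 < d)%R ->
    exists h, (`|h| < d)%R /\
    e%:E < pint mu p setT (fun x => \1_U (hmul h x) - \1_U x)%R.
  apply: contrapT => H; apply: nt => e e0; apply: contrapT => H'.
  apply: H; exists e; split => // d d0; apply: contrapT => H2.
  apply: H'; exists d => // h hd; rewrite leNgt; apply/negP => H3.
  by apply: H2; exists h.
have /choice[h Hh] : forall n : nat, exists h : V, (`|h| < n.+1%:R^-1)%R /\
    e%:E < pint mu p setT (fun x => \1_U (hmul h x) - \1_U x)%R.
  by move=> n; apply: He; rewrite invr_gt0.
pose a n x : R := (\1_U x * (1 - \1_U (hmul (h n) x)))%R.
have a0 n x : (0 <= a n x)%R.
  by rewrite /a mulr_ge0// subr_ge0 indicE; case: (_ \in _).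
have m1U : measurable_fun setT (\1_U : V -> R) by exact: measurable_indic.
have m1h n : measurable_fun setT (fun x => \1_U (hmul (h n) x) : R).
  exact: (measurable_comp_lmul (h n) m1U).
have ma n : measurable_fun setT (a n).
  by apply: measurable_funM => //; apply: measurable_funB.
(* |1_U(h x) - 1_U(x)| + 1_U(x) = 1_U(h x) + 2 a(x), and both indicators have
   the same integral *)
have E n : pint mu p setT (fun x => \1_U (hmul (h n) x) - \1_U x)%R + mu U =
    mu U + 2%:E * \int[mu]_x (a n x)%:E.
  have U1 : mu U = \int[mu]_x (\1_U x)%:E by rewrite integral_indic// setIT.
  have U2 : mu U = \int[mu]_x (\1_U (hmul (h n) x))%:E.
    rewrite (@ge0_integral_lmul R N (h n) (fun x => (\1_U x)%:E))//.
    exact/measurable_EFinP.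
  rewrite [in RHS]U2 [in LHS]U1 -ge0_integralZl_EFin//; last 2 first.
    by move=> x _; rewrite lee_fin.
    exact/measurable_EFinP.
  rewrite !pintE -ge0_integralD//; try exact/measurable_EFinP.
  - rewrite -ge0_integralD//; try exact/measurable_EFinP.
    + apply: eq_integral => x _; rewrite -!EFinM -!EFinD; congr _%:E.
      rewrite /a !indicE; case: (_ \in U); case: (_ \in U) => /=;
        rewrite ?subrr ?subr0 ?sub0r ?normrN ?normr0 ?normr1 ?powR1 ?powR0 ?gt_eqF//; ring.
    + by move=> x _; rewrite -EFinM lee_fin mulr_ge0.
    + by apply: measurable_funeM; exact/measurable_EFinP.
  - by apply: measurable_EFin_powR; exact: measurable_funB.
have lim : (\int[mu]_x (a n x)%:E) @[n --> \oo] --> (0 : \bar R).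
  rewrite -[X in _ --> X](integral0 mu setT).
  apply: (@dominated_cvg _ _ _ mu setT measurableT (fun n x => (a n x)%:E)
    (cst 0) (fun x => (\1_U x)%:E)) => //.
  - by move=> n; exact/measurable_EFinP.
  - move=> x _; apply: cvg_EFin; first exact: nearW.
    have [xU|xU] := boolP (x \in U); last first.
      rewrite (_ : (fun n => _) = cst 0%R); first exact: cvg_cst.
      by apply/funext => n; rewrite /a indicE (negbTE xU) mul0r.
    have cx : (fun y => hmul y x) y @[y --> (0 : V)%R] --> x.
      rewrite -[X in _ --> X](@hmul0x R N x).
      apply: (@continuous_hmul R N _ id (cst x)); first by move=> y.
      exact: cst_continuous.
    have : \forall y \near (0 : V)%R, U (hmul y x).
      apply: cx; apply: open_nbhs_nbhs; split => //.
      by rewrite inE in xU.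
    move=> /nbhs_ballP[d /= d0 dU].
    have [k Hk] : exists k : nat, (k.+1%:R^-1 < d)%R.
      exists (Num.truncn d^-1); rewrite invf_plt ?posrE//; exact: truncnS_gt.
    apply: cvg_near_cst; exists k => // n /= kn.
    rewrite /a; suff -> : \1_U (hmul (h n) x) = (1 : R)%R by rewrite subrr mulr0.
    rewrite indicE mem_set//; apply: dU; rewrite -ball_normE /= sub0r normrN.
    apply: lt_le_trans (Hh n).1 _; apply: le_trans (ltW Hk).
    by rewrite lef_pV2 ?posrE// ler_nat.
  - apply/integrableP; split; first exact/measurable_EFinP.
    under eq_integral do rewrite gee0_abs ?lee_fin//.
    by rewrite integral_indic// setIT.
  - move=> n x _; rewrite gee0_abs ?lee_fin// /a ler_piMr//.
have lim2 : 2%:E * \int[mu]_x (a n x)%:E @[n --> \oo] --> (0 : \bar R).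
  by rewrite -(mule0 2%:E); apply: cvgeZl.
have E' n : pint mu p setT (fun x => \1_U (hmul (h n) x) - \1_U x)%R =
    2%:E * \int[mu]_x (a n x)%:E.
  have fU : mu U \is a fin_num by rewrite ge0_fin_numE.
  by have := congr1 (fun z => z - mu U) (E n); rewrite addeK// [mu U + _]addeC addeK.
have := lim2; under eq_fun do rewrite -E'.
move=> /fine_cvgP[fin /cvgrPdist_lt /(_ _ e0) H'].
near \oo => n.
have fn : pint mu p setT (fun x => \1_U (hmul (h n) x) - \1_U x)%R \is a fin_num.
  by near: n.
have He' : (`|0 - fine (pint mu p setT (fun x => \1_U (hmul (h n) x) - \1_U x)%R)| < e)%R.
  by near: n.
have := (Hh n).2; rewrite -(fineK fn) lte_fin => /lt_trans.
move: He'; rewrite sub0r normrN => /(le_lt_trans (ler_norm _)) /[swap] /[apply].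
by rewrite ltxx.
Unshelve. all: by end_near. Qed.

Let B (k : nat) : set V := ball (0 : V)%R k%:R.

Let openB k : open (B k). Proof. exact: ball_open. Qed.

Let muB k : mu (B k) < +oo.
Proof.
apply: mu_heis_bounded; first by apply: open_measurable_rV; exact: openB.
exists k%:R; split => // M kM x; rewrite /B -ball_normE /= sub0r normrN => xk.
by rewrite ltW// (lt_trans xk).
Qed.

Lemma rV_measurable_open : @measurable _ V = <<s [set U : set V | open U] >>.
Proof.
apply/seteqP; split; last first.
  apply: smallest_sub; first exact: sigma_algebra_measurable.
  by move=> U; exact: open_measurable_rV.
apply: smallest_sub; first exact: smallest_sigma_algebra.
rewrite -bigcup_seq/= => _ [i _ [C mC <-]].
have E : @measurable _ R = <<s @RGenOpens.G R >> := RGenOpens.measurableE R.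
have H : <<s @RGenOpens.G R >> `<=` image_set_system setT (fun v : V => v ord0 i)
    <<s [set U : set V | open U] >>.
  apply: smallest_sub; first by apply: sigma_algebra_image; exact: smallest_sigma_algebra.
  move=> _ [a [b ->]]; apply: sub_sigma_algebra; rewrite setTI /=.
  by move/continuousP : (@continuous_coord R _ i); apply; exact: interval_open.
by apply: H; rewrite -E.
Qed.

(** The sets whose trace on C is translation-continuous form a Dynkin system that contains
    the open sets. *)
Lemma tcont_set (C A : set V) : open C -> mu C < +oo -> measurable A -> tcont (\1_(A `&` C) : V -> R).
Proof.
move=> oC muC; have mB : measurable (C) by exact: open_measurable_rV.
have m1 (D : set V) : measurable D -> measurable_fun setT (\1_(D `&` C) : V -> R).
  by move=> mC; apply: measurable_indic; exact: measurableI.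
rewrite rV_measurable_open => sA.
apply: (dynkin_induction (G := [set U : set V | open U])
  (P := fun A => tcont (\1_(A `&` C) : V -> R))) => //.
- exact: rV_measurable_open.
- by move=> U W oU oW; exact: openI.
- by rewrite setTI; exact: tcont_open.
- move=> U oU; apply: tcont_open; first exact: openI.
  apply: le_lt_trans (muC); apply: le_measure; rewrite ?inE//.
  by apply: open_measurable_rV; exact: openI.
- move=> S mS tS.
  rewrite (_ : \1_(~` S `&` C) = (fun x => \1_(setT `&` C) x - \1_(S `&` C) x)%R).
    by apply: tcontB; [exact: m1|exact: m1|rewrite setTI; exact: tcont_open|].
  apply/funext => x; rewrite setTI !indicE !in_setI in_setC.
  by case: (x \in S); case: (x \in C); rewrite /= ?subrr ?subr0.
move=> F mF tF HF; apply: tcont_lim; first (by apply: m1; exact: bigcup_measurable).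
move=> e e0.
pose w n : V -> R := fun x => (\sum_(i < n) \1_(F i `&` C) x)%R.
have wE n : w n = \1_((\big[setU/set0]_(i < n) F i) `&` C).
  elim: n => [|n IHn].
    by apply/funext => x; rewrite /w !big_ord0 set0I indic0.
  apply/funext => x; rewrite /w !big_ord_recr/= -/(w n x) IHn !indicE !in_setI in_setU.
  have [xB|xB] := boolP (x \in C); rewrite ?andbF ?addr0// !andbT.
  have [xn|xn] := boolP (x \in F n); rewrite ?orbF ?addr0// orbT.
  rewrite (_ : (x \in _) = false) ?add0r//; apply/negP; rewrite inE => Fx.
  rewrite inE in xn; move: Fx; rewrite -bigcup_mkord => -[j /= jn Fjx].
  have /trivIsetP := tF; move/(_ j n I I); rewrite neq_ltn jn => /(_ isT).
  by rewrite -subset0 => /(_ x); apply.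
have [] := @pint_dominated_cvg _ V R mu p p1 setT (\1_(\bigcup_i F i `&` C) : V -> R)
    w measurableT _ _ _ _ _ e e0.
- by apply: m1; exact: bigcup_measurable.
- by move=> n; apply: measurable_sum => i; exact: m1.
- move=> x _; have [[i _ Fix]|nF] := pselect ((\bigcup_i F i) x); last first.
    rewrite (_ : (fun n => _) = cst (\1_(\bigcup_i F i `&` C) x)); first exact: cvg_cst.
    apply/funext => n; rewrite wE /cst !indicE !in_setI.
    rewrite (_ : (x \in _) = false); last first.
      by apply/negP; rewrite inE -bigcup_mkord => -[j _ Fj]; apply: nF; exists j.
    by have -> : (x \in \bigcup_i F i) = false by apply/negP; rewrite inE.
  apply: cvg_near_cst; exists i.+1 => // n /= ni.
  rewrite wE !indicE !in_setI; congr (_ && _)%:R.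
  rewrite (_ : (x \in _) = true).
    by rewrite mem_set//; exists i.
  by apply: mem_set; rewrite -bigcup_mkord; exists i.
- move=> n x _; rewrite wE !indicE !ger0_norm// ler_nat !in_setI.
  case: (x \in C); rewrite ?andbF// !andbT.
  have [|//] := boolP (x \in \big[setU/set0]_(i < n) F i).
  rewrite inE -bigcup_mkord => -[j _ Fj].
  by rewrite mem_set//; exists j.
- rewrite pintE; under eq_integral => x _.
    rewrite indicE (_ : (`|(x \in (\bigcup_i F i `&` C))%:R| `^ p)%R
      = \1_(\bigcup_i F i `&` C) x); last first.
      by rewrite indicE; case: (_ \in _); rewrite ?normr1 ?powR1// normr0 powR0// gt_eqF.
    over.
  rewrite integral_indic// ?setIT.
    apply: le_lt_trans (muC); apply: le_measure; rewrite ?inE//.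
    by apply: measurableI => //; exact: bigcup_measurable.
  by apply: measurableI => //; exact: bigcup_measurable.
move=> n Hn; exists (w n); split => //.
  by apply: measurable_sum => i; exact: m1.
by apply: tcont_sum => i; [exact: m1|exact: HF].
Qed.

Import HBNNSimple.

Lemma tcont_ge0 w : measurable_fun setT w -> (forall x, 0 <= w x)%R ->
  pint mu p setT w < +oo -> tcont w.
Proof.
move=> mw w0 woo; apply: tcont_lim => // e e0.
have mB k : measurable (B k) by exact: open_measurable_rV.
have mEw : measurable_fun setT (EFin \o w) by exact/measurable_EFinP.
pose s n := nnsfun_approx measurableT mEw n.
pose wn n x : R := (s n x * \1_(B n) x)%R.
have ms n : measurable_fun setT (s n : V -> R) by exact: measurable_funP.
have mwn n : measurable_fun setT (wn n).
  by apply: measurable_funM => //; exact: measurable_indic.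
have sw n x : (s n x <= w x)%R.
  have /= := @le_approx _ _ _ setT (EFin \o w) n x (fun x _ => w0 x : (0 <= (w x)%:E)%E) I.
  by rewrite lee_fin /s nnsfun_approxE.
have s0 n x : (0 <= s n x)%R by exact: fun_ge0.
have cs x : (s n x @[n --> \oo] --> w x)%R.
  have := @cvg_nnsfun_approx _ _ _ setT measurableT _ mEw (fun x _ => w0 x : (0 <= (w x)%:E)%E) x I.
  by move=> /fine_cvgP[_].
have [] := @pint_dominated_cvg _ V R mu p p1 setT w wn measurableT mw mwn _ _ woo e e0.
- move=> x _; rewrite -[X in _ --> X](mulr1 (w x)).
  apply: cvgM; first exact: cs.
  apply: cvg_near_cst; exists (Num.truncn `|x|).+1 => // n /= xn.
  rewrite indicE mem_set// /B -ball_normE /= sub0r normrN.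
  by rewrite (lt_le_trans (truncnS_gt _))// ler_nat.
- move=> n x _; rewrite /wn !ger0_norm ?mulr_ge0//; apply: le_trans (sw n x).
  by rewrite ler_piMr// indicE; case: (_ \in _).
move=> n Hn; exists (wn n); split => //.
rewrite (_ : wn n = (fun x => \sum_(y <- finmap.enum_fset (fset_set (range (s n))))
    y * \1_(s n @^-1` [set y] `&` B n) x)%R).
  have mp y : measurable (s n @^-1` [set y]).
    rewrite -[X in measurable X]setTI; exact: (ms n).
  have m1 y : measurable_fun setT (\1_(s n @^-1` [set y] `&` B n) : V -> R).
    by apply: measurable_indic; exact: measurableI.
  apply: tcont_sum => y; first by apply: measurable_funM.
  by apply: tcontZ => //; apply: tcont_set => //; exact: muB.
apply/funext => x; rewrite /wn fimfunE fsbig_finite//= mulr_suml.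
by apply: eq_bigr => y _; rewrite -mulrA indicI.
Qed.

(** Reduction to nonnegative functions, which are limits of simple ones. *)
Lemma tcont_Lp w : measurable_fun setT w -> pint mu p setT w < +oo -> tcont w.
Proof.
move=> mw woo.
have mp : measurable_fun setT (fun x => Num.max (w x) 0)%R by exact: measurable_maxr.
have mn : measurable_fun setT (fun x => Num.max (- w x) 0)%R.
  by apply: measurable_maxr => //; exact: measurable_funN.
rewrite (_ : w = (fun x => Num.max (w x) 0 - Num.max (- w x) 0)%R); last first.
  by apply/funext => x; rewrite /Num.max; do 2 case: ifPn => ?; lra.
apply: tcontB => //; apply: tcont_ge0 => //.
- by move=> x; rewrite le_max lexx orbT.
- apply: le_lt_trans woo; apply: pint_le => // x _.
  by rewrite /Num.max; case: ifPn => // _; rewrite normr0.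
- by move=> x; rewrite le_max lexx orbT.
- apply: le_lt_trans woo; apply: pint_le => // x _.
  by rewrite /Num.max; case: ifPn => // _; rewrite ?normr0 ?normrN.
Qed.

End translation_continuity.

(** Young's inequality in the form used for the pairing of |g|^(p-1) with h. *)
Lemma young_powR (R : realType) (p a b : R) : 1 <= p -> 0 <= a -> 0 <= b ->
  a `^ (p - 1) * b <= (1 - p^-1) * a `^ p + p^-1 * b `^ p.
Proof.
rewrite le_eqVlt => /predU1P[<-|p1] a0 b0.
  by rewrite subrr powRr0 invr1 subrr mul0r add0r !mul1r powRr1.
have p0 : 0 < p by rewrite (lt_trans _ p1).
have q0 : 0 < p / (p - 1) by rewrite divr_gt0// subr_gt0.
have p10 : p - 1 != 0 by rewrite subr_eq0 gt_eqF.
have pn0 : p != 0 by rewrite gt_eqF.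
have H : p^-1 + (p / (p - 1))^-1 = 1.
  by rewrite invf_div; field.
have := conjugate_powR b0 (powR_ge0 a (p - 1)) p0 q0 H.
rewrite -powRrM mulrCA divff// mulr1 [b * _]mulrC invf_div => /le_trans; apply.
rewrite le_eqVlt; apply/orP; left; apply/eqP; field.
exact: pn0.
Qed.

Section jensen.
Context d (T : measurableType d) (R : realType) (mu : {measure set T -> \bar R}).
Local Open Scope ereal_scope.

(** Integrate Young's inequality with a = int k |g| and b = |g(x)| against the probability
    density k. *)
Lemma jensen_powR (p : R) (k g : T -> R) : (1 <= p)%R ->
  measurable_fun [set: T] k -> measurable_fun [set: T] g -> (forall x, 0 <= k x)%R ->
  \int[mu]_x (k x)%:E = 1 -> \int[mu]_x (k x * `|g x|)%:E < +oo ->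
  ((\int[mu]_x (k x * `|g x|)%:E) `^ p) <= \int[mu]_x (k x * `|g x| `^ p)%:E.
Proof.
move=> p1 mk mg k0 k1 koo.
have p0 : (0 < p)%R by rewrite (lt_le_trans _ p1).
have mkg : measurable_fun [set: T] (fun x => k x * `|g x|)%R.
  by apply: measurable_funM => //; exact: measurableT_comp.
have mkp : measurable_fun [set: T] (fun x => k x * `|g x| `^ p)%R.
  by apply: measurable_funM => //; exact: measurable_powR_norm.
set I := \int[mu]_x (k x * `|g x|)%:E.
have I0 : 0 <= I by apply: integral_ge0 => x _; rewrite lee_fin mulr_ge0.
have fI : I \is a fin_num by rewrite ge0_fin_numE.
set t := fine I; have t0 : (0 <= t)%R by exact: fine_ge0.
have It : I = t%:E by rewrite fineK.
rewrite It poweR_EFin.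
set J := \int[mu]_x _.
have J0 : 0 <= J.
  by apply: integral_ge0 => x _; rewrite lee_fin mulr_ge0 ?powR_ge0.
have c0 : (0 <= 1 - p^-1)%R by rewrite subr_ge0 invf_le1.
have H : (t `^ (p - 1))%:E * I <= ((1 - p^-1) * t `^ p)%:E * \int[mu]_x (k x)%:E + (p^-1)%:E * J.
  rewrite /I /J -!ge0_integralZl_EFin ?mulr_ge0 ?powR_ge0 ?invr_ge0 ?(ltW p0)//;
    try exact/measurable_EFinP; try (by move=> x _; rewrite lee_fin mulr_ge0 ?powR_ge0); try (by move=> x _; rewrite lee_fin).
  rewrite -ge0_integralD//; last 4 first.
  - by move=> x _; rewrite -EFinM lee_fin !mulr_ge0 ?powR_ge0.
  - by apply: measurable_funeM; exact/measurable_EFinP.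
  - by move=> x _; rewrite -EFinM lee_fin !mulr_ge0 ?powR_ge0 ?invr_ge0 ?(ltW p0).
  - by apply: measurable_funeM; exact/measurable_EFinP.
  apply: ge0_le_integral => //.
  - by move=> x _; rewrite -EFinM lee_fin !mulr_ge0 ?powR_ge0.
  - by apply: measurable_funeM; exact/measurable_EFinP.
  - by apply: emeasurable_funD; apply: measurable_funeM; exact/measurable_EFinP.
  move=> x _; rewrite -!EFinM -EFinD lee_fin.
  rewrite mulrCA [(_ * k x)%R]mulrC [(p^-1 * _)%R]mulrCA -mulrDr ler_wpM2l//.
  exact: young_powR.
move: H; rewrite k1 mule1 It -EFinM.
rewrite [(_ * t)%R]mulrC mulr_powRB1// => H.
have [Joo|Joo] := eqVneq J +oo; first by rewrite Joo leey.
have fJ : J \is a fin_num by rewrite ge0_fin_numE// ltey.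
move: H; rewrite -(fineK fJ) -EFinM -EFinD !lee_fin => H.
rewrite -(@ler_pM2l _ p^-1) ?invr_gt0//; lra.
Qed.

End jensen.

Section mollifier.
Context {R : realType} {N : nat}.
Local Notation V := 'rV[R]_(N + N + 1).
Local Notation mu := (@mu_heis R N).
Implicit Types (w k : V -> R) (h x : V).

(** Group convolution, with the kernel on the left: the substitution y = h o x shows that it
    averages the left translates of w ([molE]). *)
Definition mol k w x : R := \int[mu]_y (k (hmul y (- x)) * w y).

Lemma molE k w x : measurable_fun setT k -> measurable_fun setT w ->
  mol k w x = \int[mu]_h (k h * w (hmul h x)).
Proof.
move=> mk mw; rewrite /mol /Rintegral; congr fine.
rewrite -(@integral_rmul R N x (fun y => (k (hmul y (- x)) * w y)%:E)).
  by apply: eq_integral => h _; rewrite hmulxK.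
apply/measurable_EFinP; apply: measurable_funM => //.
by apply: measurableT_comp => //; exact: measurable_rmul.
Qed.

Local Open Scope ereal_scope.

(** By Jensen and Tonelli, the L^p distance from w to its mollification is at most the
    average of its distances to the left translates. *)
Lemma mol_Lp (p e M : R) k w : (1 <= p)%R -> (0 <= e)%R ->
  measurable_fun setT k -> (forall h, 0 <= k h <= M)%R ->
  \int[mu]_h (k h)%:E = 1 ->
  measurable_fun setT w -> mu.-integrable setT (EFin \o w) ->
  measurable_fun setT (mol k w) ->
  (forall h, k h != 0%R -> pint mu p setT (fun x => w (hmul h x) - w x)%R <= e%:E) ->
  pint mu p setT (fun x => mol k w x - w x)%R <= e%:E.
Proof.
move=> p1 e0 mk kM k1 mw iw mmol Hk.
have k0 h : (0 <= k h)%R by have /andP[] := kM h.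
have M0 : (0 <= M)%R by have /andP[a b] := kM 0%R; exact: le_trans b.
have mwh x : measurable_fun setT (fun h => w (hmul h x)).
  by apply: measurableT_comp => //; exact: measurable_rmul.
have woo x : \int[mu]_h `|(w (hmul h x))%:E| < +oo.
  rewrite (@integral_rmul R N x (fun y => `|(w y)%:E|)).
    by have /integrableP[] := iw.
  by apply: measurableT_comp => //; exact/measurable_EFinP.
have ik : mu.-integrable setT (EFin \o k).
  apply/integrableP; split; first exact/measurable_EFinP.
  by under eq_integral do rewrite gee0_abs ?lee_fin//; rewrite k1 ltry.
have ikw x : mu.-integrable setT (fun h => (k h * w (hmul h x))%:E).
  apply/integrableP; split; first exact/measurable_EFinP/measurable_funM.
  apply: (@le_lt_trans _ _ (\int[mu]_h (M%:E * `|(w (hmul h x))%:E|))).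
    apply: ge0_le_integral => //.
    - by apply: measurableT_comp => //; exact/measurable_EFinP/measurable_funM.
    - apply: measurable_funeM; apply: measurableT_comp => //; exact/measurable_EFinP.
    move=> h _; rewrite EFinM abseM lee_wpmul2r// gee0_abs ?lee_fin//.
    by have /andP[] := kM h.
  rewrite ge0_integralZl_EFin//.
    by rewrite lte_mul_pinfty ?lee_fin.
  by apply: measurableT_comp => //; exact/measurable_EFinP.
have ikc x : mu.-integrable setT (fun h => (k h * w x)%:E).
  by under eq_fun do rewrite EFinM; apply: integrableZr.
have molB x : (mol k w x - w x)%:E = \int[mu]_h (k h * (w (hmul h x) - w x))%:E.
  under eq_integral do rewrite mulrBr EFinB.
  rewrite integralB//; under [X in _ = _ - X]eq_integral do rewrite EFinM.
  rewrite integralZr// k1 mul1e molE// /Rintegral EFinB fineK//.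
  exact: integral_fune_fin_num.
pose g (z : V * V) : \bar R := (k z.2 * `|w (hmul z.2 z.1) - w z.1| `^ p)%:E.
have mg : measurable_fun setT g.
  apply/measurable_EFinP; apply: measurable_funM.
    by apply: measurableT_comp => //; exact: measurable_snd.
  apply: measurable_powR_norm; apply: measurable_funB.
    by apply: (measurableT_comp mw); apply: measurable_hmul.
  by apply: measurableT_comp => //; exact: measurable_fst.
have g0 z : 0 <= g z by rewrite lee_fin mulr_ge0 ?powR_ge0.
rewrite pintE.
apply: (@le_trans _ _ (\int[mu]_x \int[mu]_h g (x, h))).
  apply: ge0_le_integral => //.
  - by apply: measurable_EFin_powR; exact: measurable_funB.
  - exact: measurable_fun_fubini_tonelli_F.
  move=> x _ /=.
  have koo : \int[mu]_h (k h * `|w (hmul h x) - w x|)%:E < +oo.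
    have /integrableP[_] := integrableB measurableT (ikw x) (ikc x).
    apply: le_lt_trans; apply: ge0_le_integral => //.
    - by move=> h _; rewrite lee_fin mulr_ge0.
    - apply/measurable_EFinP/measurable_funM => //.
      by apply: measurableT_comp => //; exact: measurable_funB.
    - apply: measurableT_comp => //; apply: emeasurable_funB;
        exact/measurable_EFinP/measurable_funM.
    move=> h _; rewrite -EFinB -mulrBr lee_fin normrM ger0_norm//.
  have mB : measurable_fun setT (fun h => w (hmul h x) - w x)%R by exact: measurable_funB.
  apply: le_trans (jensen_powR p1 mk mB k0 k1 koo).
  have IL : `|mol k w x - w x|%:E \in `[0, +oo] by rewrite in_itv/= lee_fin normr_ge0 leey.
  have IR : \int[mu]_h (k h * `|w (hmul h x) - w x|)%:E \in `[0, +oo].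
    by rewrite in_itv/= leey andbT integral_ge0// => h _; rewrite lee_fin mulr_ge0.
  have p0 : (0 <= p)%R by rewrite (le_trans _ p1).
  rewrite -poweR_EFin; apply: (gt0_ler_poweR p0 IL IR).
  rewrite -abse_EFin molB; apply: (le_trans (le_abse_integral _ _ _)) => //.
    exact/measurable_EFinP/measurable_funM.
  apply: ge0_le_integral => //.
  - apply: measurableT_comp => //; exact/measurable_EFinP/measurable_funM.
  - apply/measurable_EFinP/measurable_funM => //; exact: measurableT_comp.
  by move=> h _; rewrite lee_fin normrM ger0_norm.
rewrite fubini_tonelli//.
apply: (@le_trans _ _ (\int[mu]_h ((k h)%:E * e%:E))).
  apply: ge0_le_integral => //.
  - by move=> h _; apply: integral_ge0.
  - exact: measurable_fun_fubini_tonelli_G.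
  - by apply: emeasurable_funM => //; exact/measurable_EFinP.
  move=> h _; rewrite /g /=.
  under eq_integral do rewrite EFinM.
  rewrite ge0_integralZl_EFin//; last first.
    apply: measurable_EFin_powR; apply: measurable_funB => //.
    by apply: measurableT_comp => //; exact: measurable_lmul.
  have [->|kh] := eqVneq (k h) 0%R; first by rewrite !mul0e.
  by rewrite lee_wpmul2l ?lee_fin// -pintE; exact: Hk.
rewrite ge0_integralZr//; last 2 first.
- exact/measurable_EFinP.
- by move=> h _; rewrite lee_fin.
by rewrite k1 mul1e.
Qed.

End mollifier.

(** * Differentiation of mollified functions *)

Lemma continuous_distP (R : realType) (T : topologicalType) (f : T -> R) :
  (forall (x : T) (e : R), 0 < e -> \forall x' \near x, `|f x - f x'| <= e) ->
  continuous f.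
Proof. by move=> H x; apply/cvgrPdist_le => e e0; exact: H. Qed.

Section param_integral.
Context {R : realType} {N : nat}.
Local Notation V := 'rV[R]_(N + N + 1).
Local Notation mu := (@mu_heis R N).
Implicit Types (w g : V -> R) (L : set V).

Lemma compact_norm_bounded L g : compact L -> continuous g ->
  exists2 M : R, 0 < M & forall y, L y -> `|g y| <= M.
Proof.
move=> cL cg.
have cgL : compact (g @` L).
  by apply: continuous_compact => //; exact: continuous_subspaceT.
have [M [Mr HM]] := compact_bounded cgL.
exists (Num.max (M + 1) 1) => [|y Ly]; first by rewrite lt_max ltr01 orbT.
apply: HM; last by exists y.
by rewrite lt_max ltrDl ltr01.
Qed.

Lemma compact_closed_rV n (K : set 'rV[R]_n) : compact K -> closed K.
Proof. by apply: compact_closed; exact: norm_hausdorff. Qed.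

Lemma compact_measurable_rV n (K : set 'rV[R]_n) : compact K -> measurable K.
Proof.
move=> /compact_closed_rV cK; rewrite -(setCK K); apply: measurableC.
by apply: open_measurable_rV; exact: closed_openC.
Qed.

Lemma integrable_cont_mul L g w : compact L -> continuous g ->
  mu.-integrable setT (EFin \o w) -> (forall y, w y != 0 -> L y) ->
  mu.-integrable setT (EFin \o (fun y => g y * w y)).
Proof.
move=> cL cg iw wL; have [M M0 HM] := compact_norm_bounded cL cg.
have mw : measurable_fun setT w by have /integrableP[/measurable_EFinP] := iw.
apply: (@le_integrable _ _ _ mu setT measurableT _ (EFin \o (fun y => M * w y))).
- apply/measurable_EFinP/measurable_funM => //; exact: continuous_measurable_rV.
- move=> y _ /=; rewrite lee_fin !normrM (gtr0_norm M0).
  have [->|/wL/HM gM] := eqVneq (w y) 0; first by rewrite normr0 !mulr0.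
  by rewrite ler_wpM2r.
rewrite (_ : _ \o _ = fun y => (M%:E * (w y)%:E)%E) //.
exact: integrableZl.
Qed.

(** Compactness of L makes the continuity in the parameter x uniform in y. *)
Lemma near_uniform L (psi : V -> V -> R) x (e : R) : compact L ->
  continuous (fun z : V * V => psi z.1 z.2) -> 0 < e ->
  \forall x' \near x, forall y, L y -> `|psi x' y - psi x y| <= e.
Proof.
move=> /compact_near_coveringP cL cpsi e0.
have := cL V (nbhs x) (fun x' y => `|psi x' y - psi x y| <= e) _; apply => y Ly.
have e20 : 0 < e / 2 by rewrite divr_gt0.
have /cvgrPdist_lt /(_ _ e20) [[A B] /= [nA nB] AB] := cpsi (x, y).
exists (B, A) => //= -[y' x'] /= [By' Ax'].
have xA : A x by exact: nbhs_singleton.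
have H1 := AB (x', y') (conj Ax' By'); have H2 := AB (x, y') (conj xA By').
rewrite (splitr e) (le_trans (ler_distD (psi x y) _ _))// lerD//.
  by rewrite distrC ltW.
exact: ltW.
Qed.

Lemma param_integral_le L (A B : V -> R) w (e : R) : compact L ->
  continuous A -> continuous B ->
  mu.-integrable setT (EFin \o w) -> (forall y, w y != 0 -> L y) -> 0 <= e ->
  (forall y, L y -> `|A y - B y| <= e) ->
  `|\int[mu]_y (A y * w y) - \int[mu]_y (B y * w y)| <= e * \int[mu]_y `|w y|.
Proof.
move=> cL cA cB iw wL e0 HAB.
have iA := integrable_cont_mul cL cA iw wL.
have iB := integrable_cont_mul cL cB iw wL.
rewrite -RintegralB//.
have iAB : mu.-integrable setT (EFin \o (fun y => A y * w y - B y * w y)).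
  by rewrite (_ : _ \o _ = (fun y => (A y * w y)%:E - (B y * w y)%:E)%E);
    [exact: integrableB|].
apply: (le_trans (le_normr_Rintegral _ _)) => //.
have iaw : mu.-integrable setT (EFin \o (fun y => `|w y|)) by exact: integrable_norm.
rewrite -RintegralZl//; apply: le_Rintegral => //.
- exact: integrable_norm.
- rewrite (_ : _ \o _ = fun y => (e%:E * (`|w y|)%:E)%E) //; exact: integrableZl.
move=> y _; rewrite -mulrBl normrM.
have [->|/wL/HAB gM] := eqVneq (w y) 0; first by rewrite normr0 !mulr0.
by rewrite ler_wpM2r.
Qed.

Lemma continuous_section (psi : V -> V -> R) a :
  continuous (fun z : V * V => psi z.1 z.2) -> continuous (psi a).
Proof.
move=> cpsi y S /(cpsi (a, y)) [[A B] /= [nA nB] AB].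
apply: filterS nB => y' By'; apply: (AB (a, y')); split => //.
exact: nbhs_singleton.
Qed.

Lemma continuous_param_integral L (psi : V -> V -> R) w : compact L ->
  continuous (fun z : V * V => psi z.1 z.2) ->
  mu.-integrable setT (EFin \o w) -> (forall y, w y != 0 -> L y) ->
  continuous (fun x => \int[mu]_y (psi x y * w y)).
Proof.
move=> cL cpsi iw wL.
apply: continuous_distP => x e e0.
set I := \int[mu]_y `|w y|.
have I0 : 0 <= I by apply: Rintegral_ge0.
have e'0 : 0 < e / (I + 1) by rewrite divr_gt0// ltr_wpDl.
have cx a : continuous (psi a) by exact: continuous_section.
near=> x'.
rewrite distrC; apply: (@le_trans _ _ (e / (I + 1) * I)).
  apply: (param_integral_le cL) => //; first exact: ltW.
  by near: x'; exact: near_uniform.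
by rewrite mulrAC ler_pdivrMr ?ltr_wpDl// ler_wpM2l ?ltW// ltrDl.
Unshelve. all: by end_near. Qed.

(** Differentiation under the integral sign: difference quotients are values of the
    derivative at intermediate points, hence converge uniformly on the compact set L. *)
Lemma derive_param_integral L (K dK : V -> V -> R) w v x : compact L ->
  (forall y x', derivable (K^~ y) x' v) ->
  (forall y x', 'D_v (K^~ y) x' = dK x' y) ->
  continuous (fun z : V * V => K z.1 z.2) ->
  continuous (fun z : V * V => dK z.1 z.2) ->
  mu.-integrable setT (EFin \o w) -> (forall y, w y != 0 -> L y) ->
  derivable (fun x => \int[mu]_y (K x y * w y)) x v /\
  'D_v (fun x => \int[mu]_y (K x y * w y)) x = \int[mu]_y (dK x y * w y).
Proof.
move=> cL dKv dKE cK cdK iw wL.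
set F := fun x => _.
have cx (psi : V -> V -> R) a : continuous (fun z : V * V => psi z.1 z.2) ->
    continuous (psi a) by exact: continuous_section.
suff H : h^-1 *: ((F \o shift x) (h *: v) - F x) @[h --> (0:R)^'] -->
    \int[mu]_y (dK x y * w y).
  by split; [apply/cvg_ex; eexists; exact: H|exact: cvg_lim H].
apply/cvgrPdist_le => e e0.
set I := \int[mu]_y `|w y|.
have I0 : 0 <= I by apply: Rintegral_ge0.
have e'0 : 0 < e / (I + 1) by rewrite divr_gt0// ltr_wpDl.
have /nbhs_ballP[d /= d0 Hd] := near_uniform x cL cdK e'0.
have dv0 : 0 < d / (`|v| + 1) by rewrite divr_gt0// ltr_wpDl.
near=> h.
have h0 : h != 0 by near: h; exact: nbhs_dnbhs_neq.
have hd : `|h| < d / (`|v| + 1) by near: h; exact: dnbhs0_lt.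
have E : h^-1 *: ((F \o shift x) (h *: v) - F x) =
    \int[mu]_y ((h^-1 * (K (h *: v + x) y - K x y)) * w y).
  rewrite /F /= -RintegralB//; last 2 first.
  - exact: (integrable_cont_mul cL (cx K _ cK) iw wL).
  - exact: (integrable_cont_mul cL (cx K _ cK) iw wL).
  rewrite -[LHS]RintegralZl//; last first.
    rewrite (_ : _ \o _ = (fun y => (K (h *: v + x) y * w y)%:E - (K x y * w y)%:E)%E)//.
    by apply: integrableB => //; exact: (integrable_cont_mul cL (cx K _ cK) iw wL).
  by apply: eq_Rintegral => y _; rewrite -mulrBl mulrA.
rewrite {}E; apply: (@le_trans _ _ (e / (I + 1) * I)).
  apply: (param_integral_le cL) => //.
  - exact: cx.
  - by apply: ctsM; [exact: cts_cst|apply: ctsB; exact: cx].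
  - exact: ltW.
  move=> y Ly.
  have [c ch ->] := MVT_line x h (dKv y).
  rewrite mulrA mulVf// mul1r dKE distrC; apply: Hd => //.
  rewrite -ball_normE /= opprD addrCA subrr addr0 normrN normrZ.
  apply: le_lt_trans (ler_wpM2r (normr_ge0 v) ch) _.
  have : `|h| * (`|v| + 1) < d by rewrite -ltr_pdivlMr// ltr_wpDl.
  by apply: le_lt_trans; rewrite ler_wpM2l// lerDl.
by rewrite mulrAC ler_pdivrMr ?ltr_wpDl// ler_wpM2l ?ltW// ltrDl.
Unshelve. all: by end_near. Qed.

End param_integral.

Section mollifier_derivative.
Context {R : realType} {N : nat}.
Local Notation V := 'rV[R]_(N + N + 1).
Local Notation mu := (@mu_heis R N).
Implicit Types (w g k : V -> R) (L : set V) (v x y : V).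

Lemma derive_affine n m (f : 'rV[R]_m -> R) (A L : 'rV[R]_n -> 'rV[R]_m)
    (v x : 'rV[R]_n) :
  (forall (t : R) (v x : 'rV[R]_n), A (t *: v + x) = t *: L v + A x) ->
  derivable f (A x) (L v) ->
  derivable (f \o A) x v /\ 'D_v (f \o A) x = 'D_(L v) f (A x).
Proof.
move=> AL.
have E : (fun h : R => h^-1 *: ((f \o A \o shift x) (h *: v) - (f \o A) x)) =
    (fun h : R => h^-1 *: ((f \o shift (A x)) (h *: L v) - f (A x))).
  by apply/funext => h /=; rewrite AL.
by move=> df; split; rewrite /derivable /derive E.
Qed.

(** Velocity of x |-> y o x^-1 when x moves in the direction v. *)
Definition kdir (y v : V) : V := - v - symp y v *: etau.

Lemma hmulN_affine y (t : R) v x :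
  hmul y (- (t *: v + x)) = t *: kdir y v + hmul y (- x).
Proof.
apply/rowP => j; rewrite !hmulE /kdir !sympE !mxE; ring.
Qed.

(** Velocity of y |-> y o x^-1 when y moves in the direction v. *)
Definition ldir (x v : V) : V := v + symp v (- x) *: etau.

Lemma hmul_affine x (t : R) v y :
  hmul (t *: v + y) (- x) = t *: ldir x v + hmul y (- x).
Proof.
by apply/rowP => j; rewrite !hmulE /ldir !sympE !mxE; ring.
Qed.

Lemma deriveN_dir f x v : cd 1 f -> 'D_(- v) f x = - ('D_v f x : R).
Proof.
move=> cf; rewrite !C1_deriveE// -sumrN; apply: eq_bigr => j _.
by rewrite mxE mulNr.
Qed.

Lemma derive_kernel k y v x : cd 1 k ->
  derivable (fun x => k (hmul y (- x))) x v /\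
  'D_v (fun x => k (hmul y (- x))) x = 'D_(kdir y v) k (hmul y (- x)).
Proof.
move=> ck; apply: (@derive_affine _ _ k (fun x => hmul y (- x)) (kdir y)).
  by move=> t v' x'; exact: hmulN_affine.
exact: C1_derivable.
Qed.

Lemma cd_kernel n k x : cd n k -> cd n (fun y => k (hmul y (- x))).
Proof.
apply: (@cd_comp_sub R _ n _ k (fun y => hmul y (- x)) (ldir x)).
  by move=> t v y; exact: hmul_affine.
by apply: (@continuous_hmul R N _ id (cst (- x))); [by move=> y|exact: cst_continuous].
Qed.

(** The kernel k(y o x^-1) depends on y and x through the group only: X_i acting in y is
    minus X_i acting in x. *)
Lemma Xfield_kernel k i x y : cd 1 k ->
  Xfield i (fun y => k (hmul y (- x))) y = - 'D_(kdir y (xdir i x)) k (hmul y (- x)).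
Proof.
move=> ck; rewrite XfieldE; last exact: cd_kernel.
have [_ ->] := @derive_affine _ _ k (fun y => hmul y (- x)) (ldir x) (xdir i y) y
  (fun t v' y' => hmul_affine x t v' y') (@C1_derivable _ _ k _ _ ck).
rewrite -deriveN_dir//; congr derive.
rewrite /kdir /ldir /xdir !sympE (symp_sym _ x); apply/rowP => j; rewrite !mxE; ring.
Qed.

Lemma continuous_kernel (g : V -> R) : continuous g ->
  continuous (fun z : V * V => g (hmul z.2 (- z.1))).
Proof.
move=> cg z; apply: (@continuous_comp _ _ _ (fun z : V * V => hmul z.2 (- z.1)) g).
  apply: continuous_hmul => [t|t]; first exact: cvg_snd.
  by apply: cvgN; exact: cvg_fst.
exact: cg.
Qed.

Lemma continuous_derive_kernel k (v : V * V -> V) : cd 1 k -> continuous v ->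
  continuous (fun z : V * V => 'D_(kdir z.2 (v z)) k (hmul z.2 (- z.1))).
Proof.
move=> ck cv.
rewrite (_ : (fun z => _) = fun z : V * V => \sum_j kdir z.2 (v z) ord0 j *
    partial j k (hmul z.2 (- z.1))); last by apply/funext => z; rewrite C1_deriveE.
apply: continuous_sumr => j.
have cvj : continuous (fun z => v z ord0 j).
  by move=> z; exact: (continuous_comp (cv z) (@continuous_coord R _ j (v z))).
apply: ctsM.
  rewrite /kdir; rewrite (_ : (fun z => _) = fun z : V * V =>
    - v z ord0 j - symp z.2 (v z) * etau ord0 j); last first.
    by apply/funext => z; rewrite !mxE.
  apply: ctsB; first exact: ctsN.
  apply: ctsM; last exact: cts_cst.
  by apply: continuous_symp => // t; exact: cvg_snd.
by apply: continuous_kernel; have [_ /(_ j)[_ []]] := ck.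
Qed.

Lemma mol_C1 L k w : compact L -> cd 1 k ->
  mu.-integrable setT (EFin \o w) -> (forall y, w y != 0 -> L y) ->
  cd 1 (mol k w) /\ forall v x, 'D_v (mol k w) x =
    \int[mu]_y ('D_(kdir y v) k (hmul y (- x)) * w y).
Proof.
move=> cL ck iw wL.
have H v x : derivable (mol k w) x v /\ 'D_v (mol k w) x =
    \int[mu]_y ('D_(kdir y v) k (hmul y (- x)) * w y).
  apply: (@derive_param_integral R N L (fun x y => k (hmul y (- x)))
    (fun x y => 'D_(kdir y v) k (hmul y (- x)))) => //.
  - by move=> y x'; have [] := @derive_kernel k y v x' ck.
  - by move=> y x'; have [] := @derive_kernel k y v x' ck.
  - by apply: continuous_kernel; exact: cd_continuous ck.
  - by apply: (continuous_derive_kernel ck) => z; exact: cvg_cst.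
split; last by move=> v x; have [] := H v x.
split.
  apply: (@continuous_param_integral R N L (fun x y => k (hmul y (- x)))) => //.
  by apply: continuous_kernel; exact: cd_continuous ck.
move=> j; split; first by move=> x; have [] := H (delta_mx ord0 j) x.
split => //.
rewrite (_ : partial j _ = fun x =>
    \int[mu]_y ('D_(kdir y (delta_mx ord0 j)) k (hmul y (- x)) * w y)); last first.
  by apply/funext => x; have [] := H (delta_mx ord0 j) x.
apply: (@continuous_param_integral R N L
  (fun x y => 'D_(kdir y (delta_mx ord0 j)) k (hmul y (- x)))) => //.
by apply: (continuous_derive_kernel ck) => z; exact: cvg_cst.
Qed.

Lemma compact_supportP (Omega K : set V) g : compact K -> K `<=` Omega ->
  (forall x, g x != 0 -> K x) -> compact_support Omega g.
Proof.
move=> cK KO gK.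
have H : closure [set x | g x != 0] `<=` K.
  have /closure_id -> := compact_closed_rV cK.
  exact: closure_subset.
split; last exact: subset_trans KO.
by apply: subclosed_compact cK H; exact: closed_closure.
Qed.

Lemma test_functionM f g : smooth f -> test_function g ->
  test_function (fun x => f x * g x).
Proof.
move=> sf [sg [cg _]]; split; first by move=> k; apply: cdM; [exact: sf|exact: sg].
apply: (@compact_supportP _ (closure [set x | g x != 0])) => // x.
by rewrite mulf_eq0 negb_or => /andP[_ gx]; apply: subset_closure.
Qed.

(** A compactly supported continuous factor makes a locally integrable function integrable. *)
Lemma loc_integrableM (c g : V -> R) K : compact K -> continuous c ->
  (forall x, c x != 0 -> K x) -> loc_integrable g ->
  mu.-integrable setT (EFin \o (fun x => c x * g x)).
Proof.
move=> cK cc cKs [mg Hg].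
have mK : measurable K by exact: compact_measurable_rV.
pose gK x := g x * \1_K x.
have -> : (fun x => c x * g x) = (fun x => c x * gK x).
  apply/funext => x; rewrite /gK; have [->|/cKs Kx] := eqVneq (c x) 0.
    by rewrite !mul0r.
  by rewrite indicE mem_set// mulr1.
apply: (@integrable_cont_mul R N K) => //; last first.
  move=> y; rewrite /gK indicE; have [|] := boolP (y \in K); first by rewrite inE.
  by rewrite mulr0 eqxx.
apply/integrableP; split.
  by apply/measurable_EFinP/measurable_funM => //; exact: measurable_indic.
rewrite (_ : (\int[_]_x _ = \int[mu]_(x in K) `|g x|%:E)%E); first exact: Hg.
rewrite [RHS]integral_mkcond; apply: eq_integral => x _.
rewrite /gK /= patchE indicE; case: (x \in K); first by rewrite mulr1.
by rewrite mulr0 normr0.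
Qed.

Lemma weak_X_Rintegral i u g phi : is_weak_X i u g -> loc_integrable u ->
  test_function phi ->
  \int[mu]_x (u x * Xfield i phi x) = - \int[mu]_x (g x * phi x).
Proof.
move=> [lg H] lu tphi; rewrite /Rintegral H// fineN; congr (- _).
Qed.

Lemma Xfield_support i f K x : cd 1 f -> closed K ->
  (forall y, f y != 0 -> K y) -> Xfield i f x != 0 -> K x.
Proof.
move=> cf cK fK; apply: contraPP => nKx; rewrite XfieldE//.
rewrite (@near_eq_derive _ _ _ _ (cst 0)) ?derive_cst ?eqxx//.
have : nbhs x (~` K) by apply: open_nbhs_nbhs; split => //; exact: closed_openC.
apply: filterS => y nKy /=; apply/eqP; apply: contra_notT nKy; exact: fK.
Qed.

(** The fields X_i are left-invariant and mollification averages left translations: after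
    an integration by parts in y, given by the weak derivative of u tested with the kernel
    times chi, the derivative falls on chi u. *)
Lemma Xfield_mol i k chi u g x : smooth k -> test_function chi ->
  loc_integrable u -> is_weak_X i u g ->
  Xfield i (mol k (fun y => chi y * u y)) x =
  mol k (fun y => chi y * g y + Xfield i chi y * u y) x.
Proof.
move=> sk tchi lu wg; have [schi [cK _]] := tchi.
set K := closure [set x | chi x != 0] in cK.
have lg : loc_integrable g by case: wg.
have chiK y : chi y != 0 -> K y by move=> cy; apply: subset_closure.
have cchi : continuous chi := cd_continuous (schi 1%N).
have c1k : cd 1 k := sk 1%N; have c1chi : cd 1 chi := schi 1%N.
have iw := loc_integrableM cK cchi chiK lu.
have wK y : chi y * u y != 0 -> K y.
  by rewrite mulf_eq0 negb_or => /andP[/chiK].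
have [cmol Dmol] := mol_C1 cK c1k iw wK.
pose kx y := k (hmul y (- x)).
have skx : smooth kx by move=> n; apply: cd_kernel; exact: sk.
have tphi : test_function (fun y => kx y * chi y) by exact: test_functionM.
have ckx : continuous kx := cd_continuous (skx 1%N).
have cXkx : continuous (Xfield i kx) by apply: continuous_Xfield; exact: skx.
have cXchi : continuous (Xfield i chi) by exact: continuous_Xfield.
have XchiK y : Xfield i chi y != 0 -> K y.
  by apply: Xfield_support => //; exact: compact_closed_rV.
have i1 : mu.-integrable setT (EFin \o (fun y => (kx y * Xfield i chi y) * u y)).
  apply: loc_integrableM cK _ _ lu => [|y]; first exact: ctsM.
  by rewrite mulf_eq0 negb_or => /andP[_ /XchiK].
have i2 : mu.-integrable setT (EFin \o (fun y => (chi y * Xfield i kx y) * u y)).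
  apply: loc_integrableM cK _ _ lu => [|y]; first exact: ctsM.
  by rewrite mulf_eq0 negb_or => /andP[/chiK].
have i3 : mu.-integrable setT (EFin \o (fun y => (kx y * chi y) * g y)).
  apply: loc_integrableM cK _ _ lg => [|y]; first exact: ctsM.
  by rewrite mulf_eq0 negb_or => /andP[_ /chiK].
rewrite XfieldE// Dmol /mol.
transitivity (\int[mu]_y (- ((chi y * Xfield i kx y) * u y))).
  apply: eq_Rintegral => y _; rewrite Xfield_kernel//; ring.
transitivity (\int[mu]_y ((kx y * chi y) * g y + (kx y * Xfield i chi y) * u y));
  last by apply: eq_Rintegral => y _; rewrite /kx; ring.
have := weak_X_Rintegral wg lu tphi.
rewrite (_ : \int[mu]_y (u y * _) =
  \int[mu]_y ((chi y * Xfield i kx y) * u y + (kx y * Xfield i chi y) * u y)); last first.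
  by apply: eq_Rintegral => y _; rewrite XfieldM//; ring.
rewrite (_ : \int[mu]_y (g y * _) = \int[mu]_y ((kx y * chi y) * g y)); last first.
  by apply: eq_Rintegral => y _; ring.
rewrite !RintegralD// => H.
rewrite (_ : \int[mu]_y (- _) = - \int[mu]_y (chi y * Xfield i kx y * u y)); last first.
  by rewrite -mulN1r -RintegralZl//; apply: eq_Rintegral => y _; rewrite mulN1r.
move: H; set I1 := Rintegral _ _ _; set I2 := Rintegral _ _ _; set I3 := Rintegral _ _ _.
move: I1 I2 I3 => I1 I2 I3; clear; lra.
Qed.

End mollifier_derivative.

(** * Approximate identities and weak horizontal derivatives *)

Section kernels.
Context {R : realType} {N : nat}.
Local Notation V := 'rV[R]_(N + N + 1).
Local Notation mu := (@mu_heis R N).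
Local Open Scope ereal_scope.
Implicit Types (w g k : V -> R) (x y h : V).

Lemma mu_compact_fin (K : set V) : compact K -> mu K < +oo.
Proof.
move=> cK; apply: mu_heis_bounded; first exact: compact_measurable_rV.
exact: compact_bounded.
Qed.

Lemma pint_loc_integrable (p : R) g : (1 <= p)%R -> measurable_fun setT g ->
  pint mu p setT g < +oo -> loc_integrable g.
Proof.
move=> p1 mg; rewrite pintE => fg; split => // K cK.
have mK : measurable K by exact: compact_measurable_rV.
have mpg : measurable_fun setT (fun x => (`|g x| `^ p)%:E).
  exact: measurable_EFin_powR.
apply: (@le_lt_trans _ _ (\int[mu]_(x in K) (1 + (`|g x| `^ p)%:E))).
  apply: ge0_le_integral => //.
  - apply: measurable_funTS; apply/measurable_EFinP.
    exact: measurableT_comp (@normr_measurable _ _) mg.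
  - by apply: emeasurable_funD => //; exact: measurable_funTS.
  move=> x _; rewrite -EFinD lee_fin.
  have [g1|g1] := lerP `|g x|%R 1%R; first by rewrite (le_trans g1)// lerDl powR_ge0.
  by rewrite ler_wpDl// -[leLHS]powRr1// ler_powR// ltW.
rewrite ge0_integralD//; last exact: measurable_funTS.
rewrite lte_add_pinfty//; first by rewrite integral_cst// mul1e; exact: mu_compact_fin.
apply: le_lt_trans fg; exact: ge0_subset_integral.
Qed.

Lemma mu_ball_gt0 (c : V) (r : R) : (0 < r)%R -> 0 < mu (ball c r).
Proof.
move=> r0.
rewrite (_ : ball c r = [set v : V | forall i, `](c ord0 i - r)%R, (c ord0 i + r)%R[%classic (v ord0 i)]).
  have mI i : measurable `](c ord0 i - r)%R, (c ord0 i + r)%R[%classic.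
    exact: measurable_itv.
  have -> : mu [set v : V | forall i, `](c ord0 i - r)%R, (c ord0 i + r)%R[%classic (v ord0 i)] =
      \prod_(i < N + N + 1) lebesgue_measure `](c ord0 i - r)%R, (c ord0 i + r)%R[%classic.
    exact: lebesgue_rV_box.
  elim/big_ind : _ => // [a b a0 b0|i _]; first exact: mule_gt0.
  by rewrite lebesgue_measure_itv/= lte_fin ltrBlDr -addrA ltrDl addr_gt0// -EFinB lte_fin subr_gt0 ltrBlDr -addrA ltrDl addr_gt0.
apply/seteqP; split => [v|v Hv]; rewrite -ball_normE /=.
  move=> cv i; have := le_lt_trans (ler_coord_norm _ i) cv.
  by rewrite !mxE /= in_itv/= distrC ltr_distl.
apply: rV_norm_lt => // i; have := Hv i.
by rewrite !mxE /= in_itv/= distrC ltr_distl.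
Qed.

(** The kernels are normalized bumps centred at an arbitrary point c: mollifying with
    them smooths and translates at the same time. *)
Lemma exists_kernel (c : V) (r : R) : (0 < r)%R ->
  exists k (M : R), [/\ smooth k, forall h, (0 <= k h <= M)%R,
    \int[mu]_h (k h)%:E = 1 & forall h, k h != 0%R -> (`|h - c| < r)%R].
Proof.
move=> r0; pose b := bump r c.
have cb : continuous b := cd_continuous (@smooth_bump R _ r c 1%N).
have mb : measurable_fun setT b by exact: continuous_measurable_rV.
have b0 := bump_ge0 r c.
have b1 x : (b x <= 1)%R.
  rewrite /b /bump /flat; case: ifP => // t0.
  by rewrite expr0 mul1r -expR0 ler_expR oppr_le0 invr_ge0 ltW.
pose I := \int[mu]_h (b h)%:E.
have mB : measurable (ball c r : set V) by apply: open_measurable_rV; exact: ball_open.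
have Ioo : I < +oo.
  apply: (@le_lt_trans _ _ (\int[mu]_(x in ball c r) 1)).
    rewrite [leRHS]integral_mkcond; apply: ge0_le_integral => //.
    - by move=> x _; rewrite lee_fin.
    - exact/measurable_EFinP.
    - by apply/(measurable_restrictT _ mB).
    move=> x _; rewrite patchE; case: ifPn; first by rewrite lee_fin.
    rewrite notin_setE -ball_normE /= => H; rewrite lee_fin.
    have [->//|/bump_support] := eqVneq (b x) 0%R.
    by rewrite distrC => /(_ r0).
  rewrite integral_cst// mul1e; apply: mu_heis_bounded => //.
  exists (`|c| + r)%R; split; first by rewrite num_real.
  move=> M cM y; rewrite -ball_normE /= => cy; apply: le_trans (ltW cM).
  by rewrite -(subrK c y) addrC (le_trans (ler_normD _ _))// lerD2l distrC ltW.
have I0 : 0 < I.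
  have bc : (0 < b c)%R by exact: bump_center.
  have bc2 : (0 < b c / 2)%R by rewrite divr_gt0.
  have /cvgrPdist_lt /(_ _ bc2) /nbhs_ballP[d /= d0 Hd] := cb c.
  have mBd : measurable (ball c d : set V) by apply: open_measurable_rV; exact: ball_open.
  apply: (@lt_le_trans _ _ (\int[mu]_(x in ball c d) (b c / 2)%:E)).
    by rewrite integral_cst// mule_gt0 ?lte_fin ?divr_gt0//; exact: mu_ball_gt0.
  apply: (@le_trans _ _ (\int[mu]_(x in ball c d) (b x)%:E)).
    apply: ge0_le_integral => //.
    - by move=> x _; rewrite lee_fin divr_ge0// ltW.
    - by apply: measurable_funTS; exact/measurable_EFinP.
    move=> x /Hd; rewrite lee_fin ltr_distlC => /andP[H _]; apply: ltW.
    by apply: le_lt_trans H; rewrite {2}(splitr (b c)) addrK.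
  by apply: ge0_subset_integral => //; [exact/measurable_EFinP|move=> x _; rewrite lee_fin].
have IE : (fine I)%:E = I by rewrite fineK// ge0_fin_numE// ltW.
have fI0 : (0 < fine I)%R by rewrite -lte_fin IE.
exists (fun h => (fine I)^-1 * b h)%R, (fine I)^-1%R; split.
- by move=> n; apply: cdZ; exact: smooth_bump.
- move=> h; have fV0 : (0 <= (fine I)^-1)%R by rewrite invr_ge0 ltW.
  by rewrite mulr_ge0// ler_piMr.
- under eq_integral do rewrite EFinM.
  rewrite ge0_integralZl_EFin//; last 3 first.
  + by move=> x _; rewrite lee_fin.
  + exact/measurable_EFinP.
  + by rewrite invr_ge0 ltW.
  by rewrite -/I -IE -EFinM mulVf// gt_eqF.
- by move=> h; rewrite mulf_eq0 negb_or => /andP[_]; exact: bump_support.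
Qed.

(** Approximate identity for kernels supported near 0, not necessarily around 0. *)
Lemma mol_cvg (p e : R) w (K : set V) : (1 <= p)%R -> (0 < e)%R ->
  measurable_fun setT w -> mu.-integrable setT (EFin \o w) -> compact K ->
  (forall y, w y != 0%R -> K y) -> pint mu p setT w < +oo ->
  exists2 d : R, (0 < d)%R & forall k (M : R), smooth k ->
    (forall h, (0 <= k h <= M)%R) -> \int[mu]_h (k h)%:E = 1 ->
    (forall h, k h != 0%R -> (`|h| < d)%R) ->
    pint mu p setT (fun x => mol k w x - w x)%R <= e%:E.
Proof.
move=> p1 e0 mw iw cK wK wp.
have [d d0 Hd] := tcont_Lp p1 mw wp e0.
exists d => // k M sk kM k1 kd.
have ck : continuous k := cd_continuous (sk 1%N).
have [cmol _] := mol_C1 cK (sk 1%N) iw wK.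
apply: (@mol_Lp R N p e M) => //.
- exact: ltW.
- exact: continuous_measurable_rV.
- by apply: continuous_measurable_rV; exact: cd_continuous cmol.
- by move=> h /kd; exact: Hd.
Qed.

(** The difference of two weak derivatives is orthogonal to all translated kernels times
    a cut-off, so that its mollifications vanish. *)
Lemma is_weak_X_unique i u g1 g2 : is_weak_X i u g1 -> is_weak_X i u g2 ->
  {ae mu, forall x, g1 x = g2 x}.
Proof.
move=> [lg1 H1] [lg2 H2].
have mg1 : measurable_fun setT g1 by case: lg1.
have mg2 : measurable_fun setT g2 by case: lg2.
have lift chi : test_function chi -> {ae mu, forall x, chi x * (g1 x - g2 x) = 0}%R.
  move=> tchi; have [schi [cK _]] := tchi.
  set K := closure [set x | chi x != 0%R] in cK.
  have chiK y : chi y != 0%R -> K y by move=> cy; apply: subset_closure.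
  have cchi : continuous chi := cd_continuous (schi 1%N).
  pose w x := (chi x * (g1 x - g2 x))%R.
  have i1 := loc_integrableM cK cchi chiK lg1.
  have i2 := loc_integrableM cK cchi chiK lg2.
  have iw : mu.-integrable setT (EFin \o w).
    rewrite (_ : _ \o _ = fun y => (chi y * g1 y)%:E - (chi y * g2 y)%:E).
      exact: integrableB.
    by apply/funext => y; rewrite /w /= mulrBr EFinB.
  have wK y : w y != 0%R -> K y by rewrite mulf_eq0 negb_or => /andP[/chiK].
  have mw : measurable_fun setT w by have /integrableP[/measurable_EFinP] := iw.
  have w1 : pint mu 1 setT w < +oo.
    rewrite pintE; have /integrableP[_] := iw; apply: le_lt_trans.
    rewrite le_eqVlt; apply/orP; left; apply/eqP; apply: eq_integral => x _.
    by rewrite powRr1.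
  have mol0 k x : smooth k -> mol k w x = 0%R.
    move=> sk; pose phi y := (k (hmul y (- x)) * chi y)%R.
    have tphi : test_function phi.
      by apply: test_functionM => // n; apply: cd_kernel; exact: sk.
    have cphi : continuous phi by case: tphi => /(_ 1%N) /cd_continuous.
    have phiK y : phi y != 0%R -> K y.
      by rewrite mulf_eq0 negb_or => /andP[_ /chiK].
    have j1 := loc_integrableM cK cphi phiK lg1.
    have j2 := loc_integrableM cK cphi phiK lg2.
    rewrite /mol; transitivity (\int[mu]_y (phi y * g1 y - phi y * g2 y))%R.
      by apply: eq_Rintegral => y _; rewrite /phi /w; ring.
    rewrite RintegralB//; apply/eqP; rewrite subr_eq0; apply/eqP.
    have := H1 _ tphi; rewrite H2// => /oppe_inj E.
    rewrite /Rintegral; congr fine.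
    under eq_integral do rewrite mulrC.
    by under [RHS]eq_integral do rewrite mulrC.
  apply: (@pint_eq0 _ _ _ mu 1%R) => //.
  apply/eqP; rewrite eq_le pint_ge0 andbT.
  apply/lee_addgt0Pr => e e0; rewrite add0e.
  have [d d0 Hd] := mol_cvg (lexx _) e0 mw iw cK wK w1.
  have [k [M [sk kM k1 kd]]] := exists_kernel (0 : V)%R d0.
  have := Hd k M sk kM k1 _; rewrite pintBC.
  under eq_fun do rewrite mol0// subr0.
  by apply => h /kd; rewrite subr0.
(* cut-offs that are eventually nonzero at each point *)
pose chi n := bump n.+1%:R (0 : V)%R.
have tchi n : test_function (chi n).
  split; first exact: smooth_bump.
  have cB : compact (rV_cube (n.+1) : set V).
    apply: bounded_closed_compact.
      exists n.+1%:R; split; first by rewrite realn.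
      by move=> y yn x /rV_cubeP xn; apply: le_trans xn _; exact: ltW.
    rewrite (_ : rV_cube _ = (fun x : V => `|x|%R) @^-1` [set t | t <= n.+1%:R]%R).
      apply: closed_comp; last exact: closed_le.
      by move=> x _; exact: norm_continuous.
    by apply/seteqP; split => x /rV_cubeP.
  apply: (compact_supportP cB) => // x /bump_support; rewrite subr0 => H.
  by apply/rV_cubeP/ltW/H; rewrite ltr0n.
have : {ae mu, forall x n, (chi n x * (g1 x - g2 x) = 0)%R}.
  by apply/ae_foralln => n; exact: lift.
apply: filterS => x H.
have [n Hn] : exists n, chi n x != 0%R.
  pose S := (\sum_i (x ord0 i - (0 : V) ord0 i) ^+ 2)%R.
  have S0 : (0 <= S)%R by apply: sumr_ge0 => j _; exact: sqr_ge0.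
  exists (Num.bound S); rewrite gt_eqF// /chi /bump flat0_gt0 subr_gt0 -/S.
  have /lt_le_trans -> // := archi_boundP S0.
  rewrite -natr1; have : (0 <= (Num.bound S)%:R :> R)%R by [].
  by nra.
have /eqP := H n; rewrite mulf_eq0 (negbTE Hn)/= subr_eq0 => /eqP.
by [].
Qed.

Lemma weak_XP i u : (exists g, is_weak_X i u g) -> is_weak_X i u (weak_X i u).
Proof. by move=> ex; have := xgetPex (fun=> 0%R : R) ex. Qed.

Lemma is_weak_XZ i u g (c : R) : loc_integrable u -> is_weak_X i u g ->
  is_weak_X i (fun x => c * u x)%R (fun x => c * g x)%R.
Proof.
move=> lu wg; have [[mg lg] _] := wg; split.
  split; first exact: measurable_funM.
  move=> K cK; have mK := compact_measurable_rV cK.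
  under eq_integral do rewrite normrM EFinM.
  rewrite ge0_integralZl_EFin//.
    by apply: lte_mul_pinfty => //; exact: lg.
  apply: measurable_funTS; apply/measurable_EFinP.
  exact: measurableT_comp (@normr_measurable _ _) mg.
move=> phi tphi; have [sphi [cK _]] := tphi.
set K := closure [set x | phi x != 0%R] in cK.
have phiK y : phi y != 0%R -> K y by move=> cy; apply: subset_closure.
have cphi : continuous phi := cd_continuous (sphi 1%N).
have cXphi : continuous (Xfield i phi) by exact/continuous_Xfield/sphi.
have XphiK y : Xfield i phi y != 0%R -> K y.
  by apply: (Xfield_support (sphi 1%N)) => //; exact: compact_closed_rV.
have i1 := loc_integrableM cK cXphi XphiK lu.
have i2 : mu.-integrable setT (EFin \o (fun x => phi x * g x)%R).
  by apply: loc_integrableM cK _ _ _ => //; case: wg.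
have [_ /(_ _ tphi) H] := wg.
transitivity (c%:E * \int[mu]_x (u x * Xfield i phi x)%:E).
  rewrite -integralZl//.
    by apply: eq_integral => x _; rewrite -EFinM mulrA.
  by apply: eq_integrable i1 => // x _ /=; rewrite mulrC.
rewrite H muleN; congr (- _); rewrite -integralZl//.
  by apply: eq_integral => x _; rewrite -EFinM mulrA.
by apply: eq_integrable i2 => // x _ /=; rewrite mulrC.
Qed.

(** The chosen derivative of c u is c times that of u only almost everywhere, by uniqueness. *)
Lemma weak_XZ i u (c : R) : loc_integrable u -> (exists g, is_weak_X i u g) ->
  {ae mu, forall x, weak_X i (fun x => c * u x)%R x = (c * weak_X i u x)%R}.
Proof.
move=> lu exg; have wu := weak_XP exg.
have wcu := is_weak_XZ c lu wu.
apply: is_weak_X_unique (wcu).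
by apply: weak_XP; exists (fun x => (c * weak_X i u x)%R).
Qed.

End kernels.

(** * Translating the closure of a smooth domain into its interior *)

Section push_inside.
Context {R : realType} {N : nat}.
Local Notation V := 'rV[R]_(N + N + 1).
Implicit Types (x y h k : V) (Omega : set V).

Lemma hmulN_near x0 (e : R) : 0 < e ->
  exists2 d : R, 0 < d & forall k y, `|k| < d -> `|y - x0| < d ->
    `|hmul (- k) y - x0| < e.
Proof.
move=> e0.
have c : continuous (fun z : V * V => hmul (- z.1) z.2).
  apply: (@continuous_hmul R N _ (fun z : V * V => - z.1) snd) => z.
    by apply: cvgN; exact: cvg_fst.
  exact: cvg_snd.
have /cvgrPdist_lt /(_ _ e0) /nbhs_ballP [d /= d0 Hd] := c ((0 : V), x0).
exists d => // k y kd yd.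
have := Hd (k, y) _; rewrite /= oppr0 hmul0x distrC; apply.
by split; rewrite -ball_normE /= ?sub0r ?normrN// distrC.
Qed.

(** Velocity of t |-> (t q)^-1 o y. *)
Definition pdir y q : V := - q - symp q y *: etau.

Lemma hmulN_line (t : R) q y : hmul (- (t *: q)) y = t *: pdir y q + y.
Proof. by apply/rowP => j; rewrite hmulE /pdir !sympE !mxE; ring. Qed.

(** The element h is a small multiple of a direction b whose left translation moves x0 along
    a coordinate axis on which the defining function rho decreases; by continuity rho
    decreases strictly along all nearby trajectories. *)
Lemma push_inside Omega x0 : open Omega -> smooth_boundary Omega ->
  closure Omega x0 -> exists2 r : R, 0 < r & forall d : R, 0 < d ->
    exists h (e : R), [/\ 0 < e, `|h| + e < d & forall k y, `|k - h| < e ->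
      closure Omega y -> `|y - x0| <= r -> Omega (hmul (- k) y)].
Proof.
move=> oO sO cx0.
have [iO|niO] := pselect (interior Omega x0).
  have /nbhs_ballP[e /= e0 He] := iO.
  have [d d0 Hd] := hmulN_near x0 e0.
  exists (d / 2); first by rewrite divr_gt0.
  move=> d' d'0; exists 0, (Num.min d d' / 2).
  have m0 : 0 < Num.min d d' by rewrite lt_min d0.
  have m1 : Num.min d d' <= d by rewrite ge_min lexx.
  have m2 : Num.min d d' <= d' by rewrite ge_min lexx orbT.
  split; [by rewrite divr_gt0|by rewrite normr0; lra|].
  move=> k y; rewrite subr0 => kd _ yd; apply: He.
  rewrite -ball_normE /= distrC; apply: Hd; first lra.
  by apply: le_lt_trans yd _; lra.
have [rho [srho [i0 pi0] /nbhs_ballP[e2 /= e20 Hrho]]] := sO x0 (conj cx0 niO).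
have c1 : cd 1 rho := srho 1%N.
pose c := partial i0 rho x0; pose w : V := c *: delta_mx ord0 i0.
(* the vertical correction makes the velocity at x0 equal to - w *)
pose b : V := w - symp w x0 *: etau.
pose G (z : V * (V * V)) := 'D_(pdir z.2.1 (b + z.2.2)) rho z.1.
have cG : continuous G.
  rewrite /G (_ : (fun z => _) = fun z : V * (V * V) =>
    \sum_j pdir z.2.1 (b + z.2.2) ord0 j * partial j rho z.1); last first.
    by apply/funext => z; rewrite C1_deriveE.
  have c21 : continuous (fun z : V * (V * V) => z.2.1).
    by move=> z; apply: (@continuous_comp _ _ _ snd fst); [exact: cvg_snd|exact: cvg_fst].
  have c22 : continuous (fun z : V * (V * V) => b + z.2.2).
    move=> z; apply: cvgD; first exact: cvg_cst.
    by apply: (@continuous_comp _ _ _ snd snd); exact: cvg_snd.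
  apply: continuous_sumr => j; apply: ctsM; last first.
    move=> z; apply: (@continuous_comp _ _ _ fst (partial j rho)); first exact: cvg_fst.
    by have [_ /(_ j)[_ [+ _]]] := c1; apply.
  rewrite /pdir (_ : (fun z => _) = fun z : V * (V * V) =>
    - (b + z.2.2) ord0 j - symp (b + z.2.2) z.2.1 * etau ord0 j); last first.
    by apply/funext => z; rewrite !mxE.
  apply: ctsB; last by apply: ctsM; [exact: continuous_symp|exact: cts_cst].
  apply: ctsN => z.
  exact: (continuous_comp (c22 z) (@continuous_coord R _ j (b + z.2.2))).
have G0 : G (x0, (x0, 0)) < 0.
  rewrite /G /= addr0.
  have -> : pdir x0 b = - w.
    by apply/rowP => j; rewrite /pdir /b !sympE !mxE; ring.
  rewrite deriveN_dir// C1_deriveE// (bigD1 i0)//= big1 ?addr0.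
    by rewrite !mxE !eqxx mulr1 -/c oppr_lt0 -expr2 lt0r sqr_ge0 sqrf_eq0 andbT.
  by move=> j /negbTE ji; rewrite !mxE ji andbF mulr0 mul0r.
have [d1 d10 Hd1] : exists2 d1 : R, 0 < d1 & forall x y q, `|x - x0| < d1 ->
    `|y - x0| < d1 -> `|q| < d1 -> G (x, (y, q)) < 0.
  have mG0 : 0 < - G (x0, (x0, 0)) by rewrite oppr_gt0.
  have /cvgrPdist_lt /(_ _ mG0) /nbhs_ballP [d1 /= d10 Hd1] := cG (x0, (x0, 0)).
  exists d1 => // x y q xd yd qd.
  have := Hd1 (x, (y, q)) _; rewrite ltr_norml => /(_ _)/andP[].
    by split; [|split]; rewrite -ball_normE /= ?sub0r ?normrN// distrC.
  lra.
have e'0 : 0 < Num.min d1 e2 by rewrite lt_min d10.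
have m1 : Num.min d1 e2 <= d1 by rewrite ge_min lexx.
have m2 : Num.min d1 e2 <= e2 by rewrite ge_min lexx orbT.
have [d3 d30 Hd3] := hmulN_near x0 e'0.
have rho_le y : closure Omega y -> `|y - x0| < e2 -> rho y <= 0.
  move=> cy yd; rewrite leNgt; apply/negP => ry.
  have crho : continuous rho := cd_continuous c1.
  have ny1 : \forall z \near y, 0 < rho z.
    have /cvgrPdist_lt /(_ _ ry) := crho y; apply: filterS => z.
    by rewrite ltr_norml => /andP[_]; lra.
  have ny2 : \forall z \near y, `|z - x0| < e2.
    have H : open (ball x0 e2) by exact: ball_open.
    have : nbhs y (ball x0 e2).
      by apply: open_nbhs_nbhs; split => //; rewrite -ball_normE /= distrC.
    by apply: filterS => z; rewrite -ball_normE /= distrC.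
  have [z [Oz [rz zd]]] := cy _ (filterI ny1 ny2).
  have : rho z < 0 by apply/Hrho => //; rewrite -ball_normE /= distrC.
  lra.
have n0 : 0 < Num.min d3 (Num.min d1 e2) by rewrite lt_min d30.
have n1 : Num.min d3 (Num.min d1 e2) <= d3 by rewrite ge_min lexx.
have n2 : Num.min d3 (Num.min d1 e2) <= Num.min d1 e2 by rewrite ge_min lexx orbT.
set r := Num.min d3 _ in n0 n1 n2.
exists (r / 2); first by rewrite divr_gt0.
move=> d d0.
pose t := Num.min d3 d / (2 * (`|b| + 1)).
have s0 : 0 < Num.min d3 d by rewrite lt_min d30.
have s1 : Num.min d3 d <= d3 by rewrite ge_min lexx.
have s2 : Num.min d3 d <= d by rewrite ge_min lexx orbT.
have b10 : 0 < `|b| + 1 by rewrite ltr_wpDl.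
have t0 : 0 < t by rewrite divr_gt0// mulr_gt0.
have tb : t * (`|b| + 1) = Num.min d3 d / 2.
  by rewrite /t invfM mulrA -!mulrA mulVf ?mulr1// gt_eqF.
pose eta := Num.min d1 1.
have eta0 : 0 < eta by rewrite lt_min d10 ltr01.
have eta1 : eta <= d1 by rewrite ge_min lexx.
have eta2 : eta <= 1 by rewrite ge_min lexx orbT.
exists (t *: b), (t * eta); split; first exact: mulr_gt0.
  rewrite normrZ gtr0_norm// -mulrDr; apply: (@le_lt_trans _ _ (t * (`|b| + 1))).
    by rewrite ler_wpM2l ?lerD2l// ltW.
  by rewrite tb; lra.
move=> k y kd cy yd.
pose q := t^-1 *: (k - t *: b).
have kE : k = t *: (b + q).
  by rewrite /q scalerDr scalerA mulfV ?gt_eqF// scale1r addrC subrK.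
have qd : `|q| < eta.
  by rewrite normrZ gtr0_norm ?invr_gt0// ltr_pdivrMl.
have bq : `|b + q| <= `|b| + 1.
  by rewrite (le_trans (ler_normD _ _))// lerD2l; lra.
have bqt (c' : R) : `|c'| <= t -> `|c' *: (b + q)| < d3.
  move=> ct; rewrite normrZ; apply: (@le_lt_trans _ _ (t * (`|b| + 1))).
    by apply: ler_pM.
  by rewrite tb; lra.
rewrite kE hmulN_line; apply/Hrho.
  rewrite -hmulN_line -ball_normE /= distrC; apply: lt_le_trans m2.
  by apply: Hd3; [apply: bqt; rewrite gtr0_norm|lra].
have [c' ct] := MVT_line y t (fun z => @C1_derivable _ _ rho z (pdir y (b + q)) c1).
rewrite (gtr0_norm t0) in ct.
move/eqP; rewrite subr_eq => /eqP ->.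
have : G (c' *: pdir y (b + q) + y, (y, q)) < 0.
  apply: Hd1; [|lra|lra].
  by rewrite -hmulN_line; apply: lt_le_trans m1; apply: Hd3; [exact: bqt|lra].
rewrite /G /= => Gneg.
have ry : rho y <= 0 by apply: rho_le => //; lra.
have : t * 'D_(pdir y (b + q)) rho (c' *: pdir y (b + q) + y) < 0 by rewrite pmulr_rlt0.
lra.
Qed.
End push_inside.

(** * Density of compactly supported functions *)

Section partition_of_unity.
Context {R : realType} {n : nat}.
Local Notation V := 'rV[R]_n.
Implicit Types (x y c : V) (K : set V).

Lemma compact_closed_ball_rV c (r : R) : compact [set y : V | `|y - c| <= r].
Proof.
apply: bounded_closed_compact.
  exists (`|c| + r); split; first by rewrite num_real.
  move=> M cM y /= cy; apply: le_trans (ltW cM).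
  by rewrite -(subrK c y) addrC (le_trans (ler_normD _ _))// lerD2l.
rewrite (_ : [set _ | _] = (fun x : V => `|x - c|) @^-1` [set t | t <= r]) //.
apply: closed_comp; last exact: closed_le.
move=> x _; apply: (@continuous_comp _ _ _ (fun x => x - c) Num.norm).
  by apply: (@continuousB _ _ _ id (cst c)); [move=> ? //|exact: cst_continuous].
exact: norm_continuous.
Qed.

Lemma compact_closure_bounded K : bounded_set K -> compact (closure K).
Proof.
move=> bK; apply: bounded_closed_compact; last exact: closed_closure.
have [M0 [M0r HM0]] := bK; exists M0; split => // M' M0M' y cy.
have H : closed [set y : V | `|y| <= M'].
  have := compact_closed_rV (@compact_closed_ball_rV (0 : V) M').
  by under eq_set do rewrite subr0.
have /closure_id E := H.
have : closure [set y : V | `|y| <= M'] y.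
  by apply: closure_subset cy => z Oz /=; exact: HM0.
by rewrite -E.
Qed.

(** The sum S of finitely many bumps is positive on K but may vanish elsewhere; dividing
    by S + flat 0 (min S - S), which agrees with S on K and never vanishes, gives a smooth
    partition of unity. *)
Lemma partition_of_unity K (r : V -> R) : compact K -> (forall x, 0 < r x) ->
  exists (s : seq V) (chi : V -> V -> R),
  [/\ forall c, c \in s -> K c,
      forall c, smooth (chi c) /\ (forall y, chi c y != 0 -> `|y - c| < r c)
    & forall y, K y -> \sum_(c <- s) chi c y = 1].
Proof.
move=> cK r0.
have [->|/set0P K0] := eqVneq K set0.
  exists [::], (fun _ => cst 0); split => // c; split; first by move=> k; exact: cd_cst.
  by move=> y; rewrite eqxx.
pose b c := bump (r c) c.
have cb c : continuous (b c) := cd_continuous (@smooth_bump R _ (r c) c 1%N).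
have := cK; rewrite (@compact_cover V) => /(_ V K (fun c => [set y | 0 < b c y])).
case.
- move=> c _; rewrite (_ : [set _ | _] = b c @^-1` [set t | 0 < t]) //.
  by apply: open_comp => [y _|]; [exact: cb|exact: open_gt].
- by move=> y Ky; exists y => //=; exact: bump_center.
move=> D0 DK Dcov; pose D : seq V := finmap.enum_fset D0.
pose S y := \sum_(c <- D) b c y.
have S0 y : 0 <= S y by apply: sumr_ge0 => c _; exact: bump_ge0.
have Sgt y : K y -> 0 < S y.
  move=> /Dcov[c /= cD bcy]; rewrite /S (big_rem c)//=.
  by rewrite ltr_pwDl//; apply: sumr_ge0 => d _; exact: bump_ge0.
have cS : continuous S by apply: continuous_sumr => c; exact: cb.
have [a aK aS] := @compact_EVT_min V R S K K0 cK (continuous_subspaceT cS).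
have {}aK : 0 < S a by apply: Sgt; rewrite inE in aK.
(* S a is the minimum of S over K *)
pose T y := S y + flat 0 (S a - S y).
have T0 y : T y != 0.
  have := S0 y; rewrite le_eqVlt => /orP[/eqP Sy|Sy].
    by rewrite /T -Sy add0r subr0 gt_eqF// flat0_gt0.
  by rewrite gt_eqF// ltr_pwDl// flat_ge0.
have sS : smooth S by move=> k; apply: cd_sum => c; exact: smooth_bump.
have sT : smooth T.
  move=> k; apply: cdD; first exact: sS.
  by apply: cd_flat; apply: cdB; [exact: cd_cst|exact: sS].
exists D, (fun c y => b c y * (T y)^-1); split.
- by move=> c /DK; rewrite inE.
- move=> c; split.
    by move=> k; apply: cdM; [exact: smooth_bump|apply: cdV => //; exact: sT].
  by move=> y; rewrite mulf_eq0 negb_or => /andP[+ _]; exact: bump_support.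
move=> y Ky; rewrite -mulr_suml.
suff -> : T y = S y by rewrite mulfV// gt_eqF// Sgt.
rewrite /T; have := flat_ge0 0 (S a - S y); rewrite le_eqVlt => /orP[/eqP <-|].
  by rewrite addr0.
by rewrite flat0_gt0 subr_gt0 ltNge aS// inE.
Qed.

End partition_of_unity.

Lemma fin_common_pos (R : realType) (I : eqType) (s : seq I) (P : I -> R -> Prop) :
  (forall i d d', 0 < d' -> d' <= d -> P i d -> P i d') ->
  (forall i, i \in s -> exists2 d, 0 < d & P i d) ->
  exists2 d, 0 < d & forall i, i \in s -> P i d.
Proof.
move=> Pmon; elim: s => [|i s IH] H; first by exists 1.
have [|d d0 Hd] := IH; first by move=> j js; apply: H; rewrite inE js orbT.
have [e e0 He] := H i (mem_head _ _).
exists (Num.min d e); first by rewrite lt_min d0.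
have m0 : 0 < Num.min d e by rewrite lt_min d0.
move=> j; rewrite inE => /orP[/eqP ->|js].
  by apply: Pmon He => //; rewrite ge_min lexx orbT.
by apply: Pmon (Hd _ js) => //; rewrite ge_min lexx.
Qed.

Section density.
Context {R : realType} {N : nat}.
Local Notation V := 'rV[R]_(N + N + 1).
Local Notation mu := (@mu_heis R N).
Local Open Scope ereal_scope.
Implicit Types (v w phi chi : V -> R) (g G : 'I_(N + N) -> V -> R) (Omega : set V).
Variables (p : R) (p1 : (1 <= p)%R) (Omega : set V).

(** Pairs of a function and a candidate for its horizontal gradient, approximated over the
    whole space by test functions supported in Omega. *)
Definition approximable w G := forall e : R, (0 < e)%R -> exists phi,
  [/\ cd 1 phi, compact_support Omega phi,
      pint mu p setT (fun x => phi x - w x)%R <= e%:E &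
      forall j, pint mu p setT (fun x => Xfield j phi x - G j x)%R <= e%:E].

Lemma Xfield_measurable j phi : cd 1 phi -> measurable_fun setT (Xfield j phi).
Proof. by move=> cphi; apply: continuous_measurable_rV; exact: continuous_Xfield. Qed.

Lemma cd_measurable phi : cd 1 phi -> measurable_fun setT phi.
Proof. by move=> /cd_continuous; exact: continuous_measurable_rV. Qed.

Lemma approximableD w1 w2 G1 G2 :
  measurable_fun setT w1 -> measurable_fun setT w2 ->
  (forall j, measurable_fun setT (G1 j)) -> (forall j, measurable_fun setT (G2 j)) ->
  approximable w1 G1 -> approximable w2 G2 ->
  approximable (fun x => w1 x + w2 x)%R (fun j x => G1 j x + G2 j x)%R.
Proof.
move=> m1 m2 mG1 mG2 H1 H2 e e0.
have K0 : (0 < pK p)%R by exact: pK_gt0.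
have e'0 : (0 < e / (2 * pK p))%R by rewrite divr_gt0// mulr_gt0.
have [f1 [c1 [k1 s1] a1 b1]] := H1 _ e'0; have [f2 [c2 [k2 s2] a2 b2]] := H2 _ e'0.
have key (F1 F2 : V -> R) : measurable_fun setT F1 -> measurable_fun setT F2 ->
    pint mu p setT F1 <= (e / (2 * pK p))%:E -> pint mu p setT F2 <= (e / (2 * pK p))%:E ->
    pint mu p setT (fun x => F1 x + F2 x)%R <= e%:E.
  move=> mF1 mF2 F1e F2e; apply: le_trans (pintD _ p1 measurableT mF1 mF2) _.
  apply: (@le_trans _ _ ((pK p)%:E * ((e / (2 * pK p))%:E + (e / (2 * pK p))%:E))).
    by rewrite lee_pmul2l ?lee_fin ?fin_numE// leeD.
  rewrite -EFinD -EFinM lee_fin le_eqVlt; apply/orP; left; apply/eqP.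
  by field; rewrite gt_eqF.
exists (fun x => f1 x + f2 x)%R; split.
- exact: cdD.
- apply: (@compact_supportP R N Omega
    (closure [set x | f1 x != 0%R] `|` closure [set x | f2 x != 0%R])).
  + exact: compactU.
  + by rewrite subUset.
  + move=> x; have [->|f1x] := eqVneq (f1 x) 0%R.
      by rewrite add0r => f2x; right; apply: subset_closure.
    by move=> _; left; apply: subset_closure.
- rewrite (_ : (fun x => _) = fun x => (f1 x - w1 x) + (f2 x - w2 x))%R.
    by apply: key => //; apply: measurable_funB => //; exact: cd_measurable.
  by apply/funext => x; ring.
- move=> j; have -> : (fun x => Xfield j (fun x => f1 x + f2 x) x - (G1 j x + G2 j x))%R =
      (fun x => (Xfield j f1 x - G1 j x) + (Xfield j f2 x - G2 j x))%R.
    by apply/funext => x; rewrite XfieldD//; ring.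
  by apply: key => //; apply: measurable_funB => //; exact: Xfield_measurable.
Qed.

Lemma approximable0 : approximable (fun=> 0%R) (fun _ _ => 0%R).
Proof.
move=> e e0; exists (fun=> 0%R).
have P0 : pint mu p setT (fun=> 0 - 0)%R <= e%:E.
  rewrite pintE subrr normr0 powR0 ?integral0 ?lee_fin ?ltW//.
  by rewrite gt_eqF// (lt_le_trans ltr01).
split => //; first exact: cd_cst.
- apply: (@compact_supportP R N Omega set0) => //; first exact: compact0.
  by move=> x; rewrite eqxx.
move=> j; have -> // : (fun x => Xfield j (fun=> 0) x - 0)%R = (fun x : V => 0 - 0)%R.
apply/funext => x; rewrite XfieldE; last exact: cd_cst.
by rewrite derive_cst.
Qed.

Lemma approximable_sum (s : seq V) (W : V -> V -> R) (G : V -> 'I_(N + N) -> V -> R) :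
  (forall c, measurable_fun setT (W c)) ->
  (forall c j, measurable_fun setT (G c j)) ->
  (forall c, c \in s -> approximable (W c) (G c)) ->
  approximable (fun x => \sum_(c <- s) W c x)%R (fun j x => \sum_(c <- s) G c j x)%R.
Proof.
move=> mW mG; elim: s => [|c s IH] H.
  rewrite (_ : (fun x => _) = fun=> 0%R); last by apply/funext => x; rewrite big_nil.
  have -> : (fun (j : 'I_(N + N)) x => \sum_(c <- [::]) G c j x)%R = fun _ _ => 0%R.
    by apply/funext => j; apply/funext => x; rewrite big_nil.
  exact: approximable0.
rewrite (_ : (fun x => _) = fun x => (W c x + \sum_(c <- s) W c x)%R); last first.
  by apply/funext => x; rewrite big_cons.
have -> : (fun j x => \sum_(d <- c :: s) G d j x)%R =
    (fun j x => G c j x + \sum_(c <- s) G c j x)%R.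
  by apply/funext => j; apply/funext => x; rewrite big_cons.
apply: approximableD => //.
- exact: measurable_sum.
- by move=> j; exact: measurable_sum.
- by apply: H; rewrite mem_head.
- by apply: IH => d ds; apply: H; rewrite inE ds orbT.
Qed.

(** A localized function chi v is mollified with a kernel centred at the translation h that
    pushes the closure of Omega inside: the support of the mollification is then a compact
    subset of Omega, and left-invariance identifies its gradient. *)
Lemma approximable_piece v g (c : V) (r : R) chi :
  measurable_fun setT v -> pint mu p setT v < +oo -> (forall x, ~ Omega x -> v x = 0%R) ->
  (forall j, is_weak_X j v (g j)) -> (forall j, pint mu p setT (g j) < +oo) ->
  bounded_set Omega ->
  (forall d : R, (0 < d)%R ->
    exists h (e : R), [/\ (0 < e)%R, (`|h| + e < d)%R & forall k y, (`|k - h| < e)%R ->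
      closure Omega y -> (`|y - c| <= r)%R -> Omega (hmul (- k) y)]) ->
  smooth chi -> (forall y, chi y != 0%R -> (`|y - c| < r)%R) ->
  approximable (fun x => chi x * v x)%R (fun j x => chi x * g j x + Xfield j chi x * v x)%R.
Proof.
move=> mv pv vO wg pg bO Hpush schi chir e e0.
have lv : loc_integrable v by exact: pint_loc_integrable pv.
pose B := [set y : V | `|y - c| <= r]%R.
have cB : compact B by exact: compact_closed_ball_rV.
have chiB y : chi y != 0%R -> B y by move=> /chir/ltW.
have tchi : test_function chi by split => //; apply: (compact_supportP cB).
have cchi : continuous chi := cd_continuous (schi 1%N).
have cXchi j : continuous (Xfield j chi) by exact/continuous_Xfield/schi.
have XchiB j y : Xfield j chi y != 0%R -> B y.
  by apply: (Xfield_support (schi 1%N)) => //; exact: compact_closed_rV.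
set w := fun x => (chi x * v x)%R.
set G := fun j x => (chi x * g j x + Xfield j chi x * v x)%R.
have wB y : w y != 0%R -> B y by rewrite mulf_eq0 negb_or => /andP[/chiB].
have GB j y : G j y != 0%R -> B y.
  have [/chiB//|nB] := boolP (chi y != 0%R).
  move: nB; rewrite negbK /G => /eqP ->; rewrite mul0r add0r mulf_eq0 negb_or.
  by move=> /andP[/XchiB].
have lg j : loc_integrable (g j) by case: (wg j).
have mg j : measurable_fun setT (g j) by case: (lg j).
have iw : mu.-integrable setT (EFin \o w) by exact: loc_integrableM cB cchi chiB lv.
have i1 j : mu.-integrable setT (EFin \o (fun x => chi x * g j x)%R).
  exact: loc_integrableM cB cchi chiB (lg j).
have i2 j : mu.-integrable setT (EFin \o (fun x => Xfield j chi x * v x)%R).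
  exact: loc_integrableM cB (cXchi j) (@XchiB j) lv.
have iG j : mu.-integrable setT (EFin \o G j).
  rewrite (_ : _ \o _ = fun x => ((chi x * g j x)%:E + (Xfield j chi x * v x)%:E)) //.
  by have := integrableD measurableT (i1 j) (i2 j).
have mw : measurable_fun setT w by have /integrableP[/measurable_EFinP] := iw.
have mG j : measurable_fun setT (G j) by have /integrableP[/measurable_EFinP] := iG j.
have bmul (a f : V -> R) : continuous a -> (forall y, a y != 0%R -> B y) ->
    measurable_fun setT f -> pint mu p setT f < +oo ->
    pint mu p setT (fun x => a x * f x)%R < +oo.
  move=> ca aB mf pf; have [M M0 HM] := compact_norm_bounded cB ca.
  apply: (@le_lt_trans _ _ (pint mu p setT (fun x => M * f x)%R)).
    apply: (pint_le _ p1) => //; [|exact: measurable_funM|].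
      by apply: measurable_funM => //; exact: continuous_measurable_rV.
    move=> x _; rewrite !normrM (gtr0_norm M0).
    have [->|/aB/HM] := eqVneq (a x) 0%R; first by rewrite normr0 mul0r mulr_ge0// ltW.
    by move=> H; rewrite ler_wpM2r.
  by rewrite (pintZ mu)// lte_mul_pinfty// lee_fin powR_ge0.
have pw : pint mu p setT w < +oo by exact: bmul.
have pG j : pint mu p setT (G j) < +oo.
  apply: le_lt_trans (pintD _ p1 measurableT _ _) _.
  - by apply: measurable_funM => //; exact: continuous_measurable_rV.
  - by apply: measurable_funM => //; exact: continuous_measurable_rV.
  rewrite lte_mul_pinfty// ?lee_fin ?ltW ?pK_gt0//.
  rewrite lte_add_pinfty//; first exact: bmul.
  exact: (bmul _ v (cXchi j) (@XchiB j) mv pv).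
have [d1 d10 Hd1] := mol_cvg p1 e0 mw iw cB wB pw.
have [d2 d20 Hd2] : exists2 d : R, (0 < d)%R & forall j, j \in enum 'I_(N + N) ->
    forall k (M : R), smooth k ->
    (forall h, (0 <= k h <= M)%R) -> \int[mu]_h (k h)%:E = 1 ->
    (forall h, k h != 0%R -> (`|h| < d)%R) ->
    pint mu p setT (fun x => mol k (G j) x - G j x)%R <= e%:E.
  apply: fin_common_pos.
    move=> j d d' d'0 dd' H k M sk kM k1 kd; apply: (H k M) => // h /kd hd'.
    exact: lt_le_trans hd' dd'.
  by move=> j _; exact: (mol_cvg p1 e0 (mG j) (iG j) cB (@GB j) (pG j)).
have m0 : (0 < Num.min d1 d2)%R by rewrite lt_min d10.
have [h [eta [eta0 heta Heta]]] := Hpush _ m0.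
have eta20 : (0 < eta / 2)%R by rewrite divr_gt0.
have [k [M [sk kM k1 kh]]] := exists_kernel h eta20.
have kd x : k x != 0%R -> (`|x| < Num.min d1 d2)%R.
  move=> /kh xh; apply: le_lt_trans heta; rewrite -(subrK h x) addrC.
  by rewrite (le_trans (ler_normD _ _))// lerD2l; lra.
exists (mol k w).
have [cmol _] := mol_C1 cB (sk 1%N) iw wB.
have clO : compact (closure Omega) by exact: compact_closure_bounded.
split => //.
- pose K := closure Omega `&` B.
  have cK : compact K.
    apply: (subclosed_compact _ clO); last by move=> y [].
    by apply: closedI; [exact: closed_closure|exact: compact_closed_rV].
  pose K' := (fun z : V * V => hmul (- z.1) z.2) @` ([set x | `|x - h| <= eta / 2]%R `*` K).
  apply: (@compact_supportP _ _ _ K').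
  + apply: continuous_compact.
      apply: continuous_subspaceT.
      apply: (@continuous_hmul R N _ (fun z : V * V => - z.1)%R snd) => z.
        by apply: cvgN; exact: cvg_fst.
      exact: cvg_snd.
    by apply: compact_setX => //; exact: compact_closed_ball_rV.
  + move=> _ [[x y] [/= xh [cy By]] <-]; apply: Heta => //.
    by apply: le_lt_trans xh _; lra.
  move=> x; apply: contraPP => nK'; apply/negP; rewrite negbK; apply/eqP.
  rewrite /mol; under eq_Rintegral => y _.
    rewrite (_ : (_ * _)%R = 0%R); first over.
    apply/eqP; rewrite mulf_eq0; apply/orP.
    have [|ky] := eqVneq (k (hmul y (- x))) 0%R; [by left|right].
    apply: contraPT nK' => wy; apply; exists (hmul y (- x), y).
      split => /=; first exact/ltW/kh.
      split; last exact: wB.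
      apply: subset_closure; apply: contrapT => /vO vy.
      by move: wy; rewrite /w vy mulr0 eqxx.
    by rewrite /= (hmul_opp y) !opprK -hmulA hmulNx hmulx0.
  by rewrite /Rintegral integral0.
- apply: (Hd1 k M) => // x /kd; rewrite lt_min; by case/andP.
move=> j.
rewrite (_ : (fun x => _) = fun x => mol k (G j) x - G j x)%R; last first.
  by apply/funext => x; rewrite (Xfield_mol x sk tchi lv (wg j)).
apply: (Hd2 j _ k M) => //; first by rewrite mem_enum.
by move=> x /kd; rewrite lt_min; case/andP.
Qed.

Lemma Xfield_sum (s : seq V) (F : V -> V -> R) j x : (forall c, cd 1 (F c)) ->
  (Xfield j (fun y => \sum_(c <- s) F c y) x = \sum_(c <- s) Xfield j (F c) x)%R.
Proof.
move=> cF; elim: s => [|c s IH].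
  rewrite big_nil (_ : (fun y => _) = fun=> 0%R); last by apply/funext => y; rewrite big_nil.
  by rewrite XfieldE ?derive_cst//; exact: cd_cst.
rewrite big_cons -IH -XfieldD//; last exact: cd_sum.
by congr (Xfield j _ x); apply/funext => y; rewrite big_cons.
Qed.

(** Sum the approximations of the localized pieces; inside Omega the cut-offs add up to 1,
    so that the terms with their derivatives cancel. *)
Lemma density v g (e : R) : open Omega -> bounded_set Omega -> smooth_boundary Omega ->
  measurable_fun setT v -> pint mu p setT v < +oo -> (forall x, ~ Omega x -> v x = 0%R) ->
  (forall j, is_weak_X j v (g j)) -> (forall j, pint mu p setT (g j) < +oo) ->
  (0 < e)%R -> exists phi,
  [/\ cd 1 phi, compact_support Omega phi,
      pint mu p setT (fun x => phi x - v x)%R <= e%:E &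
      forall j, pint mu p Omega (fun x => Xfield j phi x - g j x)%R <= e%:E].
Proof.
move=> oO bO sO mv pv vO wg pg e0.
have mO : measurable Omega by exact: open_measurable_rV.
have cO : compact (closure Omega) by exact: compact_closure_bounded.
have /choice[r Hr] : forall x : V, exists r : R, (0 < r)%R /\ (closure Omega x ->
    forall d : R, (0 < d)%R ->
    exists h (e : R), [/\ (0 < e)%R, (`|h| + e < d)%R & forall k y, (`|k - h| < e)%R ->
      closure Omega y -> (`|y - x| <= r)%R -> Omega (hmul (- k) y)]).
  move=> x; have [cx|ncx] := pselect (closure Omega x); last by exists 1%R.
  by have [r r0 H] := push_inside oO sO cx; exists r.
have [s [chi [sK Hchi chi1]]] := partition_of_unity cO (fun x => (Hr x).1).
have mg j : measurable_fun setT (g j) by case: (wg j) => [[]].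
have schi c : smooth (chi c) by have [] := Hchi c.
have mchi c : measurable_fun setT (chi c) by apply: cd_measurable; exact: schi.
have mX c j : measurable_fun setT (Xfield j (chi c)) by apply: Xfield_measurable; exact: schi.
have /(_ _ e0)[phi [c1 c2 c3 c4]] := @approximable_sum s (fun c x => chi c x * v x)%R
  (fun c j x => chi c x * g j x + Xfield j (chi c) x * v x)%R
  (fun c => measurable_funM (mchi c) mv)
  (fun c j => measurable_funD (measurable_funM (mchi c) (mg j)) (measurable_funM (mX c j) mv))
  (fun c cs => @approximable_piece v g c (r c) (chi c) mv pv vO wg pg bO
    ((Hr c).2 (sK c cs)) (schi c) (Hchi c).2).
exists phi; split => //.
  rewrite (_ : (fun x => _) = fun x => phi x - \sum_(c <- s) chi c x * v x)%R//.
  apply/funext => x; congr (_ - _)%R; rewrite -mulr_suml.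
  have [Ox|/vO ->] := pselect (Omega x); last by rewrite mulr0.
  by rewrite chi1 ?mul1r//; exact: subset_closure.
move=> j; apply: le_trans (c4 j).
rewrite !pintE; apply: (@le_trans _ _ (\int[mu]_(x in Omega)
  (`|Xfield j phi x - \sum_(c <- s) (chi c x * g j x + Xfield j (chi c) x * v x)| `^ p)%:E)).
  rewrite le_eqVlt; apply/orP; left; apply/eqP; apply: eq_integral => x.
  rewrite inE => Ox; congr (`|_ - _| `^ _)%:E.
  rewrite big_split/= -!mulr_suml chi1 ?mul1r; last exact: subset_closure.
  rewrite -Xfield_sum; last by move=> c; exact: schi.
  rewrite XfieldE; last by apply: cd_sum => c; exact: schi.
  rewrite (@near_eq_derive R V R _ (cst (1%R : R))) ?derive_cst ?mul0r ?addr0//.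
  have : nbhs x Omega by exact: open_nbhs_nbhs.
  by apply: filterS => y Oy; rewrite chi1//; exact: subset_closure.
apply: ge0_subset_integral => //.
apply: measurable_EFin_powR; apply: measurable_funB; first exact: Xfield_measurable.
by apply: measurable_sum => c; apply: measurable_funD; exact: measurable_funM.
Qed.

End density.

(** * Increments along the group and the Gagliardo seminorm *)

Section right_translation.
Context {R : realType} {N : nat}.
Local Notation V := 'rV[R]_(N + N + 1).
Local Notation mu := (@mu_heis R N).
Local Open Scope ereal_scope.
Implicit Types (phi w : V -> R) (x y h v : V) (Omega : set V).
Variables (p : R) (p1 : (1 <= p)%R).

(** p-th power of the L^p modulus of continuity for right translations, that is, along the
    left-invariant fields. *)
Definition rdiff phi h := pint mu p setT (fun y => phi (hmul y h) - phi y)%R.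

Lemma measurable_comp_rmul w h : measurable_fun setT w ->
  measurable_fun setT (fun x => w (hmul x h)).
Proof. by move=> mw; exact: (measurableT_comp mw (measurable_rmul h)). Qed.

Lemma pint_rmul w h : measurable_fun setT w ->
  pint mu p setT (fun x => w (hmul x h)) = pint mu p setT w.
Proof.
move=> mw; rewrite !pintE.
exact: (@integral_rmul R N h (fun x => (`|w x| `^ p)%:E) (measurable_EFin_powR p mw)).
Qed.

Lemma rdiff_ge0 phi h : 0 <= rdiff phi h.
Proof. exact: pint_ge0. Qed.

Lemma rdiff_hmul phi h1 h2 : measurable_fun setT phi ->
  rdiff phi (hmul h1 h2) <= (pK p)%:E * (rdiff phi h1 + rdiff phi h2).
Proof.
move=> mphi; rewrite addeC.
have m1 := measurable_comp_rmul h1 mphi; have m2 := measurable_comp_rmul h2 mphi.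
have m12 := measurable_comp_rmul h1 m2.
rewrite -[rdiff phi h2](@pint_rmul _ h1); last exact: measurable_funB.
rewrite /rdiff (_ : (fun y => _) = fun y =>
  (phi (hmul (hmul y h1) h2) - phi (hmul y h1)) + (phi (hmul y h1) - phi y))%R; last first.
  by apply/funext => y; rewrite hmulA subrKA.
by apply: pintD => //; exact: measurable_funB.
Qed.

Lemma rdiff_le phi h : measurable_fun setT phi ->
  rdiff phi h <= (pK p)%:E * (pint mu p setT phi + pint mu p setT phi).
Proof.
move=> mphi; have m1 := measurable_comp_rmul h mphi.
apply: le_trans (pintD mu p1 measurableT m1 (measurable_funN mphi)) _.
by rewrite pint_rmul// pintN.
Qed.

(** Velocity of t |-> y o (t v). *)
Definition vdir v y : V := v + symp y v *: etau.

Lemma hmul_vdir v y (t : R) : (hmul y (t *: v) = t *: vdir v y + y)%R.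
Proof. by apply/rowP => j; rewrite hmulE /vdir !sympE !mxE; ring. Qed.

Lemma vdir_line v y (c : R) : vdir v (hmul y (c *: v)) = vdir v y.
Proof. by rewrite /vdir hmulE !sympE !mulr0 !addr0. Qed.

(** The l^1 norm of the horizontal gradient: its L^p norm is controlled by those of the
    components. *)
Definition hgrad1 phi y : R := \sum_j `|Xfield j phi y|.

(** Along a horizontal vector the derivative only involves the fields X_j. *)
Lemma derive_vdir phi v y : cd 1 phi -> htau v = 0%R ->
  ('D_(vdir v y) phi y = \sum_j hx j v * Xfield j phi y)%R.
Proof.
move=> cphi v0.
have v_sum : (v = \sum_j hx j v *: evec j)%R.
  apply/rowP => l; rewrite summxE -(splitK l); case: (fintype.split l) => [j|j] /=.
    rewrite (bigD1 j)//= big1 ?addr0; last first.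
      by move=> i /negbTE ij; rewrite !mxE eq_shift (eq_sym j) ij andbF mulr0.
    by rewrite !mxE !eqxx mulr1.
  rewrite [RHS]big1; first by rewrite (ord1 j); exact: v0.
  by move=> i _; rewrite !mxE eq_rlshift andbF mulr0.
have s_sum : (symp y v = \sum_j hx j v * symp y (evec j))%R.
  rewrite {1}v_sum; elim/big_ind2 : _ => [|a b c d <- <-|j _].
  - by rewrite -[0%R in LHS](scale0r (0 : V)%R) sympZr mul0r.
  - by rewrite sympDr.
  - by rewrite sympZr.
have vE : vdir v y = (\sum_j hx j v *: xdir j y)%R.
  rewrite /vdir s_sum {1}v_sum scaler_suml -big_split/=; apply: eq_bigr => j _.
  by rewrite /xdir scalerDr scalerA.
rewrite C1_deriveE// vE.
under eq_bigr do rewrite summxE mulr_suml.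
rewrite exchange_big/=; apply: eq_bigr => j _.
rewrite XfieldE// C1_deriveE// mulr_sumr; apply: eq_bigr => i _.
by rewrite mxE mulrA.
Qed.

(** Halving the step repeatedly, the increment along v is bounded by 2^(pm) times the
    increment along v / 2^m, that is, by a difference quotient, which converges uniformly on
    a compact set to the derivative along v. *)
Lemma rdiff_horizontal Omega phi v : cd 1 phi -> compact_support Omega phi ->
  htau v = 0%R ->
  rdiff phi v <= (pK p * `|v| `^ p)%:E * pint mu p setT (hgrad1 phi).
Proof.
move=> cphi [cK KO] v0; have p0 : (0 < p)%R by exact: lt_le_trans p1.
have mphi : measurable_fun setT phi by exact: cd_measurable.
pose D y := ('D_(vdir v y) phi y : R).
have DE y : D y = (\sum_j hx j v * Xfield j phi y)%R by exact: derive_vdir.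
have cD : continuous D.
  rewrite (_ : D = fun y => \sum_j hx j v * Xfield j phi y)%R; last exact/funext.
  by apply: continuous_sumr => j; apply: ctsM; [exact: cts_cst|exact: continuous_Xfield].
have mD : measurable_fun setT D by exact: continuous_measurable_rV.
have mX j : measurable_fun setT (Xfield j phi) by exact: Xfield_measurable.
have mG : measurable_fun setT (hgrad1 phi).
  apply: measurable_sum => j.
  exact: measurableT_comp (@normr_measurable _ _) (mX j).
have D_le : pint mu p setT D <= (`|v| `^ p)%:E * pint mu p setT (hgrad1 phi).
  rewrite -[X in (X `^ p)%:E]normr_id -pintZ//.
  apply: pint_le => //; first exact: measurable_funM.
  move=> y _; rewrite DE (le_trans (ler_norm_sum _ _ _))//.
  rewrite ger0_norm ?mulr_ge0 ?sumr_ge0// mulr_sumr; apply: ler_sum => j _.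
  by rewrite normrM ler_wpM2r//; exact: ler_coord_norm.
suff : rdiff phi v <= (pK p)%:E * pint mu p setT D.
  move=> /le_trans; apply; rewrite EFinM -muleA.
  by rewrite lee_pmul2l ?lte_fin ?pK_gt0.
(* each halving costs 2 * 2^(p-1) = 2^p, the p-th power of the factor 2 by which the
   difference quotient is normalized *)
pose q m y := (2 ^+ m * (phi (hmul y ((2^-1 ^+ m) *: v)) - phi y))%R.
have mq m : measurable_fun setT (q m).
  by apply: measurable_funM => //; apply: measurable_funB => //; exact: measurable_comp_rmul.
have c2 : (2 * pK p = 2 `^ p)%R.
  rewrite /pK -powR_inv1// -powRrM mulN1r opprB.
  have -> : (2 `^ p = 2 `^ (1 + (p - 1)) :> R)%R by rewrite addrC subrK.
  rewrite [RHS]powRD; last by rewrite pnatr_eq0 implybT.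
  by rewrite powRr1.
have halve m : rdiff phi v <= ((2 `^ p) ^+ m)%:E * rdiff phi ((2^-1 ^+ m) *: v)%R.
  elim: m => [|m IH]; first by rewrite !expr0 mul1e scale1r.
  apply: le_trans IH _; rewrite exprSr EFinM -muleA lee_pmul2l ?lte_fin ?exprn_gt0 ?powR_gt0//.
  have -> : (2^-1 ^+ m *: v = hmul (2^-1 ^+ m.+1 *: v) (2^-1 ^+ m.+1 *: v))%R.
    rewrite hmulE sympxx scale0r addr0 -scalerDl; congr (_ *: _).
    by rewrite exprS; lra.
  apply: le_trans (rdiff_hmul _ _ mphi) _.
  by rewrite -c2 mulrC EFinM -muleA -mule2n mule_natl.
have rdq m : rdiff phi v <= pint mu p setT (q m).
  apply: le_trans (halve m) _.
  rewrite /q pintZ//; last by apply: measurable_funB => //; exact: measurable_comp_rmul.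
  by rewrite ger0_norm ?exprn_ge0// -powR_mulrn// -powRAC powR_mulrn ?powR_ge0.
suff approx e : (0 < e)%R -> exists m, pint mu p setT (fun y => q m y - D y)%R <= e%:E.
  apply/lee_addgt0Pr => e e0.
  have e'0 : (0 < e / pK p)%R by rewrite divr_gt0// pK_gt0.
  have [m Hm] := approx _ e'0.
  apply: le_trans (rdq m) _.
  rewrite (_ : q m = fun y => D y + (q m y - D y))%R; last by apply/funext => y; rewrite addrC subrK.
  apply: le_trans (pintD mu p1 measurableT mD (measurable_funB (mq m) mD)) _.
  rewrite ge0_muleDr ?pint_ge0// leeD2l//.
  apply: le_trans (lee_wpmul2l _ Hm) _; first by rewrite lee_fin ltW// pK_gt0.
  by rewrite -EFinM mulrC divfK// gt_eqF// pK_gt0.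
move=> e0.
set K := closure _ in cK KO.
pose L := (fun z : V * V => hmul z.1 z.2) @` (K `*` [set x : V | `|x - 0| <= `|v|]%R).
have cL : compact L.
  apply: continuous_compact.
    apply: continuous_subspaceT.
    by apply: (@continuous_hmul R N _ fst snd) => z; [exact: cvg_fst|exact: cvg_snd].
  by apply: compact_setX => //; exact: compact_closed_ball_rV.
have DK y : D y != 0%R -> K y.
  apply: contraPP => nKy; rewrite DE big1 ?eqxx// => j _.
  apply/eqP; rewrite mulf_eq0; apply/orP; right; apply: contra_notT nKy.
  apply: (Xfield_support cphi); first exact: compact_closed_rV.
  by move=> z phiz; exact: subset_closure.
have DL y (c : R) : (`|c| <= 1)%R -> D (hmul y (c *: v)) != 0%R -> L y.
  move=> c1 /DK KD; exists (hmul y (c *: v), - (c *: v))%R => /=; last by rewrite hmulxK.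
  by split => //=; rewrite subr0 normrN normrZ ler_piMl.
have mL : measurable L by exact: compact_measurable_rV.
have muL : mu L < +oo by exact: mu_compact_fin.
pose e' := ((e / (fine (mu L) + 1)) `^ p^-1)%R.
have b0 : (0 < fine (mu L) + 1)%R by rewrite ltr_wpDl// fine_ge0.
have e'0 : (0 < e')%R by rewrite powR_gt0// divr_gt0.
have cpsi : continuous (fun z : V * V => D (hmul z.2 z.1)).
  move=> z; apply: (@continuous_comp _ _ _ (fun z : V * V => hmul z.2 z.1) D); last exact: cD.
  by apply: (@continuous_hmul R N _ snd fst) => ?; [exact: cvg_snd|exact: cvg_fst].
have /nbhs_ballP[d /= d0 Hd] := @near_uniform R N L (fun x y => D (hmul y x)) 0%R e' cL cpsi e'0.
have [m Hm] : exists m, (2^-1 ^+ m * `|v| < d)%R.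
  have a0 : (0 <= `|v| / d)%R by rewrite divr_ge0// ltW.
  exists (Num.bound (`|v| / d)); rewrite exprVn mulrC ltr_pdivrMr ?exprn_gt0//.
  rewrite -ltr_pdivrMl// mulrC; apply: lt_le_trans (archi_boundP a0) _.
  by rewrite -natrX ler_nat ltnW// ltn_expl.
exists m.
have HqD y : q m y != D y -> L y /\ (`|q m y - D y| <= e')%R.
  have [c cm] := MVT_line y (2^-1 ^+ m)%R (fun z => @C1_derivable _ _ phi z (vdir v y) cphi).
  rewrite -!hmul_vdir => Hc.
  have qE : q m y = D (hmul y (c *: v)).
    rewrite /q Hc mulrA -exprMn mulfV ?pnatr_eq0// expr1n mul1r.
    by rewrite /D vdir_line.
  have c1 : (`|c| <= 1)%R.
    apply: le_trans cm _; rewrite ger0_norm ?exprn_ge0// exprVn invf_le1 ?exprn_gt0//.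
    by rewrite exprn_ege1// ler1n.
  rewrite qE => Hne.
  have Ly : L y.
    have [Dy|Dy] := eqVneq (D y) 0%R; first by apply: (DL _ _ c1); rewrite -Dy.
    by apply: (@DL y 0%R); rewrite ?normr0// scale0r hmulx0.
  split => //; have := Hd (c *: v)%R _ y Ly; rewrite hmulx0; apply.
  rewrite -ball_normE /= sub0r normrN normrZ; apply: le_lt_trans Hm; rewrite ler_wpM2r//.
  by apply: le_trans cm _; rewrite ger0_norm// exprn_ge0.
apply: (@le_trans _ _ (pint mu p setT (fun y => e' * \1_L y)%R)).
  apply: pint_le => //; first exact: measurable_funB.
    by apply: measurable_funM => //; exact: measurable_indic.
  move=> y _; have [->|/HqD[Ly H]] := eqVneq (q m y) (D y); first by rewrite subrr normr0.
  by rewrite indicE mem_set// mulr1 (gtr0_norm e'0).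
rewrite pintZ//.
have -> : pint mu p setT \1_L = mu L.
  rewrite pintE -[RHS]mul1e -[RHS]integral_cst// [RHS]integral_mkcond.
  apply: eq_integral => y _; rewrite patchE indicE; case: (y \in L).
    by rewrite normr1 powR1.
  by rewrite normr0 powR0// gt_eqF.
rewrite gtr0_norm// /e' -powRrM mulVf ?gt_eqF// powRr1; last by rewrite ltW// divr_gt0.
have muLE : mu L = (fine (mu L))%:E by rewrite fineK// ge0_fin_numE.
rewrite [X in _ * X <= _]muLE -EFinM lee_fin.
by rewrite mulrAC ler_pdivrMr// ler_wpM2l// ?ltW// ltrDl.
Qed.

Lemma evec_norm (j : 'I_(N + N)) : (`|evec j : V| <= 1)%R.
Proof.
apply: rV_norm_le => // i; rewrite mxE; case: (_ && _); first by rewrite normr1.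
by rewrite normr0.
Qed.

Lemma htau_evec (j : 'I_(N + N)) (a : R) : htau (a *: evec j : V) = 0%R.
Proof. by rewrite /htau !mxE eq_rlshift andbF mulr0. Qed.

Lemma symp_evec2 (i : 'I_N) : symp (evec (lshift N i)) (evec (rshift N i) : V) = (2^-1)%R.
Proof.
rewrite symp_evec; case: splitP => j /=; first by move=> ij; have := ltn_ord j; rewrite -ij ltnNge leq_addr.
move=> /addnI ij; have {ij} -> : j = i by apply: val_inj; rewrite /= ij.
by rewrite /hx mxE !eqxx mul1r.
Qed.

(** Group commutators of horizontal steps a e_i and b e_(N+i) produce the vertical step a b. *)
Lemma hmul_commutator (i : 'I_N) (a b : R) :
  hmul (hmul (a *: evec (lshift N i)) (b *: evec (rshift N i)))
       (hmul ((- a) *: evec (lshift N i)) ((- b) *: evec (rshift N i))) =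
  ((a * b) *: etau : V).
Proof.
apply/rowP => k; rewrite !hmulE !sympE (symp_sym (evec (rshift N i))) symp_evec2 !mxE.
by field.
Qed.

(** A vertical step t is a commutator of horizontal steps of size sqrt |t|. *)
Lemma rdiff_vertical Omega phi (t : R) : (0 < N)%N -> cd 1 phi -> compact_support Omega phi ->
  rdiff phi (t *: etau) <=
  (4 * pK p ^+ 3 * Num.sqrt `|t| `^ p)%:E * pint mu p setT (hgrad1 phi).
Proof.
move=> N0 cphi sphi; pose i := Ordinal N0.
have mphi : measurable_fun setT phi by exact: cd_measurable.
set G := pint mu p setT (hgrad1 phi).
pose r := Num.sqrt `|t|.
have r0 : (0 <= r)%R by exact: sqrtr_ge0.
have step (a : R) j : (`|a| <= r)%R -> rdiff phi (a *: evec j) <= (pK p * r `^ p)%:E * G.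
  move=> ar; apply: le_trans (rdiff_horizontal cphi sphi (htau_evec j a)) _.
  rewrite lee_wpmul2r ?pint_ge0// lee_fin ler_wpM2l ?(ltW (pK_gt0 p))//.
  apply: ge0_ler_powR => //; rewrite ?nnegrE// ?(le_trans _ p1)//.
  by rewrite normrZ (le_trans _ ar)// ler_piMr// evec_norm.
have [a [b [ar br abt]]] : exists a b : R, [/\ `|a| <= r, `|b| <= r & a * b = t]%R.
  exists r, (Num.sg t * r)%R; split.
  - by rewrite ger0_norm.
  - rewrite normrM (ger0_norm r0) normr_sg ler_piMl//; by case: (t != 0%R).
  - by rewrite mulrCA -expr2 sqr_sqrtr// mulrC -numEsg mulr1 || rewrite mulrCA -expr2 sqr_sqrtr// -numEsg.
rewrite -abt -(hmul_commutator i) abt.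
apply: le_trans (rdiff_hmul _ _ mphi) _.
have K0 : 0 <= (pK p)%:E by rewrite lee_fin ltW// pK_gt0.
have two (c d : R) j k : (`|c| <= r)%R -> (`|d| <= r)%R ->
    rdiff phi (hmul (c *: evec j) (d *: evec k)) <= (2 * pK p ^+ 2 * r `^ p)%:E * G.
  move=> ar' br'; apply: le_trans (rdiff_hmul _ _ mphi) _.
  apply: le_trans (lee_wpmul2l K0 (leeD (step _ _ ar') (step _ _ br'))) _.
  rewrite -mule2n -mule_natl !muleA -!EFinM le_eqVlt; apply/orP; left; apply/eqP.
  by congr (_%:E * _); ring.
apply: le_trans (lee_wpmul2l K0 (leeD (two _ _ _ _ ar br) (two _ _ _ _ _ _))) _.
- by rewrite normrN.
- by rewrite normrN.
rewrite -mule2n -mule_natl !muleA -!EFinM le_eqVlt; apply/orP; left; apply/eqP.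
by congr (_%:E * _); ring.
Qed.

Lemma hnorm_ge0 h : (0 <= hnorm h)%R.
Proof. exact: powR_ge0. Qed.

Lemma hnorm4 h : (hnorm h ^+ 4 = (\sum_(i < N + N) hx i h ^+ 2) ^+ 2 + htau h ^+ 2)%R.
Proof.
rewrite /hnorm -powR_mulrn ?powR_ge0// -powRrM mulVf ?pnatr_eq0// powRr1//.
by rewrite addr_ge0// sqr_ge0.
Qed.

Lemma hx_le_hnorm h (i : 'I_(N + N)) : (`|hx i h| <= hnorm h)%R.
Proof.
rewrite -(@ler_pXn2r _ 4)// ?nnegrE ?hnorm_ge0// hnorm4.
have -> : (`|hx i h| ^+ 4 = (hx i h ^+ 2) ^+ 2)%R.
  by rewrite -exprM -normrX ger0_norm// exprn_even_ge0.
rewrite ler_wpDr ?sqr_ge0// ler_pXn2r ?nnegrE ?sqr_ge0 ?sumr_ge0// => [|j _]; last exact: sqr_ge0.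
by rewrite (bigD1 i)//= lerDl sumr_ge0// => j _; exact: sqr_ge0.
Qed.

Lemma htau_le_hnorm h : (`|htau h| <= hnorm h ^+ 2)%R.
Proof.
rewrite -(@ler_pXn2r _ 2)// ?nnegrE ?exprn_ge0 ?hnorm_ge0//.
by rewrite -exprM hnorm4 real_normK ?num_real// lerDr sqr_ge0.
Qed.

(** Every h is the product of its horizontal part and a vertical step, both of homogeneous
    size at most |h|. *)
Lemma rdiff_le_hnorm Omega phi h : (0 < N)%N -> cd 1 phi -> compact_support Omega phi ->
  rdiff phi h <=
  (pK p * (pK p + 4 * pK p ^+ 3) * hnorm h `^ p)%:E * pint mu p setT (hgrad1 phi).
Proof.
move=> N0 cphi sphi; have mphi : measurable_fun setT phi by exact: cd_measurable.
have p0 : (0 <= p)%R by rewrite (le_trans _ p1).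
pose v := (h - htau h *: etau)%R.
have v0 : htau v = 0%R by rewrite /v /htau !mxE !eqxx mulr1 subrr.
have hE : h = hmul v (htau h *: etau).
  by rewrite hmulE !sympE mulr0 scale0r addr0 subrK.
rewrite {1}hE; apply: le_trans (rdiff_hmul _ _ mphi) _.
have vh : (`|v| <= hnorm h)%R.
  apply: rV_norm_le => [|i]; first exact: hnorm_ge0.
  rewrite -(splitK i); case: (fintype.split i) => j /=.
    have := hx_le_hnorm h j; rewrite /hx /v !mxE eq_lrshift andbF mulr0 subr0.
    by [].
  by have := v0; rewrite /htau (ord1 j) => ->; rewrite normr0 hnorm_ge0.
have th : (Num.sqrt `|htau h| <= hnorm h)%R.
  rewrite -[leRHS]ger0_norm ?hnorm_ge0// -(sqrtr_sqr (hnorm h)) ler_sqrt ?sqr_ge0//.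
  exact: htau_le_hnorm.
have K0 : (0 <= pK p)%R by rewrite ltW// pK_gt0.
have H1 := rdiff_horizontal cphi sphi v0.
have H2 := @rdiff_vertical Omega phi (htau h) N0 cphi sphi.
apply: le_trans (lee_wpmul2l _ (leeD H1 H2)) _; first by rewrite lee_fin.
rewrite -ge0_muleDl ?lee_fin ?mulr_ge0 ?exprn_ge0 ?powR_ge0// muleA -EFinD -EFinM.
apply: lee_wpmul2r; first exact: pint_ge0.
rewrite lee_fin -[X in (_ <= X)%R]mulrA; apply: ler_wpM2l => //.
rewrite [leRHS]mulrDl; apply: lerD; apply: ler_wpM2l; rewrite ?mulr_ge0 ?exprn_ge0//.
  by apply: ge0_ler_powR; rewrite // nnegrE ?hnorm_ge0.
by apply: ge0_ler_powR; rewrite // nnegrE ?hnorm_ge0 ?sqrtr_ge0.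
Qed.

End right_translation.

Section kernel_integrability.
Context {R : realType} {N : nat}.
Local Notation V := 'rV[R]_(N + N + 1).
Local Notation mu := (@mu_heis R N).
Local Open Scope ereal_scope.
Implicit Types (x y h v : V).

(** Box comparable to the ball of radius r of the homogeneous norm. *)
Definition hbox (r : R) : set V :=
  [set h | (forall j : 'I_(N + N), `|hx j h| <= r)%R /\ (`|htau h| <= r ^+ 2)%R].

Let side (r : R) (i : 'I_(N + N + 1)) : set R :=
  if fintype.split i is inl _ then `[(- r)%R, r] else `[(- r ^+ 2)%R, (r ^+ 2)%R].

Lemma hboxE r : hbox r = [set h : V | forall i, side r i (h ord0 i)].
Proof.
apply/seteqP; split => [h [Hx Ht] i|h Hs].
  rewrite -(splitK i) /side unsplitK; case: (fintype.split i) => j /=.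
    by have := Hx j; rewrite /hx in_itv/= ler_norml.
  by move: Ht; rewrite /htau (ord1 j) in_itv/= ler_norml.
split.
  move=> j; have := Hs (unsplit (inl j)); rewrite /side unsplitK /=.
  by rewrite /hx in_itv/= ler_norml.
have := Hs (unsplit (inr ord0)); rewrite /side unsplitK /=.
by rewrite /htau in_itv/= ler_norml.
Qed.

Let measurable_side r i : measurable (side r i).
Proof. by rewrite /side; case: (fintype.split i) => _; exact: measurable_itv. Qed.

Lemma measurable_hbox r : measurable (hbox r).
Proof. by rewrite hboxE; apply: measurable_rV_box => i. Qed.

(** The side r^2 in the vertical direction makes Q = 2N + 2 the volume exponent. *)
Lemma mu_hbox (r : R) : (0 < r)%R ->
  mu (hbox r) = (2 ^+ (N + N).+1 * r ^+ hdim N)%:E.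
Proof.
move=> r0; rewrite hboxE.
have -> : mu [set h | forall i, side r i (h ord0 i)] =
    \prod_(i < N + N + 1) lebesgue_measure (side r i) by exact: lebesgue_rV_box.
rewrite big_split_ord/= big_ord1 (eq_bigr (fun _ => (2 * r)%:E)); last first.
  move=> i _; rewrite /side (_ : lshift 1 i = unsplit (inl i))// unsplitK.
  rewrite lebesgue_measure_itv/= lte_fin gtrN// -EFinD; congr (_%:E); ring.
rewrite {1}/side (_ : rshift (N + N) ord0 = unsplit (inr ord0))// unsplitK.
rewrite lebesgue_measure_itv/= lte_fin gtrN ?exprn_gt0// -EFinD.
rewrite prodEFin -EFinM prodr_const card_ord; congr (_%:E).
have -> : hdim N = (N + N).+2 by rewrite /hdim mul2n -addnn addn2.
rewrite exprMn !exprS; move: (2 ^+ (N + N))%R (r ^+ (N + N))%R => a b; ring.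
Qed.

Lemma hnorm_le_hbox h (r : R) : (hnorm h <= r)%R -> hbox r h.
Proof.
move=> hr; split => [j|]; first exact: le_trans (hx_le_hnorm h j) hr.
apply: le_trans (htau_le_hnorm h) _.
by rewrite ler_pXn2r// nnegrE ?hnorm_ge0// (le_trans (hnorm_ge0 h)).
Qed.

Lemma dyadic (T : R) : (1 <= T)%R -> exists k, (2 ^+ k <= T < 2 ^+ k.+1)%R.
Proof.
move=> T1.
have ex : exists m, (T < 2 ^+ m)%R.
  exists (Num.bound T); apply: lt_le_trans (archi_boundP (le_trans ler01 T1)) _.
  by rewrite -natrX ler_nat ltnW// ltn_expl.
case: (ex_minnP ex) => -[|m] Tm mmin.
  by move: Tm; rewrite expr0 ltNge T1.
exists m; rewrite Tm andbT leNgt; apply/negP => /mmin; by rewrite ltnn.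
Qed.

Lemma measurable_hnorm : measurable_fun setT (@hnorm R N).
Proof.
apply: (@measurableT_comp _ _ _ _ _ _ (fun t : R => t `^ 4^-1)%R) => //.
apply: measurable_funD.
  by apply: measurable_funX; apply: measurable_sum => i; apply: measurable_funX; exact: measurable_hx.
by apply: measurable_funX; exact: measurable_coord_rV.
Qed.

Lemma measurable_hnorm_powR (a : R) :
  measurable_fun setT (fun h : V => hnorm h `^ a)%R.
Proof.
apply: (@measurableT_comp _ _ _ _ _ _ (fun t : R => t `^ a)%R) => //.
exact: measurable_hnorm.
Qed.

Lemma measurable_hkernel (a b : R) :
  measurable_fun setT (fun h : V => Num.min 1 (hnorm h `^ a) / hnorm h `^ b)%R.
Proof.
apply: measurable_funM.
  by apply: measurable_minr => //; exact: measurable_hnorm_powR.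
under eq_fun do rewrite -powRN.
exact: measurable_hnorm_powR.
Qed.

Lemma geometric_nneseries_lty (c q : R) : (0 <= c)%R -> (0 < q)%R -> (q < 1)%R ->
  \sum_(0 <= k <oo) (c * q ^+ k)%:E < +oo.
Proof.
move=> c0 q0 q1; apply: (@le_lt_trans _ _ (c / (1 - q))%:E); last exact: ltry.
apply: lime_le.
  by apply: is_cvg_nneseries => k _ _; rewrite lee_fin mulr_ge0// exprn_ge0// ltW.
apply: nearW => n; rewrite sumEFin lee_fin.
have := @geometric_le_lim R n c q c0 q0; rewrite gtr0_norm// => /(_ q1).
by rewrite /series /geometric.
Qed.

Variables (s p : R) (s0 : (0 < s)%R) (s1 : (s < 1)%R) (p0 : (0 < p)%R).
Let kap : R := ((hdim N)%:R + s * p)%R.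

(** Dyadic decomposition: on the shell |h| ~ 2^k the integral is of order 2^(-ksp) for large
    radii and 2^(-k(p-sp)) for small ones; both series are geometric because 0 < s < 1. *)
Lemma hnorm_kernel_integrable :
  \int[mu]_h (Num.min 1 (hnorm h `^ p) / hnorm h `^ kap)%:E < +oo.
Proof.
have sp0 : (0 < s * p)%R by rewrite mulr_gt0.
have kap0 : (0 < kap)%R by rewrite /kap ltr_wpDl.
pose two : R := 2%R.
have t0 : (0 < two)%R by [].
pose ca (k : nat) : R := ((two ^+ k) `^ (- kap))%R.
pose cb (k : nat) : R := ((two ^- k) `^ p * (two ^- k.+1) `^ (- kap))%R.
(* one term for each outer shell 2^k <= |h| <= 2^(k+1) and each inner shell
   2^-(k+1) <= |h| <= 2^-k *)
pose F h k := ((ca k)%:E * (\1_(hbox (two ^+ k.+1)) h)%:E +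
  (cb k)%:E * (\1_(hbox (two ^- k)) h)%:E).
have ca0 k : (0 <= ca k)%R by exact: powR_ge0.
have cb0 k : (0 <= cb k)%R by rewrite mulr_ge0// powR_ge0.
have F0 k h : 0 <= F h k.
  by rewrite /F -!EFinM -EFinD lee_fin addr_ge0// mulr_ge0.
have mF k : measurable_fun setT (F ^~ k).
  apply: emeasurable_funD; apply: emeasurable_funM => //;
    by apply/measurable_EFinP; apply: measurable_indic; exact: measurable_hbox.
have dom h : (Num.min 1 (hnorm h `^ p) / hnorm h `^ kap)%:E <= \sum_(0 <= k <oo) F h k.
  have Fk k (z : \bar R) : z <= F h k -> z <= \sum_(0 <= k <oo) F h k.
    move=> zF; apply: le_trans zF _.
    apply: le_trans (nneseries_lim_ge k.+1 _); last by move=> m _ _; exact: F0.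
    by rewrite big_nat_recr//= leeDr// sume_ge0.
  move: (hnorm h) (hnorm_ge0 h) (@hnorm_le_hbox h) => t + hb.
  rewrite le_eqVlt => /orP[/eqP <-|tp].
    rewrite [X in (_ / X)%R](_ : _ = 0%R); last by rewrite powR0// gt_eqF.
    by rewrite invr0 mulr0; apply: nneseries_ge0.
  have [t1|t1] := lerP 1%R t.
    have [k /andP[kt tk]] := dyadic t1.
    apply: (Fk k); rewrite /F -!EFinM -EFinD lee_fin.
    have -> : \1_(hbox (two ^+ k.+1)) h = 1%R :> R.
      by rewrite indicE mem_set//; apply: hb; exact: ltW.
    rewrite mulr1; apply: (@le_trans _ _ (ca k)); last by rewrite lerDl mulr_ge0.
    apply: (@le_trans _ _ (1 / t `^ kap)%R).
      by rewrite ler_wpM2r ?invr_ge0 ?powR_ge0// ge_min lexx.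
    rewrite mul1r -powRN /ca !powRN lef_pV2 ?posrE ?powR_gt0 ?exprn_gt0//.
    by apply: ge0_ler_powR; rewrite ?nnegrE ?exprn_ge0// ltW.
  have /dyadic[k] : (1 <= t^-1)%R by rewrite invf_ge1// ltW.
  move=> /andP[tk0 kt0].
  have tk : (t <= two ^- k)%R by rewrite -[t]invrK lef_pV2 ?posrE ?invr_gt0 ?exprn_gt0.
  have kt : (two ^- k.+1 < t)%R by rewrite -[t]invrK ltf_pV2 ?posrE ?invr_gt0 ?exprn_gt0.
  apply: (Fk k); rewrite /F -!EFinM -EFinD lee_fin.
  have -> : \1_(hbox (two ^- k)) h = 1%R :> R.
    by rewrite indicE mem_set//; exact: hb.
  rewrite mulr1; apply: (@le_trans _ _ (cb k)); last by rewrite lerDr mulr_ge0.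
  apply: ler_pM.
  - by rewrite le_min ler01 powR_ge0.
  - by rewrite invr_ge0 powR_ge0.
  - rewrite ge_min; apply/orP; right.
    by apply: ge0_ler_powR; rewrite ?nnegrE ?invr_ge0 ?exprn_ge0// ltW.
  rewrite powRN lef_pV2 ?posrE ?powR_gt0 ?invr_gt0 ?exprn_gt0//.
  by apply: ge0_ler_powR; rewrite ?nnegrE ?invr_ge0 ?exprn_ge0// ltW.
apply: (@le_lt_trans _ _ (\int[mu]_h \sum_(0 <= k <oo) F h k)).
  apply: ge0_le_integral => //.
  - move=> h _; rewrite lee_fin divr_ge0 ?powR_ge0// le_min ler01 powR_ge0//.
  - by apply/measurable_EFinP; exact: measurable_hkernel.
  - by apply: ge0_emeasurable_sum.
rewrite integral_nneseries//.
pose c2 : R := (two ^+ (N + N).+1)%R.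
pose qa : R := (two `^ (- (s * p)))%R.
pose qb : R := (two `^ (s * p - p))%R.
pose A : R := (c2 * two ^+ hdim N)%R.
pose B : R := (c2 * two `^ kap)%R.
have IF k : \int[mu]_h F h k = (A * qa ^+ k)%:E + (B * qb ^+ k)%:E.
  rewrite ge0_integralD//; last 4 first.
  - by move=> h _; rewrite mule_ge0// lee_fin.
  - apply: emeasurable_funM => //; apply/measurable_EFinP; apply: measurable_indic.
    exact: measurable_hbox.
  - by move=> h _; rewrite mule_ge0// lee_fin.
  - apply: emeasurable_funM => //; apply/measurable_EFinP; apply: measurable_indic.
    exact: measurable_hbox.
  have II (c r : R) : (0 <= c)%R -> (0 < r)%R -> \int[mu]_h (c%:E * (\1_(hbox r) h)%:E) =
      (c * (c2 * r ^+ hdim N))%:E.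
    move=> c0 r0; rewrite ge0_integralZl_EFin//; last first.
      by apply/measurable_EFinP; apply: measurable_indic; exact: measurable_hbox.
    rewrite EFinM -mu_hbox//; congr (_ * _).
    by rewrite integral_indic//; [rewrite setIT|exact: measurable_hbox].
  have En n : (two ^+ n = two `^ n%:R)%R by rewrite powR_mulrn// ltW.
  have EV n : (two ^- n = two `^ (- n%:R))%R by rewrite powRN -En.
  have EX a n : ((two `^ a) ^+ n = two `^ (a * n%:R))%R.
    by rewrite -powR_mulrn ?powR_ge0// -powRrM.
  have EP a b : ((two `^ a) `^ b = two `^ (a * b))%R by rewrite -powRrM.
  have ED a b : (two `^ a * two `^ b = two `^ (a + b))%R.
    by rewrite -powRD// pnatr_eq0 implybT.
  rewrite !II ?invr_gt0 ?exprn_gt0//; congr ((_)%:E + (_)%:E).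
    rewrite /ca /A /qa mulrCA -mulrA; congr (c2 * _)%R.
    rewrite !En !EP !EX !ED; congr (_ `^ _)%R.
    by rewrite /kap -natr1; ring.
  rewrite /cb /B /qb mulrCA -mulrA; congr (c2 * _)%R.
  rewrite !EV !EP !EX !ED; congr (_ `^ _)%R.
  by rewrite /kap -natr1; ring.
under eq_eseriesr do rewrite IF.
have A0 : (0 <= A)%R by rewrite mulr_ge0 ?exprn_ge0.
have B0 : (0 <= B)%R by rewrite mulr_ge0 ?powR_ge0 ?exprn_ge0.
rewrite nneseriesD; last 2 first.
- by move=> k _ _; rewrite lee_fin mulr_ge0// exprn_ge0// powR_ge0.
- by move=> k _ _; rewrite lee_fin mulr_ge0// exprn_ge0// powR_ge0.
have pow2_lt1 (a : R) : (a < 0)%R -> (two `^ a < 1)%R.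
  move=> a0; rewrite -[a]opprK powRN invf_lt1 ?powR_gt0//.
  rewrite /powR gt_eqF// expR_gt1 mulr_gt0 ?oppr_gt0// ln_gt0//.
  by rewrite /two ltr1n.
rewrite lte_add_pinfty//; apply: geometric_nneseries_lty => //;
  rewrite ?powR_gt0//; apply: pow2_lt1.
- by rewrite oppr_lt0.
- by rewrite subr_lt0 gtr_pMl.
Qed.

End kernel_integrability.

Section gagliardo_bound.
Context {R : realType} {N : nat}.
Local Notation V := 'rV[R]_(N + N + 1).
Local Notation mu := (@mu_heis R N).
Local Open Scope ereal_scope.
Implicit Types (x y h v : V) (phi : V -> R).
Variables (s p : R).

Lemma measurable_gagliardo_weight (a : R) :
  measurable_fun setT (fun z : V * V => gagliardo_weight s p z `^ a)%R.
Proof.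
apply: (@measurableT_comp _ _ _ _ _ _ (fun t : R => t `^ a)%R) => //.
apply: (@measurableT_comp _ _ _ _ _ _ (fun h : V => hnorm h `^ ((hdim N)%:R + s * p))%R
  _ (fun z : V * V => hmul (hinv z.2) z.1)); first exact: measurable_hnorm_powR.
apply: measurable_hmul; last exact: measurable_fst.
have : measurable_fun setT (fun z : V * V => - z.2)%R.
  apply: measurable_fun_rV => i.
  rewrite (_ : (fun z => _) = fun z : V * V => - (z.2 ord0 i))%R.
    apply: measurable_funN.
    exact: (measurableT_comp (measurable_coord_rV i) measurable_snd).
  by apply/funext => z; rewrite mxE.
by [].
Qed.

Hypotheses (p1 : (1 < p)%R) (s0 : (0 < s)%R) (s1 : (s < 1)%R) (N0 : (0 < N)%N).

(** The left translation x = y o h turns the double integral into an integral over the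
    increments h. *)
Lemma int_dmu_rdiff phi : measurable_fun setT phi ->
  measurable_fun setT
    (fun h => rdiff p phi h * ((hnorm h `^ ((hdim N)%:R + s * p))^-1)%:E) /\
  int_dmu s p (fun z : V * V => `|phi z.1 - phi z.2| `^ p)%R =
  \int[mu]_h (rdiff p phi h * ((hnorm h `^ ((hdim N)%:R + s * p))^-1)%:E).
Proof.
move=> mphi; set kap := ((hdim N)%:R + s * p)%R.
rewrite /int_dmu.
pose F (z : V * V) := (`|phi z.1 - phi z.2| `^ p / gagliardo_weight s p z)%:E.
have m1 : measurable_fun setT (fun z : V * V => phi z.1).
  exact: measurableT_comp mphi measurable_fst.
have m2 : measurable_fun setT (fun z : V * V => phi z.2).
  exact: measurableT_comp mphi measurable_snd.
have mF : measurable_fun setT F.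
  apply/measurable_EFinP; apply: measurable_funM.
    by apply: measurable_powR_norm; exact: measurable_funB.
  under eq_fun do rewrite -powR_inv1 ?powR_ge0//.
  exact: measurable_gagliardo_weight.
have F0 z : 0 <= F z by rewrite lee_fin divr_ge0 ?powR_ge0.
pose G (z : V * V) := ((`|phi (hmul z.1 z.2) - phi z.1| `^ p) / hnorm z.2 `^ kap)%:E.
have mG : measurable_fun setT G.
  apply/measurable_EFinP; apply: measurable_funM.
    apply: measurable_powR_norm; apply: measurable_funB => //.
    apply: measurableT_comp mphi _.
    by apply: measurable_hmul; [exact: measurable_fst|exact: measurable_snd].
  under eq_fun do rewrite -powRN.
  apply: (@measurableT_comp _ _ _ _ _ _ (fun h : V => hnorm h `^ (- kap))%R
    _ (fun z : V * V => z.2)); first exact: measurable_hnorm_powR.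
  exact: measurable_snd.
have G0 z : 0 <= G z by rewrite lee_fin divr_ge0 ?powR_ge0.
have EG h : fubini_G mu G h = rdiff p phi h * ((hnorm h `^ kap)^-1)%:E.
  rewrite /fubini_G /rdiff pintE muleC -ge0_integralZl_EFin//; last 2 first.
  - apply: measurable_EFin_powR; apply: measurable_funB => //.
    exact: measurable_comp_rmul.
  - by rewrite invr_ge0 powR_ge0.
  by apply: eq_integral => y _; rewrite /G -EFinM mulrC.
split.
  rewrite (_ : (fun h => _) = fubini_G mu G); last by apply/funext => h; rewrite EG.
  exact: measurable_fun_fubini_tonelli_G.
rewrite (_ : \int[_]_z _ = \int[mu \x mu]_z F z)//.
rewrite (fubini_tonelli2 _ mF F0) /fubini_G.
transitivity (\int[mu]_y \int[mu]_h G (y, h)).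
  apply: eq_integral => y _.
  have mFy : measurable_fun setT (fun x => F (x, y)).
    exact: measurableT_comp mF (measurable_pair2 y).
  have E := @ge0_integral_lmul R N y (fun x => F (x, y)) mFy (fun x => F0 (x, y)).
  apply: etrans (esym E) _; apply: eq_integral => h _; rewrite /F /G /gagliardo_weight /=.
  by rewrite /hinv hmulKx.
by rewrite (fubini_tonelli G mG G0); apply: eq_integral => h _; rewrite -EG.
Qed.

(** For |h| >= 1 the increments are bounded by the norm of phi, for |h| < 1 by |h|^p times
    that of its horizontal gradient; the remaining kernel is integrable. *)
Lemma gagliardo_bound : exists2 C : R, (0 < C)%R &
  forall Omega phi, cd 1 phi -> compact_support Omega phi ->
  int_dmu s p (fun z : V * V => `|phi z.1 - phi z.2| `^ p)%R <=
  C%:E * (pint mu p setT phi + pint mu p setT (hgrad1 phi)).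
Proof.
have p1' : (1 <= p)%R by exact: ltW.
have p0 : (0 < p)%R by exact: lt_le_trans ltr01 p1'.
have K0 := pK_gt0 p.
pose C1 : R := (pK p * (pK p + 4 * pK p ^+ 3) + 2 * pK p)%R.
have C10 : (0 < C1)%R.
  by rewrite /C1 addr_gt0// ?mulr_gt0// addr_gt0// mulr_gt0// exprn_gt0.
have I_lty := @hnorm_kernel_integrable R N s p s0 s1 p0.
set I := \int[_]_h _ in I_lty.
have I0 : 0 <= I.
  apply: integral_ge0 => h _; rewrite lee_fin divr_ge0 ?powR_ge0//.
  by rewrite le_min ler01 powR_ge0.
have IE : I = (fine I)%:E by rewrite fineK// ge0_fin_numE.
have fI0 : (0 <= fine I)%R by exact: fine_ge0.
exists (C1 * (fine I + 1))%R; first by rewrite mulr_gt0// ltr_wpDl.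
move=> Omega phi cphi sphi.
have mphi : measurable_fun setT phi by exact: cd_measurable.
have [mr ->] := int_dmu_rdiff mphi.
set A := pint mu p setT phi; set B := pint mu p setT (hgrad1 phi).
have A0 : 0 <= A by exact: pint_ge0.
have B0 : 0 <= B by exact: pint_ge0.
have bound h : rdiff p phi h <= (C1 * Num.min 1 (hnorm h `^ p))%:E * (A + B).
  have [m|m] := lerP 1%R (hnorm h `^ p)%R.
    apply: le_trans (rdiff_le p1' _ mphi) _; rewrite -/A mulr1.
    rewrite -mule2n -mule_natl muleA -EFinM.
    apply: lee_pmul => //.
    - by rewrite lee_fin mulr_ge0// ltW.
    - rewrite lee_fin /C1 mulrC lerDr mulr_ge0 ?addr_ge0 ?mulr_ge0 ?exprn_ge0 ?ltW//.
    - by rewrite leeDl.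
  apply: le_trans (rdiff_le_hnorm p1' _ N0 cphi sphi) _; rewrite -/B.
  apply: lee_pmul => //.
  - by rewrite lee_fin ?mulr_ge0 ?addr_ge0 ?mulr_ge0 ?exprn_ge0 ?powR_ge0 ?ltW.
  - by rewrite lee_fin ler_wpM2r ?powR_ge0// /C1 lerDl mulr_ge0// ltW.
  - by rewrite leeDr.
have [AB|] := eqVneq (A + B) +oo.
  rewrite AB gt0_muley ?leey// lte_fin mulr_gt0// ltr_wpDl//.
rewrite -ltey => AB.
have ABE : A + B = (fine (A + B))%:E by rewrite fineK// ge0_fin_numE// adde_ge0.
have fAB : (0 <= fine (A + B))%R by apply: fine_ge0; exact: adde_ge0.
apply: (@le_trans _ _ (\int[mu]_h ((C1 * fine (A + B))%:E *
    (Num.min 1 (hnorm h `^ p) / hnorm h `^ ((hdim N)%:R + s * p))%:E))).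
  have H h : 0 <= rdiff p phi h * (hnorm h `^ ((hdim N)%:R + s * p))^-1%:E <=
    (C1 * fine (A + B))%:E *
    (Num.min 1 (hnorm h `^ p) / hnorm h `^ ((hdim N)%:R + s * p))%:E.
    rewrite mule_ge0 ?rdiff_ge0 ?lee_fin ?invr_ge0 ?powR_ge0//=.
    apply: (@le_trans _ _ ((C1 * Num.min 1 (hnorm h `^ p))%:E * (A + B) *
      (hnorm h `^ ((hdim N)%:R + s * p))^-1%:E)).
      by apply: lee_wpmul2r => //; rewrite lee_fin invr_ge0 powR_ge0.
    rewrite ABE -!EFinM lee_fin le_eqVlt; apply/orP; left; apply/eqP; ring.
  apply: ge0_le_integral => //.
  - by move=> h _; have /andP[] := H h.
  - by apply: emeasurable_funM => //; apply/measurable_EFinP; exact: measurable_hkernel.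
  - by move=> h _; have /andP[] := H h.
rewrite ge0_integralZl_EFin//; last 3 first.
- by move=> h _; rewrite lee_fin divr_ge0 ?powR_ge0// le_min ler01 powR_ge0.
- by apply/measurable_EFinP; exact: measurable_hkernel.
- by rewrite mulr_ge0// ltW.
rewrite -/I IE ABE -!EFinM lee_fin mulrAC; apply: ler_wpM2r => //.
by apply: ler_wpM2l; [exact: ltW|rewrite /= lerDl].
Qed.

End gagliardo_bound.

(** * Convergence tools for integrals of p-th powers *)

Lemma cvg_powR_norm (R : realType) (p l : R) (u : nat -> R) : 0 < p ->
  u n @[n --> \oo] --> l -> `|u n| `^ p @[n --> \oo] --> `|l| `^ p.
Proof.
move=> p0 ul.
have [l0|l0] := eqVneq l 0.
  rewrite l0 normr0 powR0 ?gt_eqF//; apply: (@cvg_powR0 R p u p0).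
  by rewrite -l0.
have nl0 : 0 < `|l| by rewrite normr_gt0.
have cl : {for `|l|, continuous (fun t : R => t `^ p)}.
  apply: differentiable_continuous; apply/derivable1_diffP.
  by apply: derivable_powR; rewrite in_itv/= nl0.
exact: (continuous_cvg _ cl (cvg_norm ul)).
Qed.

Section measure_tools.
Context d (T : measurableType d) (R : realType) (mu : {measure set T -> \bar R}).
Local Open Scope ereal_scope.
Implicit Types (D : set T) (F g h a : T -> R).

(** Fatou's lemma as a lower bound that eventually holds along the sequence, for almost
    everywhere convergence. *)
Lemma fatou_lower D (F_ : nat -> T -> R) F (c : R) : measurable D ->
  (forall n, measurable_fun D (F_ n)) -> measurable_fun D F ->
  (forall n x, D x -> 0 <= F_ n x)%R -> (forall x, D x -> 0 <= F x)%R ->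
  {ae mu, forall x, D x -> F_ n x @[n --> \oo] --> F x} ->
  c%:E < \int[mu]_(x in D) (F x)%:E ->
  \forall n \near \oo, c%:E <= \int[mu]_(x in D) (F_ n x)%:E.
Proof.
move=> mD mF_ mF F_0 F0 cvF cF.
have mEF n : measurable_fun D (fun x => (F_ n x)%:E) by apply/measurable_EFinP.
have F0' n x : D x -> 0 <= (F_ n x)%:E by move=> Dx; rewrite lee_fin; exact: F_0.
have minf : measurable_fun D (fun x => limn_einf (fun n => (F_ n x)%:E)).
  rewrite (_ : (fun x => _) = fun x => - limn_esup (fun n => - (F_ n x)%:E)).
    apply: measurableT_comp => //; apply: measurable_fun_limn_esup => n.
    exact: measurableT_comp (mEF n).
  apply/funext => x; rewrite -limn_einfN; congr limn_einf; apply/funext => n /=.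
  by rewrite opprK.
have le1 : \int[mu]_(x in D) (F x)%:E <=
    \int[mu]_(x in D) limn_einf (fun n => (F_ n x)%:E).
  apply: ae_ge0_le_integral => //.
  - exact/measurable_EFinP.
  - by move=> x Dx; rewrite limn_einf_lim; apply: lime_ge; [exact: is_cvg_einfs|
      apply: nearW => n; apply: le_ereal_inf_tmp => _ [m _ <-]; exact: F0'].
  apply: filterS cvF => x + Dx => /(_ Dx) cFx.
  have cE : (F_ n x)%:E @[n --> \oo] --> (F x)%:E by apply/cvg_EFin; [exact: nearW|].
  by rewrite is_cvg_limn_einfE; [rewrite (cvg_lim _ cE)|apply/cvg_ex; exists (F x)%:E].
have := lt_le_trans cF (le_trans le1 (fatou mu mD mEF F0')).
rewrite limn_einf_lim => /lte_lim; move=> /(_ _ _) H.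
have : \forall n \near \oo, c%:E <= einfs (fun n => \int[mu]_(x in D) (F_ n x)%:E) n.
  by apply: H; [exact: nondecreasing_einfs|exact: is_cvg_einfs].
apply: filterS => n /le_trans; apply; apply: ereal_inf_lbound.
by exists n => //=.
Qed.

Lemma pint_fatou (p c : R) D (F_ : nat -> T -> R) F : (0 < p)%R -> measurable D ->
  (forall n, measurable_fun D (F_ n)) -> measurable_fun D F ->
  {ae mu, forall x, D x -> F_ n x @[n --> \oo] --> F x} ->
  (\forall n \near \oo, pint mu p D (F_ n) <= c%:E) -> pint mu p D F <= c%:E.
Proof.
move=> p0 mD mF_ mF cF Hn; rewrite leNgt; apply/negP; rewrite {1}pintE.
move=> ltc.
have [c' cc' c'F] : exists2 c' : R, (c < c')%R & c'%:E < \int[mu]_(x in D) (`|F x| `^ p)%:E.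
  move: ltc; case: (\int[mu]_(x in D) _) => [r||]// => [|_].
    rewrite lte_fin => cr; exists ((c + r) / 2)%R; first by rewrite midf_lt.
    by rewrite lte_fin midf_lt.
  by exists (c + 1)%R; [rewrite ltrDl|rewrite ltry].
have := @fatou_lower D (fun n x => `|F_ n x| `^ p)%R (fun x => `|F x| `^ p)%R c' mD.
case.
- by move=> n; exact: measurable_powR_norm.
- exact: measurable_powR_norm.
- by move=> n x _; exact: powR_ge0.
- by move=> x _; exact: powR_ge0.
- apply: filterS cF => x + Dx => /(_ Dx) cFx.
  exact: cvg_powR_norm.
- exact: c'F.
move=> N1 _ HN1; have [N2 _ HN2] := Hn.
have := HN1 (maxn N1 N2) (leq_maxl _ _); rewrite /= -pintE => H1.
have := le_trans H1 (HN2 (maxn N1 N2) (leq_maxr _ _)).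
by rewrite lee_fin leNgt cc'.
Qed.

(** Geometric decay of the integrals makes the series of |F_n|^p integrable, hence its
    general term tends to 0 almost everywhere. *)
Lemma pint_cvg_ae (p C : R) (F_ : nat -> T -> R) : (0 < p)%R -> (0 <= C)%R ->
  (forall n, measurable_fun setT (F_ n)) ->
  (forall n, pint mu p setT (F_ n) <= (C * 2^-1 ^+ n)%:E) ->
  {ae mu, forall x, F_ n x @[n --> \oo] --> (0 : R)%R}.
Proof.
move=> p0 C0 mF HF.
pose S x := \sum_(0 <= n <oo) (`|F_ n x| `^ p)%:E.
have mP n : measurable_fun setT (fun x => (`|F_ n x| `^ p)%:E) by exact: measurable_EFin_powR.
have mS : measurable_fun setT S.
  by apply: ge0_emeasurable_sum => // n x _ _; rewrite lee_fin powR_ge0.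
have S0 x : 0 <= S x by apply: nneseries_ge0 => n _ _; rewrite lee_fin powR_ge0.
have iS : mu.-integrable setT S.
  apply/integrableP; split => //.
  under eq_integral do rewrite gee0_abs//.
  rewrite integral_nneseries//.
  apply: (@le_lt_trans _ _ (\sum_(0 <= n <oo) (C * 2^-1 ^+ n)%:E)).
    apply: lee_nneseries => [n _ _|n _]; last by have := HF n; rewrite pintE.
    by rewrite -pintE pint_ge0.
  by apply: geometric_nneseries_lty => //; rewrite invf_lt1// ltr1n.
have := integrable_ae measurableT iS; apply: filterS => x /(_ I) Sx.
have Soo : S x < +oo by move: Sx; rewrite ge0_fin_numE.
pose a n := (`|F_ n x| `^ p)%R.
have a0 n : (0 <= a n)%R by exact: powR_ge0.
have cvE : (a n)%:E @[n --> \oo] --> 0.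
  have tail : \sum_(n <= k <oo) (a k)%:E @[n --> \oo] --> 0.
    by apply: (@nneseries_tail_cvg R (fun k => (a k)%:E) xpredT) => // k _; rewrite lee_fin.
  apply: (@squeeze_cvge _ _ _ _ (cst 0) _ (fun n => \sum_(n <= k <oo) (a k)%:E)) => //.
    apply: nearW => n /=; rewrite lee_fin a0/=.
    have -> : (a n)%:E = \sum_(n <= k < n.+1) (a k)%:E by rewrite big_nat1.
    by apply: nneseries_lim_ge => k _ _; rewrite lee_fin.
  exact: cvg_cst.
have cv : a n @[n --> \oo] --> (0 : R)%R by exact: (fine_cvg cvE).
apply: norm_cvg0.
have pV : (0 < p^-1)%R by rewrite invr_gt0.
have := @cvg_powR0 R p^-1%R a pV cv.
apply: cvg_trans; apply: near_eq_cvg; apply: nearW => n.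
by rewrite ger0_norm// /a -powRrM mulfV ?gt_eqF// powRr1.
Qed.

Lemma pint_sum_le (p : R) (p1 : (1 <= p)%R) D (I : Type) (s : seq I) : measurable D ->
  exists2 C : R, (0 < C)%R & forall F : I -> T -> R, (forall i, measurable_fun D (F i)) ->
  pint mu p D (fun x => \sum_(i <- s) F i x)%R <= C%:E * \sum_(i <- s) pint mu p D (F i).
Proof.
move=> mD; have K0 := pK_gt0 p; elim: s => [|i s [C C0 IH]].
  exists 1%R => // F _; rewrite big_nil mule0 pintE.
  under eq_integral do rewrite big_nil normr0 powR0 ?gt_eqF ?(lt_le_trans ltr01 p1)//.
  by rewrite integral0.
exists (pK p * (1 + C))%R => [|F mF]; first by rewrite mulr_gt0// addr_gt0.
under eq_fun do rewrite big_cons.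
have mS : measurable_fun D (fun x => \sum_(i <- s) F i x)%R by exact: measurable_sum.
apply: le_trans (pintD mu p1 mD (mF i) mS) _.
rewrite EFinM -muleA lee_pmul2l// big_cons.
have S0 : 0 <= \sum_(i <- s) pint mu p D (F i) by apply: sume_ge0 => j _; exact: pint_ge0.
rewrite ge0_muleDr ?pint_ge0//; apply: leeD.
  by rewrite -[leLHS]mul1e; apply: lee_wpmul2r; rewrite ?pint_ge0// lee_fin lerDl ltW.
by apply: le_trans (IH F mF) _; apply: lee_wpmul2r => //; rewrite lee_fin lerDr.
Qed.

Lemma pint_ae_eq (p : R) D g h : measurable D -> measurable_fun D g -> measurable_fun D h ->
  {ae mu, forall x, D x -> g x = h x} -> pint mu p D g = pint mu p D h.
Proof.
move=> mD mg mh gh; rewrite !pintE; apply: ge0_ae_eq_integral => //.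
- exact: measurable_EFin_powR.
- exact: measurable_EFin_powR.
by apply: filterS gh => x /= gh Dx; rewrite gh.
Qed.

Lemma pint_integrable (p : R) D g : measurable D -> measurable_fun D g ->
  pint mu p D g < +oo -> mu.-integrable D (fun x => (`|g x| `^ p)%:E).
Proof.
move=> mD mg pg; apply/integrableP; split; first exact: measurable_EFin_powR.
by under eq_integral do rewrite gee0_abs ?lee_fin ?powR_ge0//; rewrite -pintE.
Qed.

(** Young's inequality bounds |g|^(p-1) |h| by |g|^p + |h|^p. *)
Lemma young_integrable (p : R) D g h a : (1 <= p)%R -> measurable D ->
  measurable_fun D g -> measurable_fun D h -> measurable_fun D a ->
  (forall x, D x -> `|a x| <= `|g x| `^ (p - 1) * `|h x|)%R ->
  pint mu p D g < +oo -> pint mu p D h < +oo ->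
  mu.-integrable D (EFin \o a).
Proof.
move=> p1 mD mg mh ma aD pg ph.
have ig := pint_integrable mD mg pg; have ih := pint_integrable mD mh ph.
apply: (@le_integrable _ _ _ mu D mD _ (fun x => (`|g x| `^ p)%:E + (`|h x| `^ p)%:E)).
- exact/measurable_EFinP.
- move=> x Dx; rewrite /= -[leRHS]/((Num.norm (`|g x| `^ p + `|h x| `^ p))%:E) lee_fin [leRHS]ger0_norm ?addr_ge0 ?powR_ge0//.
  apply: le_trans (aD x Dx) _; apply: le_trans (young_powR p1 _ _) _ => //.
  have q1 : (p^-1 <= 1)%R by rewrite invf_le1// (lt_le_trans ltr01).
  have q0 : (0 <= p^-1)%R by rewrite invr_ge0 (le_trans ler01).
  by apply: lerD; rewrite ler_piMl ?powR_ge0// lerBlDr lerDl.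
exact: integrableD.
Qed.

Lemma ae_exists (P : T -> Prop) (S : set T) : {ae mu, forall x, P x} ->
  measurable S -> 0 < mu S -> exists2 x, S x & P x.
Proof.
move=> [A [mA A0 PA]] mS muS; apply: contrapT => H.
have SA : S `<=` A.
  by move=> x Sx; apply: PA => Px; apply: H; exists x.
have := le_measure mu (mem_set mS) (mem_set mA) SA.
by rewrite [X in _ <= X -> _]A0 leNgt muS.
Qed.

End measure_tools.

(** * Almost everywhere statements on product spaces *)

Section product_ae.
Context d1 d2 (T1 : measurableType d1) (T2 : measurableType d2) (R : realType).
Variables (m1 : {sigma_finite_measure set T1 -> \bar R}).
Variables (m2 : {sigma_finite_measure set T2 -> \bar R}).
Local Open Scope ereal_scope.

Lemma ae_prod_fst (P : T1 -> Prop) : {ae m1, forall x, P x} ->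
  {ae (m1 \x m2), forall z, P z.1}.
Proof.
move=> [A [mA A0 PA]]; exists (A `*` setT); split => //.
- exact: measurableX.
- by rewrite product_measure1E// [X in X * _]A0 mul0e.
- by move=> z /= nP; split => //; exact: PA.
Qed.

Lemma ae_prod_snd (P : T2 -> Prop) : {ae m2, forall x, P x} ->
  {ae (m1 \x m2), forall z, P z.2}.
Proof.
move=> [A [mA A0 PA]]; exists (setT `*` A); split => //.
- exact: measurableX.
- by rewrite product_measure1E// [X in _ * X]A0 mule0.
- by move=> z /= nP; split => //; exact: PA.
Qed.

End product_ae.

(** * The Euclidean norm of finite families *)

Section euclidean_norm.
Context {R : realType} {I : finType}.
Implicit Types a b : I -> R.

Definition enorm a : R := Num.sqrt (\sum_i a i ^+ 2).

Lemma enorm_ge0 a : 0 <= enorm a. Proof. exact: sqrtr_ge0. Qed.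

Lemma enorm_sqr a : enorm a ^+ 2 = \sum_i a i ^+ 2.
Proof. by rewrite sqr_sqrtr// sumr_ge0// => i _; exact: sqr_ge0. Qed.

Lemma cauchy_schwarz a b : `|\sum_i a i * b i| <= enorm a * enorm b.
Proof.
rewrite -(@ler_pXn2r _ 2)// ?nnegrE ?mulr_ge0 ?enorm_ge0//.
rewrite real_normK ?num_real// exprMn !enorm_sqr.
set A := \sum_i a i ^+ 2; set B := \sum_i b i ^+ 2; set S := \sum_i a i * b i.
have B0 : 0 <= B by apply: sumr_ge0 => i _; exact: sqr_ge0.
have : 0 <= \sum_i (B * a i - S * b i) ^+ 2 by apply: sumr_ge0 => i _; exact: sqr_ge0.
have -> : \sum_i (B * a i - S * b i) ^+ 2 = B * (A * B - S ^+ 2).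
  transitivity (\sum_i (B ^+ 2 * a i ^+ 2 + (- (2 * B * S)) * (a i * b i) + S ^+ 2 * b i ^+ 2)).
    by apply: eq_bigr => i _; ring.
  by rewrite !big_split/= -!mulr_sumr -/A -/B -/S; ring.
move: B0; rewrite le_eqVlt => /orP[/eqP B0|B0]; last first.
  by rewrite pmulr_rge0// subr_ge0.
suff -> : S = 0 by rewrite -B0 mulr0 expr0n.
apply: big1 => i _; suff -> : b i = 0 by rewrite mulr0.
apply/eqP; rewrite -sqrf_eq0; apply/eqP.
by apply: (psumr_eq0P _ (esym B0)) => // j _; exact: sqr_ge0.
Qed.

Lemma enormD a b : enorm (fun i => a i + b i) <= enorm a + enorm b.
Proof.
rewrite -(@ler_pXn2r _ 2)// ?nnegrE ?addr_ge0 ?enorm_ge0//.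
rewrite enorm_sqr sqrrD !enorm_sqr.
under eq_bigr do rewrite sqrrD.
rewrite !big_split/= lerD2r lerD2l -mulr2n ler_pMn2r//.
exact: le_trans (ler_norm _) (cauchy_schwarz a b).
Qed.

Lemma enormZ (c : R) a : enorm (fun i => c * a i) = `|c| * enorm a.
Proof.
rewrite /enorm; under eq_bigr do rewrite exprMn.
by rewrite -mulr_sumr sqrtrM ?sqr_ge0// sqrtr_sqr.
Qed.

Lemma enorm_le_sum a : enorm a <= \sum_i `|a i|.
Proof.
have S0 : 0 <= \sum_i `|a i| by exact: sumr_ge0.
rewrite -(@ler_pXn2r _ 2)// ?nnegrE ?enorm_ge0// enorm_sqr expr2 mulr_sumr.
apply: ler_sum => i _; rewrite -[leLHS]real_normK ?num_real// expr2 ler_wpM2r//.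
by rewrite (bigD1 i)//= lerDl sumr_ge0.
Qed.

Lemma enorm_le a b : (forall i, `|a i| <= `|b i|) -> enorm a <= enorm b.
Proof.
move=> ab; rewrite /enorm ler_wsqrtr// ler_sum// => i _.
by rewrite -[leLHS]real_normK ?num_real// -[leRHS]real_normK ?num_real// ler_pXn2r// nnegrE.
Qed.

End euclidean_norm.

Lemma measurable_enorm d (T : measurableType d) (R : realType) (I : finType) (D : set T)
    (G : I -> T -> R) : (forall i, measurable_fun D (G i)) ->
  measurable_fun D (fun x => enorm (fun i => G i x)).
Proof.
move=> mG; rewrite /enorm.
rewrite (_ : (fun x => _) = fun x => (\sum_i G i x ^+ 2) `^ 2^-1); last first.
  by apply/funext => x; rewrite powR12_sqrt// sumr_ge0// => i _; exact: sqr_ge0.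
apply: (@measurableT_comp _ _ _ _ _ _ (fun t : R => t `^ 2^-1)) => //.
by apply: measurable_sum => i; exact: measurable_funX.
Qed.

(** * Pairs approximated in energy by test functions *)

Section pair_energy.
Context {R : realType} {N : nat}.
Local Notation V := 'rV[R]_(N + N + 1).
Local Notation mu := (@mu_heis R N).
Local Open Scope ereal_scope.
Implicit Types (v w phi : V -> R) (G : 'I_(N + N) -> V -> R) (Omega : set V).

(** Difference quotient whose p-th power is the Gagliardo integrand: the nonlocal part of the
    energy becomes the p-th power of an L^p norm on the product space. *)
Definition gag (s p : R) v (z : V * V) : R :=
  ((v z.1 - v z.2) * gagliardo_weight s p z `^ (- p^-1))%R.

Lemma measurable_gag s p v : measurable_fun setT v -> measurable_fun setT (gag s p v).
Proof.
move=> mv; apply: measurable_funM; last exact: measurable_gagliardo_weight.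
apply: measurable_funB.
  exact: measurableT_comp mv measurable_fst.
exact: measurableT_comp mv measurable_snd.
Qed.

Lemma gag_powR (s p c : R) (z : V * V) : (0 < p)%R ->
  (`|c * gagliardo_weight s p z `^ (- p^-1)| `^ p = `|c| `^ p / gagliardo_weight s p z)%R.
Proof.
move=> p0; rewrite normrM powRM// (ger0_norm (powR_ge0 _ _)) -powRrM mulNr mulVf ?gt_eqF//.
by rewrite powR_inv1// powR_ge0.
Qed.

Lemma int_dmu_gag (s p : R) v : (0 < p)%R ->
  int_dmu s p (fun z : V * V => `|v z.1 - v z.2| `^ p)%R = pint (mu \x mu) p setT (gag s p v).
Proof.
move=> p0; rewrite pintE /int_dmu; apply: eq_integral => z _.
by rewrite gag_powR.
Qed.

End pair_energy.

(** Energy of a pair of a horizontal field G and a function v, where G need not be the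
    gradient of v: the chosen weak gradient is not additive, while this energy is convex in
    the pair. *)
HB.lock Definition pair_energy {R : realType} {N : nat} (Omega : set 'rV[R]_(N + N + 1))
    (p s alpha : R) (G : 'I_(N + N) -> 'rV[R]_(N + N + 1) -> R)
    (v : 'rV[R]_(N + N + 1) -> R) : \bar R :=
  (pint (@mu_heis R N) p Omega (fun x => enorm (fun j => G j x)) +
   alpha%:E * pint (@mu_heis R N \x @mu_heis R N) p setT (gag s p v))%E.
Canonical locked_pair_energy := Unlockable pair_energy.unlock.

Section admissible_pairs.
Context {R : realType} {N : nat}.
Local Notation V := 'rV[R]_(N + N + 1).
Local Notation mu := (@mu_heis R N).
Local Open Scope ereal_scope.
Implicit Types (v w phi : V -> R) (G : 'I_(N + N) -> V -> R).
Variables (Omega : set V) (p s alpha : R).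
Hypotheses (p1 : (1 < p)%R) (s0 : (0 < s)%R) (s1 : (s < 1)%R) (alpha0 : (0 < alpha)%R).
Hypotheses (N0 : (0 < N)%N) (oO : open Omega) (bO : bounded_set Omega).
Hypothesis sO : smooth_boundary Omega.
Let p1' : (1 <= p)%R. Proof. exact: ltW. Qed.
Let p0 : (0 < p)%R. Proof. exact: lt_le_trans ltr01 p1'. Qed.
Let mO : measurable Omega. Proof. exact: open_measurable_rV. Qed.
Local Notation EP := (pair_energy Omega p s alpha).

Definition test1 phi := cd 1 phi /\ compact_support Omega phi.

Lemma pair_energyE G v : EP G v = pint mu p Omega (fun x => enorm (fun j => G j x)) +
  alpha%:E * pint (mu \x mu) p setT (gag s p v).
Proof. by rewrite unlock. Qed.

Lemma pair_energy_ge0 G v : 0 <= EP G v.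
Proof. by rewrite pair_energyE adde_ge0 ?mule_ge0 ?pint_ge0// lee_fin ltW. Qed.

Lemma energyE v : energy Omega p s alpha v = EP (fun j => weak_X j v) v.
Proof.
rewrite pair_energyE /energy int_dmu_gag//; congr (_ + _); rewrite pintE.
by apply: eq_integral => x _; rewrite ger0_norm ?enorm_ge0.
Qed.

(** Quasi-convexity of the energy, from that of the two L^p norms and the triangle
    inequality for the Euclidean norm of the gradient. *)
Lemma pair_energyD (e : R) G G' v v' : (0 < e)%R -> (e < 1)%R ->
  (forall j, measurable_fun setT (G j)) -> (forall j, measurable_fun setT (G' j)) ->
  measurable_fun setT v -> measurable_fun setT v' ->
  EP (fun j x => G j x + G' j x)%R (fun x => v x + v' x)%R <=
  ((1 - e) `^ (1 - p))%:E * EP G v + (e `^ (1 - p))%:E * EP G' v'.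
Proof.
move=> e0 e1 mG mG' mv mv'; rewrite !pair_energyE.
have mgr (H : 'I_(N + N) -> V -> R) : (forall j, measurable_fun setT (H j)) ->
    measurable_fun Omega (fun x => enorm (fun j => H j x)).
  by move=> mH; apply: measurable_funTS; exact: measurable_enorm.
have c1 : (0 <= (1 - e) `^ (1 - p))%R by exact: powR_ge0.
have c2 : (0 <= e `^ (1 - p))%R by exact: powR_ge0.
have a0 : 0 <= alpha%:E by rewrite lee_fin ltW.
set A := pint mu p Omega _; set B := pint mu p Omega _; set C := pint mu p Omega _.
set a := pint (mu \x mu) p setT _; set b := pint (mu \x mu) p setT _.
set c := pint (mu \x mu) p setT _.
have H1 : A <= ((1 - e) `^ (1 - p))%:E * B + (e `^ (1 - p))%:E * C.
  apply: le_trans (pint_quasiconvex mu p1' mO (mgr _ mG) (mgr _ mG') e0 e1).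
  apply: pint_le => //; first by apply: mgr => j; exact: measurable_funD.
    by apply: measurable_funD; exact: mgr.
  move=> x _; rewrite ger0_norm ?enorm_ge0// ger0_norm ?addr_ge0 ?enorm_ge0//.
  exact: enormD.
have H2 : a <= ((1 - e) `^ (1 - p))%:E * b + (e `^ (1 - p))%:E * c.
  apply: le_trans (pint_quasiconvex (mu \x mu) p1' measurableT (measurable_gag s p mv)
    (measurable_gag s p mv') e0 e1).
  rewrite /a (_ : gag s p (fun x => v x + v' x)%R = fun z => gag s p v z + gag s p v' z)%R//.
  by apply/funext => z; rewrite /gag; ring.
apply: le_trans (leeD H1 (lee_wpmul2l a0 H2)) _.
have [A0 B0 C0] : [/\ 0 <= B, 0 <= C & 0 <= b] by split; exact: pint_ge0.
have c0 : 0 <= c by exact: pint_ge0.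
rewrite !ge0_muleDr ?mule_ge0 ?lee_fin//.
by rewrite addeACA !muleA (muleC alpha%:E) (muleC alpha%:E (e `^ (1 - p))%:E).
Qed.

Lemma pair_energyZ (c : R) G v : (forall j, measurable_fun setT (G j)) ->
  measurable_fun setT v ->
  EP (fun j x => c * G j x)%R (fun x => c * v x)%R = (`|c| `^ p)%:E * EP G v.
Proof.
move=> mG mv; rewrite !pair_energyE.
have -> : (fun x => enorm (fun j => c * G j x)%R) = (fun x => `|c| * enorm (fun j => G j x))%R.
  by apply/funext => x; rewrite enormZ.
rewrite pintZ//; last by apply: measurable_funTS; exact: measurable_enorm.
rewrite normr_id (_ : gag s p (fun x => c * v x)%R = fun z => c * gag s p v z)%R; last first.
  by apply/funext => z; rewrite /gag; ring.
rewrite pintZ//; last exact: measurable_gag.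
by rewrite ge0_muleDr ?mule_ge0 ?pint_ge0 ?lee_fin ?ltW// muleCA.
Qed.

Lemma pair_energyBC G G' v v' :
  EP (fun j x => G j x - G' j x)%R (fun x => v x - v' x)%R =
  EP (fun j x => G' j x - G j x)%R (fun x => v' x - v x)%R.
Proof.
rewrite !pair_energyE; congr (_ + _ * _).
  rewrite !pintE; apply: eq_integral => x _; congr ((`|_| `^ _)%:E).
  by rewrite /enorm; congr Num.sqrt; apply: eq_bigr => j _; rewrite -sqrrN opprB.
rewrite -pintN; congr pint; apply/funext => z; rewrite /gag; ring.
Qed.

Lemma pint_bounded (K : set V) (M : R) (F : V -> R) : compact K -> (0 <= M)%R ->
  measurable_fun setT F -> (forall x, F x != 0%R -> K x /\ `|F x| <= M)%R ->
  pint mu p setT F < +oo.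
Proof.
move=> cK M0 mF HF; have mK := compact_measurable_rV cK.
apply: (@le_lt_trans _ _ (pint mu p setT (fun y => M * \1_K y)%R)).
  apply: pint_le => //; first by apply: measurable_funM => //; exact: measurable_indic.
  move=> y _; have [->|/HF[Ky H]] := eqVneq (F y) 0%R.
    by rewrite normr0.
  by rewrite indicE mem_set// mulr1 (ger0_norm M0).
rewrite pintZ//.
have -> : pint mu p setT \1_K = mu K.
  rewrite pintE -[RHS]mul1e -[RHS]integral_cst// [RHS]integral_mkcond.
  apply: eq_integral => y _; rewrite patchE indicE; case: (y \in K).
    by rewrite normr1 powR1.
  by rewrite normr0 powR0// gt_eqF.
by rewrite lte_mul_pinfty ?lee_fin ?powR_ge0//; exact: mu_compact_fin.
Qed.

Lemma pint_continuous_lty (K : set V) (F : V -> R) : compact K -> continuous F ->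
  (forall x, F x != 0%R -> K x) -> pint mu p setT F < +oo.
Proof.
move=> cK cF FK; have [M M0 HM] := compact_norm_bounded cK cF.
apply: (pint_bounded cK (ltW M0)); first exact: continuous_measurable_rV.
by move=> x /FK Kx; split => //; exact: HM.
Qed.

Lemma test_supp phi : test1 phi -> compact (closure [set x | phi x != 0%R]) /\
  forall x, phi x != 0%R -> closure [set x | phi x != 0%R] x.
Proof. by move=> [_ [cK _]]; split => // x fx; exact: subset_closure. Qed.

Lemma hgrad1_supp phi x : test1 phi -> hgrad1 phi x != 0%R -> closure [set x | phi x != 0%R] x.
Proof.
move=> tphi; have [cK fK] := test_supp tphi; have [cphi _] := tphi.
apply: contraPP => nKx; rewrite /hgrad1 big1 ?eqxx// => j _.
apply/eqP; rewrite normr_eq0; apply: contra_notT nKx.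
by apply: (Xfield_support cphi) => //; exact: compact_closed_rV.
Qed.

Lemma continuous_hgrad1 phi : cd 1 phi -> continuous (hgrad1 phi).
Proof.
move=> cphi; apply: continuous_sumr => j x.
apply: (@continuous_comp _ _ _ (Xfield j phi) Num.norm).
  exact: continuous_Xfield.
exact: norm_continuous.
Qed.

Lemma enorm_le_hgrad1 phi x : (enorm (fun j => Xfield j phi x) <= hgrad1 phi x)%R.
Proof. exact: enorm_le_sum. Qed.

Lemma test_energy_lty phi : test1 phi -> EP (fun j => Xfield j phi) phi < +oo.
Proof.
move=> tphi; have [cphi sphi] := tphi; have [cK fK] := test_supp tphi.
have cf := cd_continuous cphi.
have h1 : pint mu p setT (hgrad1 phi) < +oo.
  by apply: (pint_continuous_lty cK (continuous_hgrad1 cphi)) => x; exact: hgrad1_supp.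
rewrite pair_energyE lte_add_pinfty//.
  apply: le_lt_trans h1.
  apply: (@le_trans _ _ (pint mu p setT (fun x => enorm (fun j => Xfield j phi x)))).
    rewrite !pintE; apply: ge0_subset_integral => //.
    by apply: measurable_EFin_powR; apply: measurable_enorm => j; exact: Xfield_measurable.
  apply: pint_le => //.
  - by apply: measurable_enorm => j; exact: Xfield_measurable.
  - by apply: continuous_measurable_rV; exact: continuous_hgrad1.
  move=> x _; rewrite ger0_norm ?enorm_ge0// (le_trans (enorm_le_hgrad1 _ _))//.
  exact: ler_norm.
rewrite lte_mul_pinfty ?lee_fin ?(ltW alpha0)// -int_dmu_gag//.
have [C C0 HC] := gagliardo_bound p1 s0 s1 N0.
apply: le_lt_trans (HC _ _ cphi sphi) _.
rewrite lte_mul_pinfty ?lee_fin ?(ltW C0)// lte_add_pinfty//.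
exact: (pint_continuous_lty cK cf).
Qed.

(** Stated for pairs so that the class is visibly closed under multiples and under differences
    with test functions, which occur when testing with approximations of the solution. *)
Definition admissible G v :=
  [/\ forall j, measurable_fun setT (G j), measurable_fun setT v, EP G v < +oo &
   exists phi_ : nat -> V -> R,
   [/\ forall n, test1 (phi_ n),
       forall e : R, (0 < e)%R -> \forall n \near \oo,
         EP (fun j x => Xfield j (phi_ n) x - G j x)%R (fun x => phi_ n x - v x)%R <= e%:E &
       {ae mu, forall x, phi_ n x @[n --> \oo] --> v x}]].

Lemma test_measurable phi : test1 phi ->
  measurable_fun setT phi /\ forall j, measurable_fun setT (Xfield j phi).
Proof. by move=> [c _]; split => [|j]; [exact: cd_measurable|exact: Xfield_measurable]. Qed.

Lemma test1D phi psi : test1 phi -> test1 psi -> test1 (fun x => phi x + psi x)%R.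
Proof.
move=> tphi tpsi; have [c1 [k1 K1]] := tphi; have [c2 [k2 K2]] := tpsi.
split; first exact: cdD.
apply: (@compact_supportP R N Omega
  (closure [set x | phi x != 0%R] `|` closure [set x | psi x != 0%R])).
- exact: compactU.
- by rewrite subUset.
- move=> x; have [->|f1x] := eqVneq (phi x) 0%R.
    by rewrite add0r => f2x; right; apply: subset_closure.
  by move=> _; left; apply: subset_closure.
Qed.

Lemma test1Z (c : R) phi : test1 phi -> test1 (fun x => c * phi x)%R.
Proof.
move=> tphi; have [c1 [k1 K1]] := tphi; have [_ fK] := test_supp tphi.
split; first exact: cdZ.
apply: (compact_supportP k1 K1) => x.
by rewrite mulf_eq0 negb_or => /andP[_ /fK].
Qed.

Lemma test1B phi psi : test1 phi -> test1 psi -> test1 (fun x => phi x - psi x)%R.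
Proof.
move=> t1 /(test1Z (-1)) /(test1D t1); congr test1; apply/funext => x; ring.
Qed.

Lemma admissibleZ (c : R) G v : admissible G v ->
  admissible (fun j x => c * G j x)%R (fun x => c * v x)%R.
Proof.
move=> [mG mv Ev [phi_ [tphi Hphi cphi]]]; split.
- by move=> j; exact: measurable_funM.
- exact: measurable_funM.
- by rewrite pair_energyZ// lte_mul_pinfty ?lee_fin ?powR_ge0.
exists (fun n x => c * phi_ n x)%R; split.
- by move=> n; exact: test1Z.
- move=> e e0.
  have e'0 : (0 < e / (`|c| `^ p + 1))%R by rewrite divr_gt0// ltr_wpDl ?powR_ge0.
  have := Hphi _ e'0; apply: filterS => n Hn.
  have [mf mX] := test_measurable (tphi n); have [cf _] := tphi n.
  have -> : (fun j x => Xfield j (fun x => c * phi_ n x) x - c * G j x)%R =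
      (fun j x => c * (Xfield j (phi_ n) x - G j x))%R.
    by apply/funext => j; apply/funext => x; rewrite XfieldZ//; ring.
  have -> : (fun x => c * phi_ n x - c * v x)%R = (fun x => c * (phi_ n x - v x))%R.
    by apply/funext => x; ring.
  rewrite pair_energyZ; last 2 first.
  - by move=> j; exact: measurable_funB.
  - exact: measurable_funB.
  apply: le_trans (lee_wpmul2l _ Hn) _; first by rewrite lee_fin powR_ge0.
  rewrite -EFinM lee_fin mulrCA ler_piMr ?(ltW e0)// ler_pdivrMr ?ltr_wpDl ?powR_ge0//.
  by rewrite mul1r lerDl.
apply: filterS cphi => x cx; exact: (cvgM (cvg_cst _) cx).
Qed.

Lemma admissibleB G v phi : admissible G v -> test1 phi ->
  admissible (fun j x => Xfield j phi x - G j x)%R (fun x => phi x - v x)%R.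
Proof.
move=> [mG mv Ev [phi_ [tphi Hphi cphi]]] t1.
have [mf mX] := test_measurable t1; have [cf _] := t1.
split.
- by move=> j; exact: measurable_funB.
- exact: measurable_funB.
- have H := @pair_energyD 2^-1%R (fun j => Xfield j phi) (fun j x => -1 * G j x)%R
    phi (fun x => -1 * v x)%R.
  have -> : (fun j x => Xfield j phi x - G j x)%R = (fun j x => Xfield j phi x + -1 * G j x)%R.
    by apply/funext => j; apply/funext => x; ring.
  have -> : (fun x => phi x - v x)%R = (fun x => phi x + -1 * v x)%R.
    by apply/funext => x; ring.
  apply: le_lt_trans (H _ _ _ _ _ _) _ => //.
  + by rewrite invf_lt1// ltr1n.
  + by move=> j; exact: measurable_funM.
  + exact: measurable_funM.
  rewrite pair_energyZ// lte_add_pinfty// !lte_mul_pinfty ?lee_fin ?powR_ge0//.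
  exact: test_energy_lty.
exists (fun n x => phi x - phi_ n x)%R; split.
- by move=> n; exact: test1B.
- move=> e e0; have := Hphi _ e0; apply: filterS => n.
  have [cn _] := tphi n.
  rewrite pair_energyBC; congr (EP _ _ <= _).
    by apply/funext => j; apply/funext => x; rewrite XfieldB//; ring.
  by apply/funext => x; ring.
apply: filterS cphi => x cx; exact: (cvgB (cvg_cst _) cx).
Qed.

Lemma HW1_0_pint v : HW1_0 p Omega v ->
  [/\ measurable_fun setT v, pint mu p setT v < +oo,
     forall j, is_weak_X j v (weak_X j v) &
     forall j, measurable_fun setT (weak_X j v) /\ pint mu p setT (weak_X j v) < +oo].
Proof.
have L (g : V -> R) : g \in Lfun mu p%:E -> measurable_fun setT g /\ pint mu p setT g < +oo.
  move=> Lg; split.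
    by have /sub_Lfun_mfun := Lg; rewrite inE.
  have /integrableP[_] := Lfun_integrable p1' Lg; rewrite pintE.
  by under eq_integral do rewrite gee0_abs ?lee_fin ?powR_ge0//.
move=> [[/L[mv pv] Hj] _]; split => // j; have [ex /L[mX pX]] := Hj j => //.
exact: weak_XP.
Qed.

Lemma pint_off (F : V -> R) : measurable_fun setT F -> (forall x, ~ Omega x -> F x = 0%R) ->
  pint mu p setT F = pint mu p Omega F.
Proof.
move=> mF FO; rewrite !pintE [RHS]integral_mkcond; apply: eq_integral => x _.
rewrite patchE; case: ifPn => //; rewrite notin_setE => /FO ->.
by rewrite normr0 powR0// gt_eqF.
Qed.

(** Approximate v by test functions phi_n at the rate 2^-n in the local norms.  The seminorm
    estimate, applied to phi_n - phi_m, controls their nonlocal distance; letting m tend to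
    infinity, Fatou's lemma transfers the bound to phi_n - v. *)
Lemma HW1_0_admissible v : HW1_0 p Omega v -> admissible (fun j => weak_X j v) v.
Proof.
move=> Hv; have [mv pv wv] := HW1_0_pint Hv; have [_ v_off] := Hv.
set g := fun j => weak_X j v in wv *.
move=> gp; have mg j : measurable_fun setT (g j) by have [] := gp j.
(* a representative that vanishes everywhere outside Omega *)
pose v' := v \_ Omega.
have vv' : {ae mu, forall x, v' x = v x}.
  apply: filterS v_off => x Hx; rewrite /v' patchE; case: ifPn => //.
  by rewrite notin_setE => /Hx ->.
have mv' : measurable_fun setT v'.
  by apply/(measurable_restrictT _ mO); exact: measurable_funTS.
have pv' : pint mu p setT v' < +oo.
  by rewrite (@pint_ae_eq _ _ _ mu p setT v' v)//; apply: filterS vv' => x -> _.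
have wv' j : is_weak_X j v' (g j).
  have [lg H] := wv j; split => // phi tphi; rewrite -H//.
  have mX : measurable_fun setT (Xfield j phi).
    by apply: Xfield_measurable; case: tphi => + _; apply.
  apply: ae_eq_integral => //; [| |apply: filterS vv' => x /= -> _ //].
    by apply/measurable_EFinP; exact: measurable_funM.
  by apply/measurable_EFinP; exact: measurable_funM.
have v'O x : ~ Omega x -> v' x = 0%R.
  by move=> nO; rewrite /v' patchE; case: ifPn => //; rewrite inE => /nO.
have h2 n : (0 < 2^-1 ^+ n :> R)%R by rewrite exprn_gt0// invr_gt0.
have /choice[phi_ Hphi] n := density p1' oO bO sO mv' pv' v'O wv' (fun j => (gp j).2) (h2 n).
have tphi n : test1 (phi_ n) by have [] := Hphi n.
have mphi n : measurable_fun setT (phi_ n) by have [] := test_measurable (tphi n).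
have mX n j : measurable_fun setT (Xfield j (phi_ n)) by have [] := test_measurable (tphi n).
have K0 := pK_gt0 p.
have K0' : 0 <= (pK p)%:E by rewrite lee_fin ltW.
have cphi : {ae mu, forall x, phi_ n x @[n --> \oo] --> v x}.
  have H := @pint_cvg_ae _ _ _ mu p 1%R (fun n x => phi_ n x - v' x)%R p0 ler01.
  have {}H : {ae mu, forall x, (phi_ n x - v' x)%R @[n --> \oo] --> (0 : R)%R}.
    apply: H => n; first exact: measurable_funB.
    by rewrite mul1r; have [] := Hphi n.
  apply: filterS2 H vv' => x cx <-.
  have -> : (fun n => phi_ n x) = (fun n => (phi_ n x - v' x) + v' x)%R.
    by apply/funext => n; rewrite subrK.
  by rewrite -[X in _ --> X]add0r; exact: (cvgD cx (cvg_cst _)).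
have [C1 C10 HC1] := gagliardo_bound p1 s0 s1 N0.
have [C2 C20 HC2] := @pint_sum_le _ _ _ mu p p1' Omega _ (index_enum 'I_(N + N)) mO.
have half n m : (n <= m)%N -> (2^-1 ^+ m <= 2^-1 ^+ n :> R)%R.
  by move=> nm; rewrite ler_wiXn2l// invf_le1// ler1n.
have dphi n m : (n <= m)%N ->
    pint mu p setT (fun x => phi_ n x - phi_ m x)%R <= (pK p * 2 * 2^-1 ^+ n)%:E.
  move=> nm; apply: le_trans (@pintB _ _ _ mu p p1' _ _ _ v' measurableT _ _ _) _ => //.
  have [_ _ a _] := Hphi n; have [_ _ b _] := Hphi m.
  rewrite pintBC in b; apply: le_trans (lee_wpmul2l K0' (leeD a b)) _.
  by rewrite -EFinD -EFinM lee_fin -mulrA ler_wpM2l ?(ltW K0)//; have := half _ _ nm; lra.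
have dX n m j : (n <= m)%N ->
    pint mu p Omega (fun x => Xfield j (phi_ n) x - Xfield j (phi_ m) x)%R <=
    (pK p * 2 * 2^-1 ^+ n)%:E.
  move=> nm; apply: le_trans (@pintB _ _ _ mu p p1' _ _ _ (g j) mO _ _ _) _ => //;
    try exact: measurable_funTS.
  have [_ _ _ /(_ j) a] := Hphi n; have [_ _ _ /(_ j) b] := Hphi m.
  rewrite pintBC in b; apply: le_trans (lee_wpmul2l K0' (leeD a b)) _.
  by rewrite -EFinD -EFinM lee_fin -mulrA ler_wpM2l ?(ltW K0)//; have := half _ _ nm; lra.
pose C3 : R := (C1 * (pK p * 2 + C2 * ((pK p * 2) *+ (N + N))))%R.
have dgag n m : (n <= m)%N ->
    pint (mu \x mu) p setT (gag s p (fun x => phi_ n x - phi_ m x)%R) <= (C3 * 2^-1 ^+ n)%:E.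
  move=> nm; rewrite -int_dmu_gag//.
  have tnm := test1B (tphi n) (tphi m); have [c12 s12] := tnm.
  apply: le_trans (HC1 _ _ c12 s12) _.
  rewrite (@pint_off (hgrad1 _)); last 2 first.
  - by apply: continuous_measurable_rV; exact: continuous_hgrad1.
  - move=> x nO; apply/eqP; apply: contra_notT nO => /(hgrad1_supp tnm).
    by have [_] := s12; apply.
  have hb : pint mu p Omega (hgrad1 (fun x => phi_ n x - phi_ m x)%R) <=
      (C2 * ((pK p * 2) *+ (N + N)) * 2^-1 ^+ n)%:E.
    have mXnm j : measurable_fun Omega (Xfield j (fun x => phi_ n x - phi_ m x)%R).
      by apply: measurable_funTS; exact: Xfield_measurable.
    apply: le_trans (HC2 (fun j x => `|Xfield j (fun x => phi_ n x - phi_ m x)%R x|%R) _) _.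
      by move=> j; exact: measurableT_comp (@normr_measurable _ _) (mXnm j).
    rewrite -mulrA EFinM lee_pmul2l//.
    apply: (@le_trans _ _ (\sum_(j < N + N) (pK p * 2 * 2^-1 ^+ n)%:E)); last first.
      by rewrite sumEFin sumr_const card_ord lee_fin mulrnAl.
    apply: lee_sum => j _; apply: le_trans (dX n m j nm).
    rewrite !pintE le_eqVlt; apply/orP; left; apply/eqP; apply: eq_integral => x _.
    by rewrite normr_id XfieldB//; [case: (tphi n)|case: (tphi m)].
  apply: le_trans (lee_wpmul2l _ (leeD (dphi n m nm) hb)) _; first by rewrite lee_fin ltW.
  by rewrite -EFinD -EFinM lee_fin /C3 -mulrDl mulrA.
have gagn n : pint (mu \x mu) p setT (gag s p (fun x => phi_ n x - v x)%R) <=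
    (C3 * 2^-1 ^+ n)%:E.
  apply: (@pint_fatou _ _ _ _ p _ setT (fun m => gag s p (fun x => phi_ n x - phi_ m x)%R)) => //.
  - by move=> m; apply: measurable_gag; exact: measurable_funB.
  - by apply: measurable_gag; exact: measurable_funB.
  - apply: filterS2 (ae_prod_fst mu cphi) (ae_prod_snd mu cphi) => z c1 c2 _; rewrite /gag.
    apply: cvgM; last exact: cvg_cst.
    by apply: cvgB; apply: cvgB => //; exact: cvg_cst.
  - by exists n => // m /= nm; exact: dgag.
have gradn n : pint mu p Omega (fun x => enorm (fun j => Xfield j (phi_ n) x - g j x)%R) <=
    (C2 * (1 *+ (N + N)) * 2^-1 ^+ n)%:E.
  have mXg j : measurable_fun Omega (fun x => Xfield j (phi_ n) x - g j x)%R.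
    by apply: measurable_funTS; exact: measurable_funB.
  have mXgn j : measurable_fun Omega (fun x => `|Xfield j (phi_ n) x - g j x|)%R.
    exact: measurableT_comp (@normr_measurable _ _) (mXg j).
  apply: (@le_trans _ _ (pint mu p Omega (fun x => \sum_j `|Xfield j (phi_ n) x - g j x|)%R)).
    apply: pint_le => //; first exact: measurable_enorm.
      exact: measurable_sum.
    move=> x _; rewrite ger0_norm ?enorm_ge0// ger0_norm ?sumr_ge0//.
    exact: enorm_le_sum.
  apply: le_trans (HC2 _ mXgn) _.
  rewrite -mulrA EFinM lee_pmul2l//.
  apply: (@le_trans _ _ (\sum_(j < N + N) (2^-1 ^+ n)%:E)); last first.
    by rewrite sumEFin sumr_const card_ord lee_fin mulrnAl mul1r.
  apply: lee_sum => j _; have [_ _ _ /(_ j)] := Hphi n; apply: le_trans.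
  rewrite !pintE le_eqVlt; apply/orP; left; apply/eqP; apply: eq_integral => x _.
  by rewrite normr_id.
pose C4 : R := (C2 * (1 *+ (N + N)) + alpha * C3)%R.
have En n : EP (fun j x => Xfield j (phi_ n) x - g j x)%R (fun x => phi_ n x - v x)%R <=
    (C4 * 2^-1 ^+ n)%:E.
  rewrite pair_energyE; have a0 : 0 <= alpha%:E by rewrite lee_fin ltW.
  apply: le_trans (leeD (gradn n) (lee_wpmul2l a0 (gagn n))) _.
  by rewrite -EFinM -EFinD lee_fin /C4 mulrDl mulrA.
have C40 : (0 <= C4)%R.
  have := le_trans (pair_energy_ge0 _ _) (En 0%N); rewrite lee_fin expr0 mulr1.
  exact.
split => //.
  have -> : g = (fun j x => Xfield j (phi_ 0%N) x + -1 * (Xfield j (phi_ 0%N) x - g j x))%R.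
    by apply/funext => j; apply/funext => x; ring.
  have -> : v = (fun x => phi_ 0%N x + -1 * (phi_ 0%N x - v x))%R.
    by apply/funext => x; ring.
  have H := @pair_energyD 2^-1%R (fun j => Xfield j (phi_ 0%N))
    (fun j x => -1 * (Xfield j (phi_ 0%N) x - g j x))%R
    (phi_ 0%N) (fun x => -1 * (phi_ 0%N x - v x))%R.
  apply: le_lt_trans (H _ _ _ _ _ _) _ => //.
  - by rewrite invf_lt1// ltr1n.
  - by move=> j; apply: measurable_funM => //; exact: measurable_funB.
  - by apply: measurable_funM => //; exact: measurable_funB.
  rewrite pair_energyZ; last 2 first.
  - by move=> j; exact: measurable_funB.
  - exact: measurable_funB.
  rewrite lte_add_pinfty// !lte_mul_pinfty ?lee_fin ?powR_ge0//.
    exact: test_energy_lty.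
  exact: le_lt_trans (En 0%N) (ltry _).
exists phi_; split => // e e0.
have : (C4 * 2^-1 ^+ n)%R @[n --> \oo] --> (0 : R)%R.
  rewrite -[X in _ --> X](mulr0 C4); apply: cvgM; first exact: cvg_cst.
  by apply: cvg_expr; rewrite ger0_norm ?invr_ge0// invf_lt1// ltr1n.
move=> /cvgrPdist_le /(_ _ e0); apply: filterS => n; rewrite sub0r normrN => H.
apply: le_trans (En n) _; rewrite lee_fin; exact: le_trans (ler_norm _) H.
Qed.

End admissible_pairs.

(** * Smoothed absolute values of test functions *)

Section smooth_absolute_value.
Context {R : realType}.
Variables (e : R) (e0 : 0 < e).

(** Smooth replacement of |t| by sqrt (t^2 + e^2); after subtracting e it vanishes at 0, so
    that it preserves compact supports. *)
Definition sabs (t : R) : R := Num.sqrt (t ^+ 2 + e ^+ 2).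

Lemma sabs_gt0 t : 0 < sabs t.
Proof. by rewrite sqrtr_gt0 ltr_wpDl ?sqr_ge0// exprn_gt0. Qed.

Lemma sabs_sqr t : sabs t ^+ 2 = t ^+ 2 + e ^+ 2.
Proof. by rewrite sqr_sqrtr// addr_ge0 ?sqr_ge0. Qed.

Lemma sabs0 : sabs 0 = e.
Proof. by rewrite /sabs expr0n add0r sqrtr_sqr gtr0_norm. Qed.

Lemma le_norm_sabs t : `|t| <= sabs t.
Proof. by rewrite -sqrtr_sqr ler_wsqrtr// lerDl sqr_ge0. Qed.

Lemma sabs_ge t : e <= sabs t.
Proof. by rewrite -[leLHS]gtr0_norm// -sqrtr_sqr ler_wsqrtr// lerDr sqr_ge0. Qed.

Lemma sabs_le t : sabs t <= `|t| + e.
Proof.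
rewrite -(@ler_pXn2r _ 2)// ?nnegrE ?addr_ge0 ?(ltW e0) ?(ltW (sabs_gt0 _))//.
by rewrite sabs_sqr sqrrD real_normK ?num_real// lerD2r lerDl mulrn_wge0// mulr_ge0// (ltW e0).
Qed.

Lemma sabs_lip a b : `|sabs a - sabs b| <= `|a - b|.
Proof.
have s0 : 0 < sabs a + sabs b by rewrite addr_gt0 ?sabs_gt0.
rewrite -(ler_pM2r s0) -{1}(gtr0_norm s0) -normrM -subr_sqr !sabs_sqr.
rewrite (_ : _ - _ = (a - b) * (a + b)); last by ring.
rewrite normrM; apply: ler_wpM2l => //; apply: le_trans (ler_normD _ _) _.
by apply: lerD; exact: le_norm_sabs.
Qed.

Lemma is_derive_sabs t : is_derive t (1 : R) sabs (t / sabs t).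
Proof.
have s0 : 0 < t ^+ 2 + e ^+ 2 by rewrite ltr_wpDl ?sqr_ge0// exprn_gt0.
have H1 := is_derive1_sqrt s0.
have H2 : is_derive t (1 : R) (fun t : R => t ^+ 2 + e ^+ 2) (2 * t).
  have E1 : is_derive t (1 : R) (fun t : R => t ^+ 2) (2 * t).
    apply: DeriveDef; first exact: exprn_derivable.
    by rewrite exp_derive expr1 /GRing.scale /= mulr1.
  have := is_deriveD E1 (is_derive_cst (e ^+ 2) t (1 : R)).
  by rewrite addr0.
have := @is_derive1_comp R Num.sqrt (fun t : R => t ^+ 2 + e ^+ 2) t _ _ H1 H2; rewrite (_ : _ * _ = t / sabs t)//.
rewrite /sabs; field; by rewrite gt_eqF ?sqrtr_gt0.
Qed.

Lemma derive_sabs t : derivable (fun t => sabs t - e) t (1 : R) /\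
  'D_1 (fun t => sabs t - e) t = t / sabs t.
Proof.
have H : is_derive t (1 : R) (fun t => sabs t - e) (t / sabs t - 0).
  by apply: is_deriveB; exact: is_derive_sabs.
by split; [exact: ex_derive|rewrite (derive_val (is_derive := H)) subr0].
Qed.

Lemma continuous_sabs : continuous sabs.
Proof.
move=> t; apply: differentiable_continuous; apply/derivable1_diffP.
by have H := is_derive_sabs t; exact: ex_derive.
Qed.

Lemma sabs_quot t : `|t / sabs t| <= 1.
Proof.
rewrite normrM normfV (gtr0_norm (sabs_gt0 t)) ler_pdivrMr ?sabs_gt0// mul1r.
exact: le_norm_sabs.
Qed.

End smooth_absolute_value.

Section test_absolute_value.
Context {R : realType} {N : nat}.
Local Notation V := 'rV[R]_(N + N + 1).
Implicit Types (phi : V -> R) (Omega : set V).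

Lemma cd_sabs (e : R) phi : 0 < e -> cd 1 phi -> cd 1 (fun x => sabs e (phi x) - e).
Proof.
move=> e0 cphi; have cf := cd_continuous cphi.
have cS : continuous (fun x => sabs e (phi x)).
  move=> x; apply: (@continuous_comp _ _ _ phi (sabs e)); first exact: cf.
  exact: continuous_sabs.
split; first by apply: ctsB => //; exact: cts_cst.
move=> i; have [_ /(_ i)[dphi [cpi _]]] := cphi.
have H x : derivable (fun x => sabs e (phi x) - e) x (delta_mx ord0 i : V) /\
    partial i (fun x => sabs e (phi x) - e) x = phi x / sabs e (phi x) * partial i phi x.
  have [d1 d2] := derive_sabs e0 (phi x).
  have := @partial_comp1 R _ (fun t => sabs e t - e) phi i x (dphi x) d1.
  by rewrite d2.
split; first by move=> x; have [] := H x.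
split => //; rewrite (_ : partial i _ = fun x => phi x / sabs e (phi x) * partial i phi x).
  apply: ctsM => //; apply: ctsM => // x.
  have nz : sabs e (phi x) != 0 by rewrite gt_eqF// sabs_gt0.
  exact: (cvgV nz (cS x)).
by apply/funext => x; have [] := H x.
Qed.

Lemma Xfield_sabs (e : R) phi j x : 0 < e -> cd 1 phi ->
  `|Xfield j (fun x => sabs e (phi x) - e) x| <= `|Xfield j phi x|.
Proof.
move=> e0 cphi; have [d1 d2] := derive_sabs e0 (phi x).
have := @Xfield_comp1 R N (fun t => sabs e t - e) j phi x cphi (cd_sabs e0 cphi) d1.
rewrite d2 => ->.
by rewrite normrM ler_piMl// sabs_quot.
Qed.

Lemma test1_sabs (e : R) Omega phi : 0 < e -> test1 Omega phi ->
  test1 Omega (fun x => sabs e (phi x) - e).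
Proof.
move=> e0 tphi; have [c1 [cK KO]] := tphi; have [_ fK] := test_supp tphi.
split; first exact: cd_sabs.
apply: (compact_supportP cK KO) => x; have [->|/fK//] := eqVneq (phi x) 0.
by rewrite sabs0// subrr eqxx.
Qed.

End test_absolute_value.

(** * Young's inequality for the p-Laplacian pairing *)

Section young_pairing.
Context d (T : measurableType d) (R : realType) (m : {measure set T -> \bar R}).
Variables (p : R) (D : set T).
Hypotheses (p1 : 1 < p) (mD : measurable D).
Implicit Types (g h a : T -> R).
Let p1' : 1 <= p. Proof. exact: ltW. Qed.
Let p0 : 0 < p. Proof. exact: lt_le_trans ltr01 p1'. Qed.

Lemma integral_Rintegral a : m.-integrable D (EFin \o a) ->
  (\int[m]_(x in D) (a x)%:E = (\int[m]_(x in D) a x)%:E)%E.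
Proof. by move=> ia; rewrite /Rintegral fineK//; exact: integrable_fin_num. Qed.

Lemma pint_Rintegral g : measurable_fun D g -> (pint m p D g < +oo)%E ->
  pint m p D g = (\int[m]_(x in D) (`|g x| `^ p))%:E.
Proof. by move=> mg pg; rewrite -integral_Rintegral ?pintE//; exact: pint_integrable. Qed.

Lemma integrableEZ (c : R) a : m.-integrable D (EFin \o a) ->
  m.-integrable D (EFin \o (fun x => c * a x)).
Proof.
move=> ia; rewrite (_ : _ \o _ = fun x => (c%:E * (a x)%:E)%E)//; exact: integrableZl.
Qed.

Lemma integrableED a h : m.-integrable D (EFin \o a) -> m.-integrable D (EFin \o h) ->
  m.-integrable D (EFin \o (fun x => a x + h x)).
Proof.
move=> ia ih; rewrite (_ : _ \o _ = fun x => ((a x)%:E + (h x)%:E)%E)//; exact: integrableD.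
Qed.

Lemma integrableEB a h : m.-integrable D (EFin \o a) -> m.-integrable D (EFin \o h) ->
  m.-integrable D (EFin \o (fun x => a x - h x)).
Proof.
move=> ia ih; rewrite (_ : _ \o _ = fun x => ((a x)%:E - (h x)%:E)%E)//; exact: integrableB.
Qed.

Lemma young_upper g h a : measurable_fun D g -> measurable_fun D h -> measurable_fun D a ->
  (forall x, D x -> `|a x| <= `|g x| `^ (p - 1) * `|h x|) ->
  (pint m p D g < +oo)%E -> (pint m p D h < +oo)%E ->
  \int[m]_(x in D) a x <=
  (1 - p^-1) * fine (pint m p D g) + p^-1 * fine (pint m p D h).
Proof.
move=> mg mh ma aD pg ph.
have ig := pint_integrable mD mg pg; have ih := pint_integrable mD mh ph.
have ia := young_integrable p1' mD mg mh ma aD pg ph.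
rewrite (pint_Rintegral mg pg) (pint_Rintegral mh ph) /=.
have i1 : m.-integrable D (EFin \o (fun x => (1 - p^-1) * `|g x| `^ p)).
  exact: integrableEZ.
have i2 : m.-integrable D (EFin \o (fun x => p^-1 * `|h x| `^ p)).
  exact: integrableEZ.
rewrite -!RintegralZl// -RintegralD//; apply: le_Rintegral => //.
  exact: integrableED.
move=> x Dx; apply: le_trans (ler_norm _) _; apply: le_trans (aD _ Dx) _.
exact: young_powR.
Qed.

(** Young's inequality for h replaced by t h: dividing by a large t, the defect of testing
    with g itself is small whenever h is small compared to t. *)
Lemma young_lower (t : R) g h a : 0 < t ->
  measurable_fun D g -> measurable_fun D h -> measurable_fun D a ->
  (forall x, D x -> `|a x - `|g x| `^ p| <= `|g x| `^ (p - 1) * `|h x|) ->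
  (pint m p D g < +oo)%E -> (pint m p D h < +oo)%E -> m.-integrable D (EFin \o a) ->
  t * (fine (pint m p D g) - \int[m]_(x in D) a x) <=
  (1 - p^-1) * fine (pint m p D g) + p^-1 * (t `^ p * fine (pint m p D h)).
Proof.
move=> t0 mg mh ma aD pg ph ia.
have ig := pint_integrable mD mg pg.
have mgp : measurable_fun D (fun x => `|g x| `^ p) by exact: measurable_powR_norm.
have pth : (pint m p D (fun x => t * h x)%R < +oo)%E.
  by rewrite pintZ// lte_mul_pinfty ?lee_fin ?powR_ge0.
have := @young_upper g (fun x => t * h x) (fun x => t * (`|g x| `^ p - a x)) mg _ _ _ pg pth.
rewrite pintZ// fineM//; last by rewrite ge0_fin_numE ?pint_ge0.
rewrite (gtr0_norm t0) RintegralZl//; last first.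
  exact: integrableEB.
rewrite RintegralB// (pint_Rintegral mg pg); apply.
- exact: measurable_funM.
- by apply: measurable_funM => //; exact: measurable_funB.
- move=> x Dx; rewrite !normrM (gtr0_norm t0) mulrCA ler_wpM2l ?(ltW t0)//.
  by rewrite distrC; exact: aD.
Qed.

End young_pairing.

Section Jp_algebra.
Context {R : realType}.
Variables (p : R) (p1 : 1 < p).
Let p0 : 0 < p. Proof. exact: lt_trans ltr01 p1. Qed.

Lemma powR_shift (a : R) : 0 <= a -> a `^ (p - 2) * a = a `^ (p - 1).
Proof.
move=> a0; rewrite mulrC -(@mulr_powRB1 R a (p - 1))// ?subr_gt0//.
by congr (_ * _ `^ _); ring.
Qed.

Lemma Jp_norm (t : R) : `|Jp p t| = `|t| `^ (p - 1).
Proof. by rewrite /Jp normrM ger0_norm ?powR_ge0// powR_shift. Qed.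

Lemma Jp_id (t : R) : Jp p t * t = `|t| `^ p.
Proof.
rewrite /Jp -mulrA -expr2 -[t ^+ 2]real_normK ?num_real// expr2 mulrA powR_shift//.
by rewrite mulrC mulr_powRB1.
Qed.

(** Distributes the weight of the double integral over the two factors of the pairing. *)
Lemma Jp_scale (c d r : R) : 0 <= r -> Jp p c * d * r `^ p = Jp p (c * r) * (d * r).
Proof.
move=> r0; rewrite /Jp normrM (ger0_norm r0) powRM//.
have -> : r `^ p = r `^ (p - 2) * r * r by rewrite powR_shift// mulrC mulr_powRB1.
ring.
Qed.

End Jp_algebra.

Lemma young_balance (R : realType) (c al RA RB r1 r2 r3 r4 : R) :
  RA <= (1 - c) * r1 + c * r2 ->
  RA + al * RB + al * ((1 - c) * r3 + c * r4 - RB) <=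
  (1 - c) * (r1 + al * r3) + c * (r2 + al * r4).
Proof. by move=> H; lra. Qed.

Lemma lower_balance (R : realType) (t c al RA RB r1 r2 r3 r4 k : R) :
  t * (r1 - RA) + al * (t * (r3 - RB)) <=
  (1 - c) * r1 + c * (k * r2) + al * ((1 - c) * r3 + c * (k * r4)) ->
  t * (r1 + al * r3 - (RA + al * RB)) <=
  (1 - c) * (r1 + al * r3) + c * (k * (r2 + al * r4)).
Proof. by move=> H; lra. Qed.

Lemma energy_balance (R : realType) (t E X k i j tau : R) :
  t * (E - X) <= k -> t * j <= k -> 2 * k <= t * tau -> t * X <= t * (i + j) ->
  t * E <= t * (i + tau).
Proof. rewrite mulrBr !mulrDr; lra. Qed.

(** * Inequalities satisfied by a weak solution *)

Section weak_formulation.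
Context {R : realType} {N : nat}.
Local Notation V := 'rV[R]_(N + N + 1).
Local Notation mu := (@mu_heis R N).
Local Open Scope ereal_scope.
Implicit Types (v w phi psi : V -> R) (G : 'I_(N + N) -> V -> R).
Variables (Omega : set V) (p s alpha : R).
Hypotheses (p1 : (1 < p)%R) (s0 : (0 < s)%R) (s1 : (s < 1)%R) (alpha0 : (0 < alpha)%R).
Hypotheses (N0 : (0 < N)%N) (oO : open Omega).
Let mO : measurable Omega. Proof. exact: open_measurable_rV. Qed.
Let p1' : (1 <= p)%R. Proof. exact: ltW. Qed.
Let p0 : (0 < p)%R. Proof. exact: lt_le_trans ltr01 p1'. Qed.
Local Notation EP := (pair_energy Omega p s alpha).
Local Notation nu := (mu \x mu).
Local Notation test := (test1 Omega).

Lemma pair_energy_lty G v : EP G v < +oo ->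
  pint mu p Omega (fun x => enorm (fun j => G j x)) < +oo /\ pint nu p setT (gag s p v) < +oo.
Proof.
rewrite pair_energyE => H; split.
  apply: le_lt_trans H; rewrite leeDl// mule_ge0 ?pint_ge0// lee_fin ltW//.
have : alpha%:E * pint nu p setT (gag s p v) < +oo.
  by apply: le_lt_trans H; rewrite leeDr// pint_ge0.
move=> H'; rewrite ltNge leye_eq; apply/negP => /eqP E.
by move: H'; rewrite E gt0_muley.
Qed.

Lemma fine_pair_energy G v : EP G v < +oo ->
  fine (EP G v) = (fine (pint mu p Omega (fun x => enorm (fun j => G j x))) +
    alpha * fine (pint nu p setT (gag s p v)))%R.
Proof.
move=> H; have [H1 H2] := pair_energy_lty H.
rewrite pair_energyE fineD ?fineM//= ?fin_numM// ge0_fin_numE ?pint_ge0//.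
Qed.

Variables (u q : V -> R) (g : 'I_(N + N) -> V -> R).
Hypotheses (mq : measurable_fun setT q) (q0 : forall x, (0 <= q x)%R).
Hypothesis admU : admissible Omega p s alpha g u.
Let gU x := enorm (fun j => g j x).
Let A phi x := (gU x `^ (p - 2) * \sum_j g j x * Xfield j phi x)%R.
Let B phi z := (Jp p (gag s p u z) * gag s p phi z)%R.
Hypothesis WF : forall phi, test phi ->
  \int[mu]_(x in Omega) (A phi x)%:E +
  alpha%:E * int_dmu s p (fun z => Jp p (u z.1 - u z.2) * (phi z.1 - phi z.2))%R =
  \int[mu]_(x in Omega) (q x * phi x)%:E.

Let mg j : measurable_fun setT (g j). Proof. by case: admU. Qed.
Let mu' : measurable_fun setT u. Proof. by case: admU. Qed.
Let Elty : EP g u < +oo. Proof. by case: admU. Qed.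
Let mgU : measurable_fun Omega gU.
Proof. by apply: measurable_funTS; exact: measurable_enorm. Qed.
Let mgag : measurable_fun setT (gag s p u). Proof. exact: measurable_gag. Qed.
Let E0 := fine (EP g u).

Let mA phi : test phi -> measurable_fun Omega (A phi).
Proof.
move=> /test_measurable[_ mX]; apply: measurable_funM.
  apply: (@measurableT_comp _ _ _ _ _ _ (fun t : R => t `^ (p - 2))%R) => //.
by apply: measurable_sum => j; apply: measurable_funTS; exact: measurable_funM.
Qed.

Let mB phi : measurable_fun setT phi -> measurable_fun setT (B phi).
Proof.
move=> mphi; apply: measurable_funM; last exact: measurable_gag.
apply: measurable_funM => //.
apply: (@measurableT_comp _ _ _ _ _ _ (fun t : R => t `^ (p - 2))%R) => //.
exact: measurableT_comp (@normr_measurable _ _) mgag.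
Qed.

Lemma pairing_le (a b : 'I_(N + N) -> R) :
  (`|enorm a `^ (p - 2) * \sum_j a j * b j| <= `|enorm a| `^ (p - 1) * `|enorm b|)%R.
Proof.
rewrite normrM ger0_norm ?powR_ge0// (ger0_norm (enorm_ge0 a)) (ger0_norm (enorm_ge0 b)).
rewrite -powR_shift ?enorm_ge0// -mulrA ler_wpM2l ?powR_ge0//.
exact: cauchy_schwarz.
Qed.

Let A_le phi x : (`|A phi x| <= `|gU x| `^ (p - 1) * `|enorm (fun j => Xfield j phi x)|)%R.
Proof. exact: pairing_le. Qed.

Let B_le phi z : (`|B phi z| <= `|gag s p u z| `^ (p - 1) * `|gag s p phi z|)%R.
Proof. by rewrite /B normrM Jp_norm. Qed.

Let int_dmuB phi : int_dmu s p (fun z => Jp p (u z.1 - u z.2) * (phi z.1 - phi z.2))%R =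
  \int[nu]_z (B phi z)%:E.
Proof.
apply: eq_integral => z _; congr (_%:E).
rewrite /B /gag -Jp_scale ?powR_ge0// -powRrM mulNr mulVf ?gt_eqF// powR_inv1// powR_ge0//.
Qed.

Let AB phi (tphi : test phi) :
  [/\ mu.-integrable Omega (EFin \o A phi), nu.-integrable setT (EFin \o B phi) &
   \int[mu]_(x in Omega) (q x * phi x)%:E =
   (\int[mu]_(x in Omega) A phi x + alpha * \int[nu]_z B phi z)%R%:E].
Proof.
have [mphi mX] := test_measurable tphi.
have [h1 h2] := pair_energy_lty (test_energy_lty p1 s0 s1 alpha0 N0 oO tphi).
have [u1 u2] := pair_energy_lty Elty.
have mE : measurable_fun Omega (fun x => enorm (fun j => Xfield j phi x)).
  by apply: measurable_funTS; exact: measurable_enorm.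
have iA : mu.-integrable Omega (EFin \o A phi).
  exact: (young_integrable p1' mO mgU mE (mA tphi) (fun x _ => A_le phi x) u1 h1).
have iB : nu.-integrable setT (EFin \o B phi).
  exact: (young_integrable p1' measurableT mgag (measurable_gag s p mphi) (mB mphi)
    (fun z _ => B_le phi z) u2 h2).
split => //.
rewrite -WF// int_dmuB integral_Rintegral// integral_Rintegral//.
Qed.

(** Remainder of Young's inequality for the pairing of |U|^(p-2) U with an increment W that
    is dominated by V'; in the proof W is an increment of |v| and V' the one of v. *)
Definition young_gap (V' W : R) (U : R) : R :=
  ((1 - p^-1) * `|U| `^ p + p^-1 * `|V'| `^ p - Jp p U * W)%R.

Lemma young_gap_ge0 V' W U : (`|W| <= `|V'|)%R -> (0 <= young_gap V' W U)%R.
Proof.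
move=> WV; rewrite subr_ge0; apply: le_trans (ler_norm _) _; rewrite normrM Jp_norm//.
apply: le_trans (young_powR p1' (normr_ge0 U) (normr_ge0 V')).
by rewrite ler_wpM2l// powR_ge0.
Qed.

(** Young's inequality in the local term, and as an identity with remainder in the nonlocal
    one. *)
Lemma test_inequality phi psi : test phi -> test psi ->
  (forall j x, `|Xfield j psi x| <= `|Xfield j phi x|)%R ->
  (forall x y, `|psi x - psi y| <= `|phi x - phi y|)%R ->
  \int[mu]_(x in Omega) (q x * psi x)%:E +
  \int[nu]_z (alpha * young_gap (gag s p phi z) (gag s p psi z) (gag s p u z))%:E <=
  ((1 - p^-1) * E0)%:E + p^-1%:E * EP (fun j => Xfield j phi) phi.
Proof.
move=> tphi tpsi Xle dle.
have [mphi mX] := test_measurable tphi; have [mpsi mXp] := test_measurable tpsi.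
have Ephi := test_energy_lty p1 s0 s1 alpha0 N0 oO tphi.
have [h1 h2] := pair_energy_lty Ephi; have [u1 u2] := pair_energy_lty Elty.
have [iA iB ->] := AB tpsi.
have iU := pint_integrable measurableT mgag u2.
have iF := pint_integrable measurableT (measurable_gag s p mphi) h2.
have j1 : nu.-integrable setT (EFin \o (fun z => (1 - p^-1) * `|gag s p u z| `^ p)%R).
  exact: (integrableEZ measurableT (1 - p^-1) iU).
have j2 : nu.-integrable setT (EFin \o (fun z => p^-1 * `|gag s p phi z| `^ p)%R).
  exact: (integrableEZ measurableT p^-1 iF).
have j12 : nu.-integrable setT (EFin \o
    (fun z => (1 - p^-1) * `|gag s p u z| `^ p + p^-1 * `|gag s p phi z| `^ p)%R).
  exact: (integrableED measurableT j1 j2).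
have jg : nu.-integrable setT (EFin \o
    (fun z => young_gap (gag s p phi z) (gag s p psi z) (gag s p u z))).
  exact: (integrableEB measurableT j12 iB).
have jag : nu.-integrable setT (EFin \o
    (fun z => alpha * young_gap (gag s p phi z) (gag s p psi z) (gag s p u z))%R).
  exact: (integrableEZ measurableT alpha jg).
rewrite (integral_Rintegral measurableT jag) RintegralZl// RintegralB// RintegralD// !RintegralZl//.
have EphiE : EP (fun j => Xfield j phi) phi = (fine (EP (fun j => Xfield j phi) phi))%:E.
  by rewrite fineK// ge0_fin_numE// pair_energy_ge0.
rewrite EphiE -EFinM -!EFinD lee_fin fine_pair_energy// /E0 fine_pair_energy//.
rewrite (pint_Rintegral measurableT mgag u2).
rewrite (pint_Rintegral measurableT (measurable_gag s p mphi) h2) /=.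
have mE : measurable_fun Omega (fun x => enorm (fun j => Xfield j phi x)).
  by apply: measurable_funTS; exact: measurable_enorm.
have HA : (\int[mu]_(x in Omega) A psi x <=
  (1 - p^-1) * fine (pint mu p Omega gU) +
  p^-1 * fine (pint mu p Omega (fun x => enorm (fun j => Xfield j phi x))))%R.
  apply: (young_upper p1 mO mgU mE (mA tpsi) _ u1 h1) => x _.
  apply: le_trans (A_le psi x) _; rewrite ler_wpM2l ?powR_ge0//.
  by rewrite ger0_norm ?enorm_ge0// ger0_norm ?enorm_ge0//; apply: enorm_le => j.
exact: young_balance HA.
Qed.

Lemma ereal_split (a b : \bar R) (c : R) : 0 <= a -> 0 <= b -> c%:E < a + b ->
  exists x y : R, [/\ x%:E < a, y%:E < b & (c < x + y)%R].
Proof.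
case: a => [a||]// _; case: b => [b||]// _.
- rewrite -EFinD lte_fin => cab; exists (a - (a + b - c) / 3)%R, (b - (a + b - c) / 3)%R.
  by rewrite !lte_fin; split; lra.
- move=> _; exists (a - 1)%R, (c - a + 2)%R; rewrite lte_fin ltry; split => //; lra.
- move=> _; exists (c - b + 2)%R, (b - 1)%R; rewrite lte_fin ltry; split => //; lra.
- by move=> _; exists c, 1%R; rewrite !ltry; split => //; lra.
Qed.

(** Quasi-convexity of the energy with a constant close to 1 in front of the limit. *)
Lemma limsup_energy G v (phi_ : nat -> V -> R) (t : R) :
  (forall j, measurable_fun setT (G j)) -> measurable_fun setT v -> EP G v < +oo ->
  (forall n, test (phi_ n)) ->
  (forall e : R, (0 < e)%R -> \forall n \near \oo,
     EP (fun j x => Xfield j (phi_ n) x - G j x)%R (fun x => phi_ n x - v x)%R <= e%:E) ->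
  (0 < t)%R -> \forall n \near \oo,
    EP (fun j => Xfield j (phi_ n)) (phi_ n) <= (fine (EP G v) + t)%:E.
Proof.
move=> mG mv Ev tphi Hphi t0; set E := fine (EP G v).
have EE : EP G v = E%:E by rewrite /E fineK// ge0_fin_numE// pair_energy_ge0.
have E00 : (0 <= E)%R by apply: fine_ge0; exact: pair_energy_ge0.
have p10 : (0 < p - 1)%R by rewrite subr_gt0.
pose tau := (t / (2 * (E + 1)))%R.
have tau0 : (0 < tau)%R by rewrite divr_gt0// mulr_gt0// ltr_wpDl.
have T1 : (1 < 1 + tau)%R by rewrite ltrDl.
(* r is chosen so that r^(1-p) = 1 + tau *)
pose r := ((1 + tau) `^ (- (p - 1)^-1))%R.
have r0 : (0 < r)%R by rewrite powR_gt0// (lt_trans ltr01).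
have r1 : (r < 1)%R.
  rewrite /r powRN invf_lt1 ?powR_gt0 ?(lt_trans ltr01)//.
  rewrite /powR gt_eqF ?(lt_trans ltr01)// expR_gt1 mulr_gt0 ?invr_gt0// ln_gt0//.
have rE : (r `^ (1 - p) = 1 + tau)%R.
  rewrite /r -powRrM (_ : _ * _ = 1)%R ?powRr1 ?(ltW (lt_trans ltr01 _))//.
  by rewrite -[X in (_ * X)%R]opprB mulrNN mulVf// gt_eqF.
have e0 : (0 < 1 - r)%R by rewrite subr_gt0.
have e1 : (1 - r < 1)%R by rewrite gtrBl.
set k := ((1 - r) `^ (1 - p))%R.
have k0 : (0 < k)%R by exact: powR_gt0.
have eta0 : (0 < t / (2 * k))%R by rewrite divr_gt0// mulr_gt0.
have := Hphi _ eta0; apply: filterS => n Hn.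
have [mf mX] := test_measurable (tphi n).
have H := @pair_energyD _ _ Omega p s alpha p1 alpha0 oO (1 - r)%R G
  (fun j x => Xfield j (phi_ n) x - G j x)%R v (fun x => phi_ n x - v x)%R e0 e1 mG _ mv _.
have -> : EP (fun j => Xfield j (phi_ n)) (phi_ n) =
    EP (fun j x => G j x + (Xfield j (phi_ n) x - G j x))%R
       (fun x => v x + (phi_ n x - v x))%R.
  congr (EP _ _); last by apply/funext => x; rewrite addrC subrK.
  by apply/funext => j; apply/funext => x; rewrite addrC subrK.
apply: le_trans (H _ _) _.
- by move=> j; exact: measurable_funB.
- exact: measurable_funB.
rewrite subKr rE EE -/k.
have k0' : 0 <= k%:E by rewrite lee_fin ltW.
apply: le_trans (leeD (lexx _) (lee_wpmul2l k0' Hn)) _.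
rewrite -!EFinM -EFinD lee_fin.
have -> : (k * (t / (2 * k)) = t / 2)%R by field; rewrite gt_eqF.
have : (tau * E <= t / 2)%R.
  rewrite /tau mulrAC ler_pdivrMr ?mulr_gt0 ?ltr_wpDl//.
  have -> : (t / 2 * (2 * (E + 1)) = t * E + t)%R by field.
  by rewrite lerDl ltW.
by rewrite mulrDl mul1r; move: (tau * E)%R => X; lra.
Qed.

(** Test with the smoothed absolute values of the approximants of v and pass to the limit:
    Fatou's lemma on the left-hand side, where both integrands are nonnegative, and
    the bound for the energies of the approximants on the right-hand side. *)
Lemma weak_young_inequality G v : admissible Omega p s alpha G v ->
  \int[mu]_(x in Omega) (q x * `|v x|)%:E +
  \int[nu]_z (alpha * young_gap (gag s p v z) (gag s p (fun x => `|v x|)%R z)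
                        (gag s p u z))%:E <=
  ((1 - p^-1) * E0)%:E + p^-1%:E * EP G v.
Proof.
move=> [mG mv Ev [phi_ [tphi Hphi cphi]]].
set E := fine (EP G v).
have EE : EP G v = E%:E by rewrite /E fineK// ge0_fin_numE// pair_energy_ge0.
have h2 n : (0 < 2^-1 ^+ n :> R)%R by rewrite exprn_gt0// invr_gt0.
pose psi n x := (sabs (2^-1 ^+ n) (phi_ n x) - 2^-1 ^+ n)%R.
have tpsi n : test (psi n) by exact: test1_sabs.
have psi_lip n x y : (`|psi n x - psi n y| <= `|phi_ n x - phi_ n y|)%R.
  rewrite /psi (_ : _ - _ = sabs (2^-1 ^+ n) (phi_ n x) - sabs (2^-1 ^+ n) (phi_ n y))%R.
    exact: sabs_lip.
  by ring.
have mphi n : measurable_fun setT (phi_ n) by have [] := test_measurable (tphi n).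
have mpsi n : measurable_fun setT (psi n) by have [] := test_measurable (tpsi n).
have mabs : measurable_fun setT (fun x => `|v x|)%R.
  exact: measurableT_comp (@normr_measurable _ _) mv.
pose F z := (alpha * young_gap (gag s p v z) (gag s p (fun x => `|v x|)%R z) (gag s p u z))%R.
pose F_ n z := (alpha * young_gap (gag s p (phi_ n) z) (gag s p (psi n) z) (gag s p u z))%R.
have mgap (a b : V -> R) : measurable_fun setT a -> measurable_fun setT b ->
    measurable_fun setT (fun z => alpha * young_gap (gag s p a z) (gag s p b z) (gag s p u z))%R.
  move=> ma mb; apply: measurable_funM => //; apply: measurable_funB; last exact: mB.
  apply: measurable_funD; apply: measurable_funM => //; apply: measurable_powR_norm => //.
  exact: measurable_gag.
have gag_le (a b : V -> R) z : (forall x y, `|b x - b y| <= `|a x - a y|)%R ->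
    (`|gag s p b z| <= `|gag s p a z|)%R.
  by move=> ab; rewrite /gag !normrM ler_wpM2r.
have F_0 n z : (0 <= F_ n z)%R.
  rewrite mulr_ge0 ?(ltW alpha0)//; apply: young_gap_ge0; apply: gag_le => x y.
  exact: psi_lip.
have F0 z : (0 <= F z)%R.
  rewrite mulr_ge0 ?(ltW alpha0)//; apply: young_gap_ge0; apply: gag_le => x y.
  exact: ler_dist_dist.
have psi0 n x : (0 <= psi n x)%R by rewrite subr_ge0; exact: sabs_ge.
have cpsi : {ae mu, forall x, psi n x @[n --> \oo] --> `|v x|%R}.
  apply: filterS cphi => x cx.
  have c2 : (2^-1 ^+ n : R)%R @[n --> \oo] --> (0 : R)%R.
    by apply: cvg_expr; rewrite ger0_norm ?invr_ge0// invf_lt1// ltr1n.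
  have c1 : `|phi_ n x|%R @[n --> \oo] --> `|v x|%R by exact: cvg_norm.
  apply: (@squeeze_cvgr _ _ _ _ (fun n => `|phi_ n x| - 2^-1 ^+ n)%R
    (fun n => `|phi_ n x|)%R) => //.
    apply: nearW => n; rewrite /psi lerD2r le_norm_sabs /=.
    by rewrite lerBlDr sabs_le.
  by rewrite -[X in _ --> X]subr0; exact: cvgB.
rewrite EE leNgt; apply/negP; rewrite -EFinM -EFinD => ltc.
have I10 : 0 <= \int[mu]_(x in Omega) (q x * `|v x|)%:E.
  by apply: integral_ge0 => x _; rewrite lee_fin mulr_ge0.
have I20 : 0 <= \int[nu]_z (F z)%:E by apply: integral_ge0 => z _; rewrite lee_fin.
have [a [b [aI bI cab]]] := ereal_split I10 I20 ltc.
set c := ((1 - p^-1) * E0 + p^-1 * E)%R in cab.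
have t0 : (0 < p * (a + b - c) / 2)%R by rewrite divr_gt0// mulr_gt0// subr_gt0.
have na : \forall n \near \oo, a%:E <= \int[mu]_(x in Omega) (q x * psi n x)%:E.
  apply: fatou_lower aI => //.
  - by move=> n; apply: measurable_funTS; exact: measurable_funM.
  - by apply: measurable_funTS; exact: measurable_funM.
  - by move=> n x _; exact: mulr_ge0.
  - by move=> x _; exact: mulr_ge0.
  apply: filterS cpsi => x cx _; exact: (cvgM (cvg_cst _) cx).
have nb : \forall n \near \oo, b%:E <= \int[nu]_z (F_ n z)%:E.
  apply: (fatou_lower (F := F)) bI => //.
  - by move=> n; exact: mgap.
  - exact: mgap.
  have cg (w : nat -> V -> R) (w' : V -> R) : {ae mu, forall x, w n x @[n --> \oo] --> w' x} ->
      {ae nu, forall z, gag s p (w n) z @[n --> \oo] --> gag s p w' z}.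
    move=> cw; apply: filterS2 (ae_prod_fst mu cw) (ae_prod_snd mu cw) => z c1 c2.
    by apply: cvgM; [exact: cvgB|exact: cvg_cst].
  apply: filterS2 (cg _ _ cphi) (cg _ _ cpsi) => z c1 c2 _.
  apply: cvgM; first exact: cvg_cst.
  apply: cvgB; last by apply: cvgM => //; exact: cvg_cst.
  apply: cvgD; first exact: cvg_cst.
  by apply: cvgM; [exact: cvg_cst|exact: cvg_powR_norm].
have [n [[ha hb] hE]] := filter_ex (filterI (filterI na nb)
  (limsup_energy mG mv Ev tphi Hphi t0)).
have H := test_inequality (tphi n) (tpsi n)
  (fun j x => Xfield_sabs j x (h2 n) (proj1 (tphi n))) _.
have {}H := le_trans (leeD ha hb) (H _).
have pV0 : 0 <= p^-1%:E by rewrite lee_fin invr_ge0 ltW.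
have := le_trans (H _) (leeD (lexx _) (lee_wpmul2l pV0 hE)).
rewrite -EFinM -!EFinD lee_fin; move=> /(_ _)/wrap[].
  exact: psi_lip.
rewrite mulrDr -/E.
have -> : (p^-1 * (p * (a + b - c) / 2) = (a + b - c) / 2)%R by field; rewrite gt_eqF.
by move: cab; rewrite /c; lra.
Qed.

Let A_lower phi x :
  (`|A phi x - `|gU x| `^ p| <=
   `|gU x| `^ (p - 1) * `|enorm (fun j => Xfield j phi x - g j x)|)%R.
Proof.
have -> : (A phi x - `|gU x| `^ p =
    gU x `^ (p - 2) * \sum_j g j x * (Xfield j phi x - g j x))%R.
  have -> : (`|gU x| `^ p = gU x `^ (p - 2) * \sum_j g j x * g j x)%R.
    under eq_bigr do rewrite -expr2.
    rewrite -enorm_sqr ger0_norm ?enorm_ge0// expr2 mulrA powR_shift ?enorm_ge0//.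
    by rewrite mulrC mulr_powRB1// enorm_ge0.
  rewrite /A -mulrBr -sumrB; congr (_ * _)%R.
  by apply: eq_bigr => j _; rewrite mulrBr.
exact: pairing_le.
Qed.

Let B_lower phi z :
  (`|B phi z - `|gag s p u z| `^ p| <=
   `|gag s p u z| `^ (p - 1) * `|gag s p (fun x => phi x - u x) z|)%R.
Proof.
rewrite /B -Jp_id// -mulrBr normrM Jp_norm//.
by rewrite (_ : (gag s p phi z - gag s p u z = gag s p (fun x => phi x - u x) z)%R)//
  /gag; ring.
Qed.

(** Test with phi close to u.  The left-hand side of the weak formulation is E(u) up to the
    pairing with phi - u, and the right-hand side is the integral of q u up to that of
    q |phi - u|.  Both errors are bounded by applying Young's inequality to t (phi - u) with
    t large and dividing by t. *)
Lemma solution_energy_le : E0%:E <= \int[mu]_(x in Omega) (q x * `|u x|)%:E.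
Proof.
have [_ _ _ [phi_ [tphi Hphi cphi]]] := admU.
have key := weak_young_inequality admU.
have E00 : (0 <= E0)%R by apply: fine_ge0; exact: pair_energy_ge0.
have q1 : (0 <= 1 - p^-1)%R by rewrite subr_ge0 invf_le1.
have pV0 : (0 < p^-1)%R by rewrite invr_gt0.
have I0 : 0 <= \int[mu]_(x in Omega) (q x * `|u x|)%:E.
  by apply: integral_ge0 => x _; rewrite lee_fin mulr_ge0.
have gap0 (a b : V -> R) : (forall x y, `|b x - b y| <= `|a x - a y|)%R ->
  0 <= \int[nu]_z (alpha * young_gap (gag s p a z) (gag s p b z) (gag s p u z))%:E.
  move=> ab; apply: integral_ge0 => z _; rewrite lee_fin mulr_ge0 ?(ltW alpha0)//.
  by apply: young_gap_ge0; rewrite /gag !normrM ler_wpM2r.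
have Ilty : \int[mu]_(x in Omega) (q x * `|u x|)%:E < +oo.
  apply: (@le_lt_trans _ _ (((1 - p^-1) * E0)%:E + p^-1%:E * EP g u)).
    apply: le_trans key; rewrite leeDl//; apply: gap0 => x y; exact: ler_dist_dist.
  by rewrite lte_add_pinfty ?ltry// lte_mul_pinfty ?lee_fin ?(ltW pV0).
have IE : \int[mu]_(x in Omega) (q x * `|u x|)%:E =
    (fine (\int[mu]_(x in Omega) (q x * `|u x|)%:E))%:E by rewrite fineK// ge0_fin_numE.
rewrite IE lee_fin; set i := fine _ in IE *.
apply/ler_addgt0Pr => tau tau0.
pose k1 := ((1 - p^-1) * E0)%R; have k10 : (0 <= k1)%R by rewrite mulr_ge0.
have [t t0 tk1] : exists2 t : R, (0 < t)%R & (4 * k1 <= t * tau)%R.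
  exists (4 * (k1 + 1) / tau)%R; first by rewrite divr_gt0// mulr_gt0// ltr_wpDl.
  by rewrite divfK ?gt_eqF//; lra.
have tp0 : (0 < t `^ p)%R by exact: powR_gt0.
pose eta := (tau * t * p / (4 * t `^ p))%R.
have eta0 : (0 < eta)%R.
  by apply: divr_gt0; [apply: mulr_gt0 => //; exact: mulr_gt0|exact: mulr_gt0].
(* with this eta, p^-1 * t^p * eta = t * tau / 4, which also bounds k1 *)
have [n Hn] := filter_ex (Hphi _ eta0).
have tn := tphi n; have [mf mX] := test_measurable tn.
have adm := admissibleB p1 s0 s1 alpha0 N0 oO admU tn.
have [mH mh Eh _] := adm.
have admt := admissibleZ alpha0 oO t adm.
set G' := (fun j x => _) in adm mH Eh Hn admt; set v' := (fun x => _) in adm mh Eh Hn admt.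
have EhE : EP G' v' = (fine (EP G' v'))%:E by rewrite fineK// ge0_fin_numE// pair_energy_ge0.
set eh := fine (EP G' v') in EhE.
have ehn : (eh <= eta)%R by move: Hn; rewrite EhE lee_fin.
pose K := (k1 + p^-1 * (t `^ p * eta))%R.
have KE : (K = k1 + tau * t / 4)%R.
  by rewrite /K /eta; field; rewrite !gt_eqF.
have J1 : t%:E * \int[mu]_(x in Omega) (q x * `|v' x|)%:E <= K%:E.
  rewrite -ge0_integralZl_EFin ?(ltW t0)//; last 2 first.
  - by move=> x _; rewrite lee_fin mulr_ge0.
  - apply/measurable_EFinP; apply: measurable_funTS; apply: measurable_funM => //.
    exact: measurableT_comp (@normr_measurable _ _) mh.
  have -> : \int[mu]_(x in Omega) (t%:E * (q x * `|v' x|)%:E) =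
      \int[mu]_(x in Omega) (q x * `|t * v' x|)%:E.
    by apply: eq_integral => x _; rewrite -EFinM normrM (gtr0_norm t0) mulrCA.
  have H := weak_young_inequality admt.
  rewrite pair_energyZ// (gtr0_norm t0) EhE in H.
  apply: (@le_trans _ _ (k1%:E + p^-1%:E * ((t `^ p)%:E * eh%:E))).
    apply: le_trans H; rewrite leeDl//; apply: gap0 => x y; exact: ler_dist_dist.
  rewrite -!EFinM -EFinD lee_fin /K lerD2l ler_wpM2l ?(ltW pV0)// ler_wpM2l// ltW//.
have J0 : 0 <= \int[mu]_(x in Omega) (q x * `|v' x|)%:E.
  by apply: integral_ge0 => x _; rewrite lee_fin mulr_ge0.
have Jlty : \int[mu]_(x in Omega) (q x * `|v' x|)%:E < +oo.
  rewrite ltNge leye_eq; apply/negP => /eqP E; move: J1; rewrite E gt0_muley ?lte_fin//.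
have JE : \int[mu]_(x in Omega) (q x * `|v' x|)%:E =
    (fine (\int[mu]_(x in Omega) (q x * `|v' x|)%:E))%:E by rewrite fineK// ge0_fin_numE.
set j := fine _ in JE.
have {}J1 : (t * j <= K)%R by move: J1; rewrite JE.
have [iA iB L] := AB tn.
have [h1 h2] := pair_energy_lty Eh; have [u1 u2] := pair_energy_lty Elty.
have mE : measurable_fun Omega (fun x => enorm (fun j => G' j x)).
  by apply: measurable_funTS; exact: measurable_enorm.
have LA := young_lower p1 mO t0 mgU mE (mA tn) (fun x _ => A_lower (phi_ n) x) u1 h1 iA.
have LB := young_lower p1 measurableT t0 mgag (measurable_gag s p mh) (mB mf)
  (fun z _ => B_lower (phi_ n) z) u2 h2 iB.
have Leq : (\int[mu]_(x in Omega) A (phi_ n) x + alpha * \int[nu]_z B (phi_ n) z <= i + j)%R.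
  rewrite -lee_fin -L EFinD -IE -JE -ge0_integralD//; last 4 first.
  - by move=> x _; rewrite lee_fin mulr_ge0.
  - apply/measurable_EFinP; apply: measurable_funTS; apply: measurable_funM => //.
    exact: measurableT_comp (@normr_measurable _ _) mu'.
  - by move=> x _; rewrite lee_fin mulr_ge0.
  - apply/measurable_EFinP; apply: measurable_funTS; apply: measurable_funM => //.
    exact: measurableT_comp (@normr_measurable _ _) mh.
  have mqf : measurable_fun Omega (fun x => (q x * phi_ n x)%:E).
    by apply/measurable_EFinP; apply: measurable_funTS; exact: measurable_funM.
  apply: le_trans (lee_abs _) _; apply: le_trans (le_abse_integral _ mO mqf) _.
  apply: ge0_le_integral => //.
  - exact: measurableT_comp mqf.
  - apply/measurable_EFinP; apply: measurable_funTS; apply: measurable_funD;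
      apply: measurable_funM => //; exact: measurableT_comp (@normr_measurable _ _) _.
  move=> x _; rewrite -EFinD lee_fin normrM (ger0_norm (q0 x)) -mulrDr ler_wpM2l//.
  by rewrite -{1}(subrK (u x) (phi_ n x)) addrC ler_normD.
have EE0 : E0 = (fine (pint mu p Omega gU) + alpha * fine (pint nu p setT (gag s p u)))%R.
  by rewrite /E0 fine_pair_energy.
have Ee : eh = (fine (pint mu p Omega (fun x => enorm (fun j => G' j x))) +
    alpha * fine (pint nu p setT (gag s p v')))%R by rewrite /eh fine_pair_energy.
set X := (\int[mu]_(x in Omega) A (phi_ n) x + alpha * \int[nu]_z B (phi_ n) z)%R in Leq.
have LX : (t * (E0 - X) <= K)%R.
  apply: (@le_trans _ _ (k1 + p^-1 * (t `^ p * eh))%R); last first.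
    by rewrite /K lerD2l ler_wpM2l ?(ltW pV0)// ler_wpM2l// ltW.
  have := lerD LA (ler_wpM2l (ltW alpha0) LB); rewrite /k1 EE0 Ee /X.
  move: (fine _) (fine _) (fine _) (fine _) => r1 r2 r3 r4.
  exact: lower_balance.
have : (t * E0 <= t * (i + tau))%R.
  have tK : (2 * K <= t * tau)%R.
    by rewrite KE (mulrC tau t); move: tk1; move: (t * tau)%R => y; lra.
  have : (t * X <= t * (i + j))%R by rewrite ler_wpM2l// ltW.
  exact: energy_balance LX J1 tK.
by rewrite ler_pM2l.
Qed.

End weak_formulation.

(** * Pointwise inequalities and their equality cases *)

(** Weighted arithmetic-geometric inequality; equivalently, the graph of the concave function
    t^(1-d) lies below its tangent at x. *)
Lemma powR_amgm (R : realType) (d x a : R) : 0 < d -> d < 1 -> 0 < x -> 0 <= a ->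
  a `^ (1 - d) <= (1 - d) * (x `^ (- d) * a) + d * x `^ (1 - d).
Proof.
move=> d0 d1 x0 a0.
have c0 : 0 < 1 - d by rewrite subr_gt0.
have c1 : 1 <= (1 - d)^-1 by rewrite invf_ge1// gerBl ltW.
have := @young_powR R (1 - d)^-1 (x `^ ((1 - d) ^+ 2)) ((x `^ (- d) * a) `^ (1 - d))
  c1 (powR_ge0 _ _) (powR_ge0 _ _).
have y0 : 0 <= x `^ (- d) * a by rewrite mulr_ge0// powR_ge0.
rewrite invrK -!powRrM mulfV ?gt_eqF// powRr1// powRM ?powR_ge0// -powRrM mulrA -powRD; last first.
  by rewrite (gt_eqF x0) implybT.
have -> : (1 - d) ^+ 2 * ((1 - d)^-1 - 1) + - d * (1 - d) = 0.
  by field; rewrite gt_eqF.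
rewrite powRr0 mul1r => /le_trans; apply.
have -> : (1 - d) ^+ 2 / (1 - d) = 1 - d by field; rewrite gt_eqF.
rewrite addrC lerD2l (_ : 1 - (1 - d) = d)//; ring.
Qed.

(** Strictness of Young's inequality from Young's inequality itself: apply it to the square
    roots of a and b and square; the remainder is (1/p) (1 - 1/p) (a^(p/2) - b^(p/2))^2. *)
Lemma young_powR_eq (R : realType) (p a b : R) : 1 < p -> 0 <= a -> 0 <= b ->
  (1 - p^-1) * a `^ p + p^-1 * b `^ p <= a `^ (p - 1) * b -> b = a.
Proof.
move=> p1 a0 b0 H.
have p0 : 0 < p by exact: lt_trans p1.
have v0 : 0 < p^-1 by rewrite invr_gt0.
have v1 : p^-1 < 1 by rewrite invf_lt1.
have Y := @young_powR R p (a `^ 2^-1) (b `^ 2^-1) (ltW p1) (powR_ge0 _ _) (powR_ge0 _ _).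
have E1 (c : R) : 0 <= c -> (c `^ 2^-1) `^ p = c `^ (p / 2) by move=> _; rewrite -powRrM mulrC.
have sq (c r : R) : 0 <= c -> (c `^ (r / 2)) ^+ 2 = c `^ r.
  by move=> c0; rewrite -powR_mulrn ?powR_ge0// -powRrM divfK.
have {}Y : (a `^ (p - 1) * b <= ((1 - p^-1) * a `^ (p / 2) + p^-1 * b `^ (p / 2)) ^+ 2).
  move: Y; rewrite !E1// => Y.
  have -> : a `^ (p - 1) * b = ((a `^ 2^-1) `^ (p - 1) * b `^ 2^-1) ^+ 2.
    rewrite exprMn -powRrM (mulrC 2^-1) sq// -powR_mulrn ?powR_ge0// -powRrM.
    by rewrite mulVf// powRr1.
  by rewrite lerXn2r ?nnegrE// ?addr_ge0 ?mulr_ge0 ?powR_ge0// ?(ltW v0)// subr_ge0 ltW.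
have {Y}H := le_trans H Y.
move: H; rewrite -(sq a p a0) -(sq b p b0).
have : (a `^ (p / 2) = b `^ (p / 2) -> b = a).
  move=> /(congr1 (fun t => t `^ (p / 2)^-1)); rewrite -!powRrM mulfV ?powRr1//.
  by rewrite gt_eqF// divr_gt0.
move: (a `^ _) (b `^ _) v0 v1 => A B; move: p^-1 => v v0 v1 AB H.
apply: AB; apply/eqP; rewrite -subr_eq0 -sqrf_eq0 eq_le sqr_ge0 andbT.
have : v * (1 - v) * (A - B) ^+ 2 <= 0 by nra.
by rewrite pmulr_rle0// mulr_gt0// subr_gt0.
Qed.

(** Both Young's inequality and the bound of W by V must be equalities, and the sign of W is
    then that of U. *)
Lemma young_gap_eq0 (R : realType) (p V W U : R) : 1 < p -> `|W| <= `|V| ->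
  young_gap p V W U = 0 -> `|V| = `|U| /\ W = U.
Proof.
move=> p1 WV; rewrite /young_gap => /eqP; rewrite subr_eq0 => /eqP H.
have J : Jp p U * W <= `|U| `^ (p - 1) * `|W|.
  by rewrite -(Jp_norm p1) -normrM ler_norm.
have VU : `|V| = `|U|.
  apply: (young_powR_eq p1) => //; rewrite H; apply: le_trans J _.
  by rewrite ler_wpM2l ?powR_ge0.
split=> //; move: H; rewrite VU -mulrDl subrK mul1r -(Jp_id p1).
have [U0|U0] := eqVneq U 0.
  move=> _; apply/eqP; rewrite U0 -normr_eq0 eq_le normr_ge0 andbT (le_trans WV)//.
  by rewrite VU U0 normr0.
move/mulfI => -> //.
by rewrite -normr_eq0 Jp_norm// powR_eq0 normr_eq0 (negbTE U0).
Qed.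

Section gagliardo_quotient.
Context {R : realType} {N : nat}.
Local Notation V := 'rV[R]_(N + N + 1).
Variables (s p : R).
Implicit Types (v w : V -> R) (z : V * V).

Lemma hnorm_eq0 (h : V) : hnorm h = 0 -> h = 0.
Proof.
move=> h0; apply/rowP => k; rewrite mxE.
have [j ->|j ->] := split_ordP k.
  apply/eqP; rewrite -normr_eq0 eq_le normr_ge0 andbT.
  by have := hx_le_hnorm h j; rewrite h0.
rewrite ord1; apply/eqP; rewrite -normr_eq0 eq_le normr_ge0 andbT.
by have := htau_le_hnorm h; rewrite h0 expr0n.
Qed.

Lemma gagliardo_weight_neq0 z (a : R) : z.1 != z.2 -> gagliardo_weight s p z `^ a != 0.
Proof.
move=> zz; rewrite /gagliardo_weight -powRrM powR_eq0 negb_and.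
apply/orP; left; apply: contra zz => /eqP /hnorm_eq0 E; apply/eqP.
by rewrite -(hmulNKx z.2 z.1) [hmul (- _) _]E hmulx0.
Qed.

(** The weight only vanishes on the diagonal, where both increments are 0. *)
Lemma gag_inj v w z : gag s p v z = gag s p w z -> v z.1 - v z.2 = w z.1 - w z.2.
Proof.
have [->|zz] := eqVneq z.1 z.2; first by rewrite !subrr.
by move/(mulIf (gagliardo_weight_neq0 (- p^-1) zz)).
Qed.

Lemma gag_norm_inj v w z : `|gag s p v z| = `|gag s p w z| ->
  `|v z.1 - v z.2| = `|w z.1 - w z.2|.
Proof.
have [->|zz] := eqVneq z.1 z.2; first by rewrite !subrr.
rewrite /gag !normrM; apply: mulIf.
by rewrite normr_eq0 gagliardo_weight_neq0.
Qed.

End gagliardo_quotient.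

(** The scaling factor ((E/e)^(1/p)) moves a function of energy e to the sphere of energy E;
    the identity expresses the sharp inequality through the mass of the scaled function. *)
Lemma sharp_identity (R : realType) (p d E m e : R) :
  0 < p -> d < 1 -> 0 < E -> 0 < e -> 0 <= m ->
  E `^ ((1 - d - p) / (1 - d)) * m `^ (p / (1 - d)) =
  e * (((E / e) `^ p^-1) `^ (1 - d) * m / E) `^ (p / (1 - d)).
Proof.
move=> p0 d1 E0 e0 m0; have c0 : 0 < 1 - d by rewrite subr_gt0.
have Ee0 : 0 <= E / e by rewrite divr_ge0 ?ltW.
have K0 : 0 <= ((E / e) `^ p^-1) `^ (1 - d) by exact: powR_ge0.
rewrite powRM ?invr_ge0 ?mulr_ge0 ?(ltW E0)// powRM// -powRrM -powRrM.
have -> : p^-1 * ((1 - d) * (p / (1 - d))) = 1 by field; rewrite !gt_eqF.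
rewrite powRr1// -(powR_inv1 (ltW E0)) -powRrM.
have -> : e * (E / e * m `^ (p / (1 - d)) * E `^ (-1 * (p / (1 - d)))) =
    E * E `^ (-1 * (p / (1 - d))) * m `^ (p / (1 - d)) by field; rewrite gt_eqF.
rewrite -{2}(powRr1 (ltW E0)) -powRD; last by rewrite (gt_eqF E0) implybT.
by congr (_ `^ _ * _); field; rewrite gt_eqF.
Qed.

Lemma ae_and d (T : measurableType d) (R : realType) (m : {measure set T -> \bar R})
    (P Q : T -> Prop) : {ae m, forall x, P x} -> {ae m, forall x, Q x} ->
  {ae m, forall x, P x /\ Q x}.
Proof. exact: filterI. Qed.

(** Almost every section of a null set of the product is a null set, by Tonelli. *)
Lemma ae_sections d1 d2 (T1 : measurableType d1) (T2 : measurableType d2) (R : realType)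
    (m1 : {sigma_finite_measure set T1 -> \bar R})
    (m2 : {sigma_finite_measure set T2 -> \bar R}) (P : T1 * T2 -> Prop) :
  {ae (m1 \x m2)%E, forall z, P z} -> {ae m1, forall x, {ae m2, forall y, P (x, y)}}.
Proof.
move=> [A [mA A0 PA]].
have mx : measurable_fun setT (m2 \o xsection A) by exact: measurable_fun_xsection.
have /(ae_eq_integral_abs m1 measurableT mx).1 :
    (\int[m1]_x `|(m2 \o xsection A) x| = 0)%E.
  rewrite -[RHS]A0 /product_measure1; apply: eq_integral => x _.
  by rewrite gee0_abs// measure_ge0.
apply: filterS => x /(_ I) /= Ax0; exists (xsection A x); split => //.
  exact: measurable_xsection.
by move=> y /= nP; rewrite /xsection /= inE; exact: PA.
Qed.

(** Squaring, the two equalities of norms give v0 v1 = u0 u1. *)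
Lemma rigid_sign (R : realType) (v0 u0 v1 u1 : R) : 0 < u0 -> `|v0| = u0 -> `|v1| = u1 ->
  `|v1 - v0| = `|u1 - u0| -> v1 = v0 / u0 * u1.
Proof.
move=> u00 v0E v1E vu.
have sq : v0 * v1 = u0 * u1.
  have := congr1 (fun t => t ^+ 2) vu; rewrite !real_normK ?num_real//.
  have := congr1 (fun t => t ^+ 2) v0E; have := congr1 (fun t => t ^+ 2) v1E.
  rewrite !real_normK ?num_real// => e1 e0; rewrite !sqrrB e0 e1 => e2.
  have : 2 * (v0 * v1) = 2 * (u0 * u1) by lra.
  by apply: mulfI; rewrite pnatr_eq0.
have v00 : v0 != 0 by rewrite -normr_eq0 v0E gt_eqF.
apply: (mulfI v00); rewrite sq mulrA mulrA.
have -> : v0 * v0 = u0 * u0 by rewrite -!expr2 -v0E real_normK ?num_real.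
by rewrite mulfK ?gt_eqF.
Qed.

(** * The sharp inequality and its extremals *)

Section extremals.
Context {R : realType} {N : nat}.
Local Notation V := 'rV[R]_(N + N + 1).
Local Notation mu := (@mu_heis R N).
Local Open Scope ereal_scope.
Implicit Types (v w phi : V -> R) (G : 'I_(N + N) -> V -> R).
Variables (Omega : set V) (p s alpha delta : R).
Hypotheses (p1 : (1 < p)%R) (s0 : (0 < s)%R) (s1 : (s < 1)%R) (alpha0 : (0 < alpha)%R).
Hypotheses (d0 : (0 < delta)%R) (d1 : (delta < 1)%R).
Hypotheses (N0 : (0 < N)%N) (oO : open Omega) (bO : bounded_set Omega).
Let mO : measurable Omega. Proof. exact: open_measurable_rV. Qed.
Let p0 : (0 < p)%R. Proof. exact: lt_trans p1. Qed.
Local Notation EP := (pair_energy Omega p s alpha).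
Local Notation nu := (mu \x mu).

(** The domain is bounded, so its complement contains a ball. *)
Lemma ae_outside (P : V -> Prop) : {ae mu, forall x, P x} -> exists2 x, ~ Omega x & P x.
Proof.
move=> aP; have [M [Mr HM]] := bO.
have HM1 : forall x, Omega x -> (`|x| <= `|M| + 1)%R.
  by apply: HM; rewrite (le_lt_trans (ler_norm M))// ltrDl.
have mC : measurable (~` Omega) by exact: measurableC.
have C0 : 0 < mu (~` Omega).
  have Bs : ball (const_mx (`|M| + 3)%R : V) 1%R `<=` ~` Omega.
    move=> x /=; rewrite -ball_normE /= => xb Ox.
    have i : 'I_(N + N + 1) := rshift (N + N) ord0.
    have := ler_coord_norm (const_mx (`|M| + 3) - x : V)%R i.
    have := ler_coord_norm x i.
    rewrite !mxE => h1 h2; have h3 := HM1 _ Ox.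
    have := ler_normD (`|M| + 3 - x ord0 i)%R (x ord0 i); rewrite subrK.
    have := ler_norm (`|M| + 3)%R; lra.
  apply: lt_le_trans (mu_ball_gt0 (const_mx (`|M| + 3)%R) ltr01) _.
  by apply: le_measure; rewrite ?inE//; apply: open_measurable_rV; exact: ball_open.
by have [x Ox Px] := ae_exists aP mC C0; exists x.
Qed.

Variables (u f0 : V -> R) (g : 'I_(N + N) -> V -> R).
Hypotheses (mf0 : measurable_fun setT f0) (f0_ge0 : forall x, (0 <= f0 x)%R).
Hypothesis admU : admissible Omega p s alpha g u.
Hypothesis u_gt0 : {ae mu, forall x, Omega x -> (0 < u x)%R}.
Hypothesis u_off : {ae mu, forall x, ~ Omega x -> u x = 0%R}.
Hypothesis u_mass : ~ {ae mu, forall x, Omega x -> f0 x = 0%R}.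
Let q x := (f0 x * u x `^ (- delta))%R.
Hypothesis WF : forall phi, test1 Omega phi ->
  \int[mu]_(x in Omega) (enorm (fun j => g j x) `^ (p - 2) *
     \sum_j g j x * Xfield j phi x)%R%:E +
  alpha%:E * int_dmu s p (fun z => Jp p (u z.1 - u z.2) * (phi z.1 - phi z.2))%R =
  \int[mu]_(x in Omega) (q x * phi x)%:E.

Let mu' : measurable_fun setT u. Proof. by case: admU. Qed.
Let mq : measurable_fun setT q.
Proof.
apply: measurable_funM => //.
exact: measurableT_comp (measurable_powR _) mu'.
Qed.
Let q0 x : (0 <= q x)%R. Proof. by rewrite mulr_ge0// powR_ge0. Qed.
Let E0 := fine (EP g u).

Definition mass v : \bar R := \int[mu]_(x in Omega) (`|v x| `^ (1 - delta) * f0 x)%:E.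

Let gap v := \int[nu]_z (alpha * young_gap p (gag s p v z)
                (gag s p (fun x => `|v x|)%R z) (gag s p u z))%:E.

Let mmass v : measurable_fun setT v ->
  measurable_fun Omega (fun x => (`|v x| `^ (1 - delta) * f0 x)%:E).
Proof.
move=> mv; apply/measurable_EFinP; apply: measurable_funTS; apply: measurable_funM => //.
exact: measurable_powR_norm.
Qed.
Let mqv v : measurable_fun setT v ->
  measurable_fun Omega (fun x => (q x * `|v x|)%:E).
Proof.
move=> mv; apply/measurable_EFinP; apply: measurable_funTS; apply: measurable_funM => //.
exact: measurableT_comp (@normr_measurable _ _) mv.
Qed.

Lemma mass_ge0 v : 0 <= mass v.
Proof. by apply: integral_ge0 => x _; rewrite lee_fin mulr_ge0 ?powR_ge0. Qed.

Lemma massZ (c : R) v : measurable_fun setT v ->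
  mass (fun x => c * v x)%R = (`|c| `^ (1 - delta))%:E * mass v.
Proof.
move=> mv; rewrite /mass -ge0_integralZl_EFin ?powR_ge0//; last 2 first.
- by move=> x _; rewrite lee_fin mulr_ge0 ?powR_ge0.
- exact: mmass.
by apply: eq_integral => x _; rewrite -EFinM normrM powRM// mulrA.
Qed.

Let mass_u : mass u = \int[mu]_(x in Omega) (q x * `|u x|)%:E.
Proof.
apply: ae_eq_integral => //; first exact: mmass.
- exact: mqv.
apply: filterS u_gt0 => x ux Ox; have {}ux := ux Ox.
rewrite gtr0_norm// /q -mulrA mulrC; congr (_ * _)%:E.
rewrite -{3}(powRr1 (ltW ux)) -powRD; last by rewrite (gt_eqF ux) implybT.
by rewrite addrC.
Qed.

Let EgE : EP g u = E0%:E.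
Proof. by rewrite /E0 fineK// ge0_fin_numE ?pair_energy_ge0//; case: admU. Qed.

Lemma gap_ge0 v : 0 <= gap v.
Proof.
apply: integral_ge0 => z _; rewrite lee_fin mulr_ge0 ?(ltW alpha0)// young_gap_ge0//.
by rewrite /gag !normrM ler_wpM2r// ler_dist_dist.
Qed.

(** The upper bound is Young's inequality with v = u, the lower bound comes from testing with
    approximations of u. *)
Lemma mass_solution : mass u = E0%:E.
Proof.
apply/eqP; rewrite eq_le mass_u (solution_energy_le p1 s0 s1 alpha0 N0 oO mq q0 admU WF) andbT.
have := weak_young_inequality p1 s0 s1 alpha0 N0 oO mq q0 admU WF admU.
rewrite -/E0 EgE -EFinM -EFinD -mulrDl subrK mul1r; apply: le_trans.
by rewrite leeDl// gap_ge0.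
Qed.

(** Otherwise the mass of u would vanish, and with it the datum, since u is positive. *)
Lemma energy_gt0 : (0 < E0)%R.
Proof.
rewrite lt_neqAle eq_sym -lee_fin -mass_solution mass_ge0 andbT.
apply/eqP => E00; apply: u_mass.
have := mass_solution; rewrite E00 /mass => M0.
have /(ae_eq_integral_abs mu mO (mmass mu')).1 : 
    \int[mu]_(x in Omega) `|(`|u x| `^ (1 - delta) * f0 x)%:E| = 0.
  rewrite -[RHS]M0; apply: eq_integral => x _.
  by rewrite gee0_abs// lee_fin mulr_ge0 ?powR_ge0.
apply: filterS2 u_gt0 => x ux H Ox; have := H Ox; have {}ux := ux Ox.
move=> [] /eqP; rewrite mulf_eq0 powR_eq0 normr_eq0 (gt_eqF ux)/=.
by move/eqP.
Qed.

(** Integrate the tangent inequality for t^(1-d) at u(x), and bound the linear term by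
    Young's inequality in the weak formulation. *)
Lemma mass_le G v : admissible Omega p s alpha G v ->
  mass v + (1 - delta)%:E * gap v <=
  (1 - delta)%:E * (((1 - p^-1) * E0)%:E + p^-1%:E * EP G v) + (delta * E0)%:E.
Proof.
move=> adm; have mv : measurable_fun setT v by case: adm.
have c0 : (0 <= 1 - delta)%R by rewrite subr_ge0 ltW.
have key := weak_young_inequality p1 s0 s1 alpha0 N0 oO mq q0 admU WF adm.
have J0 : 0 <= \int[mu]_(x in Omega) (q x * `|v x|)%:E.
  by apply: integral_ge0 => x _; rewrite lee_fin mulr_ge0.
have A : mass v <= (1 - delta)%:E * \int[mu]_(x in Omega) (q x * `|v x|)%:E + (delta * E0)%:E.
  rewrite EFinM -mass_solution -ge0_integralZl_EFin//; last 2 first.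
  - by move=> x _; rewrite lee_fin mulr_ge0.
  - exact: mqv.
  rewrite -ge0_integralZl_EFin ?(ltW d0)//; last 2 first.
  - by move=> x _; rewrite lee_fin mulr_ge0 ?powR_ge0.
  - exact: mmass.
  rewrite -ge0_integralD//; last 4 first.
  - by move=> x _; rewrite -EFinM lee_fin; apply: mulr_ge0 => //; exact: mulr_ge0.
  - by apply: measurable_funeM; exact: mqv.
  - by move=> x _; rewrite -EFinM lee_fin !mulr_ge0 ?powR_ge0 ?(ltW d0).
  - by apply: measurable_funeM; exact: mmass.
  apply: ae_ge0_le_integral => //.
  - by move=> x _; rewrite lee_fin mulr_ge0 ?powR_ge0.
  - exact: mmass.
  - by move=> x _; rewrite -!EFinM -EFinD lee_fin addr_ge0// !mulr_ge0 ?powR_ge0 ?(ltW d0).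
  - by apply: emeasurable_funD; apply: measurable_funeM; [exact: mqv|exact: mmass].
  apply: filterS u_gt0 => x ux Ox; have {}ux := ux Ox.
  rewrite -!EFinM -EFinD lee_fin.
  have := ler_wpM2r (f0_ge0 x) (powR_amgm d0 d1 ux (normr_ge0 (v x))).
  rewrite (gtr0_norm ux) /q; congr (_ <= _)%R; ring.
apply: le_trans (leeD2r _ A) _.
rewrite addeAC leeD2r// -ge0_muleDr ?gap_ge0//.
by rewrite lee_wpmul2l// lee_fin.
Qed.

Lemma mass_lty G v : admissible Omega p s alpha G v -> mass v < +oo.
Proof.
move=> adm; have [mG mv Elt _] := adm.
apply: (le_lt_trans (le_trans _ (mass_le adm))).
  by rewrite leeDl// mule_ge0 ?gap_ge0// lee_fin subr_ge0 ltW.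
rewrite lte_add_pinfty ?ltry// lte_mul_pinfty ?lee_fin ?subr_ge0 ?(ltW d1)//.
rewrite lte_add_pinfty ?ltry// lte_mul_pinfty ?lee_fin ?invr_ge0 ?(ltW p0)//.
Qed.

Let r := (p / (1 - delta))%R.
Let T := (E0 `^ ((1 - delta - p) / (1 - delta)))%R.

Let c0 : (0 < 1 - delta)%R. Proof. by rewrite subr_gt0. Qed.
Let r0 : (0 < r)%R. Proof. by rewrite divr_gt0. Qed.

Lemma scaled_mass_le G v (k e : R) : admissible Omega p s alpha G v -> EP G v = e%:E ->
  (0 < k)%R ->
  ((k `^ (1 - delta) * fine (mass v))%:E + (1 - delta)%:E * gap (fun x => k * v x)%R <=
  ((1 - delta) * ((1 - p^-1) * E0 + p^-1 * (k `^ p * e)) + delta * E0)%:E).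
Proof.
move=> adm Ee k0; have [mG mv _ _] := adm.
have := mass_le (admissibleZ alpha0 oO k adm).
have mfin : mass v \is a fin_num by rewrite ge0_fin_numE ?mass_ge0// (mass_lty adm).
rewrite massZ// pair_energyZ// Ee (gtr0_norm k0) => H.
have -> : (k `^ (1 - delta) * fine (mass v))%:E = (k `^ (1 - delta))%:E * mass v.
  by rewrite EFinM fineK.
apply: le_trans H _.
by rewrite !EFinD !EFinM !EFinD !EFinM.
Qed.

(** All multiples of v have zero energy, so that their masses are bounded by the same
    constant. *)
Lemma mass_zero_energy G v : admissible Omega p s alpha G v -> EP G v = 0 -> mass v = 0.
Proof.
move=> adm E00; apply/eqP; rewrite eq_le mass_ge0 andbT.
have mE : mass v = (fine (mass v))%:E.
  by rewrite fineK// ge0_fin_numE ?mass_ge0// (mass_lty adm).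
rewrite mE lee_fin leNgt; apply/negP => m0.
pose K := ((1 - delta) * ((1 - p^-1) * E0) + delta * E0)%R.
have K0 : (0 <= K)%R.
  have := energy_gt0 => /ltW E0g; rewrite addr_ge0 ?mulr_ge0 ?(ltW d0) ?(ltW c0)//.
  by rewrite subr_ge0 invf_le1// ltW.
have k0 : (0 < ((K + 1) / fine (mass v)) `^ (1 - delta)^-1)%R.
  by apply: powR_gt0; apply: divr_gt0 => //; exact: ltr_wpDl.
have := scaled_mass_le adm E00 k0.
have y0 : (0 <= (K + 1) / fine (mass v))%R.
  by apply: divr_ge0; [exact: addr_ge0|exact: ltW].
rewrite -powRrM mulVf ?gt_eqF// powRr1//.
rewrite divfK ?gt_eqF// !mulr0 addr0 -/K => H.
have : ((K + 1)%:E <= K%:E).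
  by apply: le_trans H; rewrite leeDl// mule_ge0 ?gap_ge0// lee_fin ltW.
by rewrite lee_fin gerDl ler10.
Qed.

(** On the multiple of v with the energy of u the bound of [mass_le] reads E(u): the mass is
    at most E(u), and equality leaves nothing for the remainder. *)
Lemma optimal_scaling G v (e : R) : admissible Omega p s alpha G v -> EP G v = e%:E ->
  (0 < e)%R -> let k := ((E0 / e) `^ p^-1)%R in
  (k `^ (1 - delta) * fine (mass v))%:E <= E0%:E /\
  ((k `^ (1 - delta) * fine (mass v))%R = E0 -> gap (fun x => k * v x)%R = 0).
Proof.
move=> adm Ee e0 k; have E00 := energy_gt0.
have k0 : (0 < k)%R by apply: powR_gt0; exact: divr_gt0.
have := scaled_mass_le adm Ee k0.
have -> : (k `^ p * e = E0)%R.
  rewrite /k -powRrM mulVf ?gt_eqF// powRr1 ?divr_ge0 ?(ltW E00) ?(ltW e0)//.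
  by rewrite divfK// gt_eqF.
have -> : ((1 - delta) * ((1 - p^-1) * E0 + p^-1 * E0) + delta * E0 = E0)%R by ring.
move=> H; split=> [|mE].
  by apply: le_trans H; rewrite leeDl// mule_ge0 ?gap_ge0// lee_fin ltW.
apply/eqP; rewrite eq_le gap_ge0 andbT.
have : (1 - delta)%:E * gap (fun x => k * v x)%R <= 0.
  by move: H; rewrite mE -[leRHS]addr0 => H; rewrite -(leeD2lE (x := E0%:E)).
by rewrite pmule_rle0// lte_fin.
Qed.

Lemma sharp_inequality G v : admissible Omega p s alpha G v ->
  T%:E * mass v `^ r <= EP G v.
Proof.
move=> adm; have [_ _ Elt _] := adm.
have eE : EP G v = (fine (EP G v))%:E by rewrite fineK// ge0_fin_numE ?pair_energy_ge0.
have mE : mass v = (fine (mass v))%:E.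
  by rewrite fineK// ge0_fin_numE ?mass_ge0// (mass_lty adm).
have m0 : (0 <= fine (mass v))%R by rewrite fine_ge0 ?mass_ge0.
have [E00|] := eqVneq (EP G v) 0.
  by rewrite (mass_zero_energy adm E00) poweR0r ?mule0 ?pair_energy_ge0// gt_eqF.
rewrite eE eqe => e_neq0; set e := fine _ in e_neq0 *.
have e0 : (0 < e)%R by rewrite lt_neqAle eq_sym e_neq0 fine_ge0// pair_energy_ge0.
have E00 := energy_gt0.
rewrite mE poweR_EFin -EFinM lee_fin /T /r (sharp_identity p0 d1 E00 e0 m0).
rewrite ger_pMr//; set X := (_ / E0)%R.
suff X01 : (0 <= X <= 1)%R.
  case/andP: X01 => X0 X1; have := @ge0_ler_powR _ r (ltW r0) X 1%R X0 ler01 X1.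
  by rewrite powR1.
rewrite divr_ge0 ?mulr_ge0 ?powR_ge0 ?(ltW E00)//= ler_pdivrMr// mul1r -lee_fin.
exact: (optimal_scaling adm eE e0).1.
Qed.

Lemma equality_gap G v : admissible Omega p s alpha G v ->
  T%:E * mass v `^ r = EP G v -> EP G v != 0 -> exists2 k : R, (0 < k)%R &
  gap (fun x => k * v x)%R = 0.
Proof.
move=> adm; have [_ _ Elt _] := adm.
have eE : EP G v = (fine (EP G v))%:E by rewrite fineK// ge0_fin_numE ?pair_energy_ge0.
have mE : mass v = (fine (mass v))%:E.
  by rewrite fineK// ge0_fin_numE ?mass_ge0// (mass_lty adm).
have m0 : (0 <= fine (mass v))%R by rewrite fine_ge0 ?mass_ge0.
rewrite {1 2}eE => Eq e_neq0; set e := fine _ in eE e_neq0 Eq *.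
have e0 : (0 < e)%R by rewrite lt_neqAle eq_sym e_neq0 fine_ge0// pair_energy_ge0.
have E00 := energy_gt0.
exists ((E0 / e) `^ p^-1)%R; first by apply: powR_gt0; exact: divr_gt0.
have [H G0] := optimal_scaling adm eE e0; apply: G0.
move: Eq; rewrite mE poweR_EFin -EFinM /T /r (sharp_identity p0 d1 E00 e0 m0) => -[].
rewrite -[RHS]mulr1 => /(mulfI (lt0r_neq0 e0)).
set X := (_ / E0)%R.
have X0 : (0 <= X)%R by rewrite divr_ge0 ?mulr_ge0 ?powR_ge0// ltW.
move=> /(congr1 (fun t => t `^ r^-1)%R); rewrite powR1 -powRrM mulfV ?(gt_eqF r0)//.
by rewrite powRr1// => /divr1_eq.
Qed.

(** Equality in Young's inequality at almost all pairs of points.  Fixing the first point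
    outside Omega gives |v| = u; fixing it inside Omega gives the sign. *)
Lemma rigidity v : measurable_fun setT v -> {ae mu, forall x, ~ Omega x -> v x = 0%R} ->
  gap v = 0 -> exists k : R, {ae mu, forall x, v x = (k * u x)%R}.
Proof.
move=> mv v_off G0.
have av : measurable_fun setT (fun x => `|v x|)%R.
  exact: measurableT_comp (@normr_measurable _ _) mv.
have mgap : measurable_fun setT (fun z => (alpha * young_gap p (gag s p v z)
    (gag s p (fun x => `|v x|)%R z) (gag s p u z))%:E).
  have mg (a : V -> R) : measurable_fun setT a -> measurable_fun setT (gag s p a).
    exact: measurable_gag.
  apply/measurable_EFinP; apply: measurable_funM => //; apply: measurable_funB.
    apply: measurable_funD; apply: measurable_funM => //; apply: measurable_powR_norm; exact: mg.
  apply: measurable_funM; last exact: mg.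
  apply: measurable_funM; last exact: mg.
  by apply: measurable_powR_norm; exact: mg.
have : {ae nu, forall z, (`|v z.1| - `|v z.2| = u z.1 - u z.2)%R /\
    (`|v z.1 - v z.2| = `|u z.1 - u z.2|)%R}.
  have gp z : (0 <= young_gap p (gag s p v z) (gag s p (fun x => `|v x|)%R z) (gag s p u z))%R.
    apply: young_gap_ge0 => //.
    by rewrite /gag !normrM ler_wpM2r// ler_dist_dist.
  have /(ae_eq_integral_abs nu measurableT mgap).1 : \int[nu]_z `|(alpha * young_gap p (gag s p v z)
     (gag s p (fun x => `|v x|)%R z) (gag s p u z))%:E| = 0.
    rewrite -[RHS]G0; apply: eq_integral => z _.
    by rewrite gee0_abs// lee_fin mulr_ge0// ltW.
  apply: filterS => z /(_ I) [] /eqP; rewrite mulf_eq0 gt_eqF//= => /eqP H.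
  have [|h1 h2] := young_gap_eq0 p1 _ H.
    by rewrite /gag !normrM ler_wpM2r// ler_dist_dist.
  split; first exact: (gag_inj h2).
  exact: (gag_norm_inj h1).
move/ae_sections; set P := fun x => {ae mu, forall y, _} => aP.
have aO := ae_and aP (ae_and v_off u_off).
have [x0 Ox0 [Px0 [/(_ Ox0) vx0 /(_ Ox0) ux0]]] := ae_outside aO.
have abs_v : {ae mu, forall x, (`|v x| = u x)%R}.
  apply: filterS Px0 => y /= [+ _].
  by rewrite vx0 ux0 normr0 !sub0r => /oppr_inj.
have uO : 0 < mu Omega.
  rewrite lt0e measure_ge0 andbT; apply/eqP => O0; apply: u_mass.
  by exists Omega; split => // x /= /not_implyP[].
have [y0 Oy0 [Py0 [vy0 /(_ Oy0) uy0]]] :=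
  ae_exists (filterI aP (ae_and abs_v u_gt0)) mO uO.
exists (v y0 / u y0)%R.
apply: filterS2 Py0 abs_v => x /= [_ vu] vx.
by apply: (rigid_sign uy0 vy0 vx); rewrite distrC vu distrC.
Qed.

Lemma zero_energy G v : measurable_fun setT v ->
  {ae mu, forall x, ~ Omega x -> v x = 0%R} -> EP G v = 0 -> {ae mu, forall x, v x = 0%R}.
Proof.
move=> mv v_off; rewrite pair_energyE => /eqP.
rewrite padde_eq0 ?mule_ge0 ?pint_ge0 ?lee_fin ?(ltW alpha0)// => /andP[_].
rewrite mule_eq0 eqe gt_eqF//= => /eqP /(pint_eq0 p0 (measurable_gag s p mv)) H.
have : {ae nu, forall z, (v z.1 = v z.2)%R}.
  apply: filterS H => z vz; apply/eqP; rewrite -subr_eq0.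
  by rewrite (@gag_inj _ _ s p v (fun=> 0%R)) ?subrr// vz /gag subrr mul0r.
move/ae_sections; set P := fun x => {ae mu, forall y, _} => aP.
have [x0 Ox0 [Px0 /(_ Ox0) vx0]] := ae_outside (ae_and aP v_off).
by apply: filterS Px0 => y /= <-.
Qed.

End extremals.

(** * Multiples of elements of the Sobolev space *)

Section scaling.
Context {R : realType} {N : nat}.
Local Notation V := 'rV[R]_(N + N + 1).
Local Notation mu := (@mu_heis R N).
Local Open Scope ereal_scope.
Implicit Types (v : V -> R).
Variables (Omega : set V) (p s alpha : R).
Hypotheses (p1 : (1 < p)%R) (alpha0 : (0 < alpha)%R) (oO : open Omega).
Let p1' : (1 <= p)%R. Proof. exact: ltW. Qed.
Let p0 : (0 < p)%R. Proof. exact: lt_trans p1. Qed.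
Let mO : measurable Omega. Proof. exact: open_measurable_rV. Qed.

Lemma pint_Lfun (g : V -> R) : measurable_fun setT g -> pint mu p setT g < +oo ->
  g \in Lfun mu p%:E.
Proof.
move=> mg fg; rewrite inE; apply/andP; split; first by rewrite inE.
rewrite !inE/= /finite_norm unlock /Lnorm poweR_lty//=.
by move: fg; rewrite pintE.
Qed.

(** The energy is computed with the chosen weak gradient, which is homogeneous up to null
    sets. *)
Lemma HW1_0Z (c : R) v : HW1_0 p Omega v ->
  HW1_0 p Omega (fun x => c * v x)%R /\
  energy Omega p s alpha (fun x => c * v x)%R =
  (`|c| `^ p)%:E * energy Omega p s alpha v.
Proof.
move=> Hv; have [mv pv wv Xv] := HW1_0_pint p1 Hv.
have lv := pint_loc_integrable p1' mv pv.
have wcv j := is_weak_XZ c lv (wv j).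
have Xc j := weak_XP (ex_intro _ _ (wcv j)).
have mX j : measurable_fun setT (weak_X j (fun x => c * v x)%R) by case: (Xc j) => -[].
have mcX j : measurable_fun setT (fun x => c * weak_X j v x)%R.
  by apply: measurable_funM => //; case: (Xv j).
have ae j := weak_XZ c lv (ex_intro _ _ (wv j)).
have mcv : measurable_fun setT (fun x => c * v x)%R by exact: measurable_funM.
split.
  have [[_ _] v_off] := Hv; split; last first.
    by apply: filterS v_off => x h /h ->; rewrite mulr0.
  split.
    by apply: pint_Lfun => //; rewrite pintZ// lte_mul_pinfty// lee_fin powR_ge0.
  move=> j; split; first by exists (fun x => c * weak_X j v x)%R; exact: wcv.
  apply: pint_Lfun => //.
  rewrite (pint_ae_eq p measurableT (mX j) (mcX j)); last first.
    by apply: filterS (ae j) => x h _.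
  have [mXv fXv] := Xv j.
  by rewrite pintZ// lte_mul_pinfty// lee_fin powR_ge0.
rewrite !energyE// -(pair_energyZ p s alpha0 oO)//; last by move=> j; case: (Xv j).
rewrite !pair_energyE; congr (_ + _).
apply: pint_ae_eq => //; [exact: measurable_funTS (measurable_enorm mX)|
  exact: measurable_funTS (measurable_enorm mcX)|].
have : {ae mu, forall x, forall j, weak_X j (fun x => c * v x)%R x = (c * weak_X j v x)%R}.
  exact: filter_forall.
apply: filterS => x h _; congr enorm; apply/funext => j; exact: h.
Qed.

End scaling.

(** * Positivity of the solution and restriction of the datum *)

Section positivity.
Context {R : realType} {N : nat}.
Local Notation V := 'rV[R]_(N + N + 1).
Local Notation mu := (@mu_heis R N).
Implicit Types (v : V -> R).

(** Exhaust Omega by the points at distance at least 1/(k+1) from its complement. *)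
Lemma ae_pos_interior (Omega : set V) (u : V -> R) : open Omega -> bounded_set Omega ->
  (forall omega, compactly_contained omega Omega ->
     exists2 C : R, 0 < C & {ae mu, forall x, omega x -> C <= u x}) ->
  {ae mu, forall x, Omega x -> 0 < u x}.
Proof.
move=> oO bO H.
pose om (k : nat) : set V := [set x | forall y, `|y - x| < k.+1%:R^-1 -> Omega y].
have omO k : om k `<=` Omega by move=> x; apply; rewrite subrr normr0 invr_gt0.
have comO k : compactly_contained (om k) Omega.
  split.
    apply: compact_closure_bounded; have [M [Mr HM]] := bO.
    exists M; split => // y /HM h x /omO; exact: h.
  move=> x cx.
  have [|y []] := cx (ball x k.+1%:R^-1); first exact: nbhsx_ballx.
  move=> yk; rewrite -ball_normE /= => xy; apply: yk; exact: xy.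
have pk k : {ae mu, forall x, om k x -> 0 < u x}.
  have [C C0] := H _ (comO k); apply: filterS => x h /h; exact: lt_le_trans.
have : {ae mu, forall x, forall k, om k x -> 0 < u x}.
  apply: (negligibleS _ (negligible_bigcup pk)) => x /= /existsNP[k nk].
  by exists k.
apply: filterS => x h Ox.
have /nbhs_ballP[e /= e0 He] : nbhs x Omega by exact: open_nbhs_nbhs.
have [k ke] : exists k : nat, k.+1%:R^-1 < e.
  exists (Num.truncn e^-1); rewrite invf_plt ?posrE//; exact: truncnS_gt.
apply: (h k) => y yk; apply: He; rewrite -ball_normE /= distrC.
exact: lt_trans ke.
Qed.

End positivity.

Section restricted_data.
Context {R : realType} {N : nat}.
Local Notation V := 'rV[R]_(N + N + 1).
Local Notation mu := (@mu_heis R N).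
Variables (Omega : set V) (f : V -> R) (l : R).
Hypotheses (oO : open Omega) (fL : f \_ Omega \in Lfun mu l%:E).
Hypothesis f_ge0 : {ae mu, forall x, Omega x -> 0 <= f x}.
Let mO : measurable Omega. Proof. exact: open_measurable_rV. Qed.

(** A representative of the datum which is nonnegative and measurable everywhere, so that the
    weight q = f u^(-d) can be treated as a function on the whole space. *)
Definition pos_datum : V -> R := fun x => Num.max ((f \_ Omega) x) 0.

Lemma measurable_pos_datum : measurable_fun setT pos_datum.
Proof.
apply: measurable_maxr; last exact: measurable_cst.
by have /sub_Lfun_mfun := fL; rewrite inE.
Qed.

Lemma pos_datum_ge0 x : 0 <= pos_datum x.
Proof. by rewrite /pos_datum le_max lexx orbT. Qed.

Lemma pos_datumE : {ae mu, forall x, Omega x -> pos_datum x = f x}.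
Proof.
apply: filterS f_ge0 => x fx Ox; rewrite /pos_datum patchE mem_set//.
by rewrite max_l// fx.
Qed.

Lemma integral_pos_datum (h : V -> R) : measurable_fun setT h ->
  (\int[mu]_(x in Omega) (h x * f x)%:E = \int[mu]_(x in Omega) (h x * pos_datum x)%:E)%E.
Proof.
move=> mh.
have mf : measurable_fun Omega f.
  have /sub_Lfun_mfun : f \_ Omega \in Lfun mu l%:E by [].
  by rewrite inE => /(measurable_restrictT f mO).
apply: ae_eq_integral => //.
- by apply/measurable_EFinP; apply: measurable_funM => //; exact: measurable_funTS.
- apply/measurable_EFinP; apply: measurable_funM; apply: measurable_funTS => //.
  exact: measurable_pos_datum.
by apply: filterS pos_datumE => x E Ox; rewrite E.
Qed.

End restricted_data.

(** * The extremal characterization *)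

Theorem theorem1p8 (R : realType) (N : nat) (s p delta alpha : R)
    (Omega : set (heis R N)) (f u : heis R N -> R) :
  (1 <= N)%N ->
  0 < s -> s < 1 -> 1 < p -> p < (hdim N)%:R ->
  0 < delta -> delta < 1 -> 0 < alpha ->
  bounded_smooth_domain Omega ->
  f \_ Omega \in Lfun mu_heis
    (conjugate_exponent (sobolev_conjugate N p / (1 - delta)))%:E ->
  {ae mu_heis, forall x, Omega x -> 0 <= f x} ->
  ~ {ae mu_heis, forall x, Omega x -> f x = 0} ->
  weak_solution Omega p s alpha delta f u ->
  [/\ Theta Omega p s alpha delta f =
        (energy Omega p s alpha u `^ ((1 - delta - p) / (1 - delta)))%E,
      forall C : R,
        (forall v, HW1_0 p Omega v ->
          (C%:E * weighted_mass Omega delta f v `^ (p / (1 - delta))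
             <= energy Omega p s alpha v)%E) <->
        (C%:E <= Theta Omega p s alpha delta f)%E &
      forall w, HW1_0 p Omega w ->
        (Theta Omega p s alpha delta f *
           weighted_mass Omega delta f w `^ (p / (1 - delta)) =
         energy Omega p s alpha w)%E ->
        exists k : R, {ae mu_heis, forall x, w x = k * u x}].
Proof.
move=> N0 s0 s1 p1 pQ d0 d1 alpha0 [Onem oO cO bO sO] fL f_ge0 f_neq0 [Hu upos weak].
pose f0 := pos_datum Omega f.
have p0 : 0 < p by exact: lt_trans p1.
have c0 : 0 < 1 - delta by rewrite subr_gt0.
have adm v (Hv : HW1_0 p Omega v) := HW1_0_admissible p1 s0 s1 alpha0 N0 oO bO sO Hv.
have mv v (Hv : HW1_0 p Omega v) : measurable_fun setT v by case: (adm v Hv).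
have mf0 : measurable_fun setT f0 := measurable_pos_datum fL.
have f0_ge0 x : 0 <= f0 x := pos_datum_ge0 Omega f x.
have massE v : HW1_0 p Omega v ->
    weighted_mass Omega delta f v = mass Omega delta f0 v.
  move=> Hv; apply: (integral_pos_datum oO fL f_ge0).
  exact: measurable_powR_norm (mv v Hv).
have u_gt0 := ae_pos_interior oO bO upos.
have u_off : {ae mu_heis, forall x, ~ Omega x -> u x = 0} by case: Hu.
have f0_neq0 : ~ {ae mu_heis, forall x, Omega x -> f0 x = 0}.
  move=> H; apply: f_neq0; apply: filterS2 H (pos_datumE f_ge0) => x h E Ox.
  by rewrite -(E Ox); exact: h.
have WF phi : test1 Omega phi ->
   (\int[mu_heis]_(x in Omega) (enorm (fun j => weak_X j u x) `^ (p - 2) *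
     \sum_j weak_X j u x * Xfield j phi x)%R%:E +
  alpha%:E * int_dmu s p (fun z => Jp p (u z.1 - u z.2) * (phi z.1 - phi z.2))%R =
  \int[mu_heis]_(x in Omega) ((f0 x * u x `^ (- delta)) * phi x)%:E)%E.
  move=> [phi1 phic]; rewrite (weak phi phi1 phic).
  have -> : (\int[mu_heis]_(x in Omega) (f x * u x `^ (- delta) * phi x)%:E =
      \int[mu_heis]_(x in Omega) ((u x `^ (- delta) * phi x) * f x)%:E)%E.
    by apply: eq_integral => x _; congr (_%:E); ring.
  rewrite (integral_pos_datum oO fL f_ge0).
    by apply: eq_integral => x _; congr (_%:E); rewrite /f0; ring.
  apply: measurable_funM; last exact: cd_measurable phi1.
  exact: measurableT_comp (measurable_powR _) (mv u Hu).
have EE v : energy Omega p s alpha v = pair_energy Omega p s alpha (fun j => weak_X j v) v.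
  exact: energyE.
pose E0 := fine (pair_energy Omega p s alpha (fun j => weak_X j u) u).
have uE : energy Omega p s alpha u = E0%:E.
  rewrite EE /E0 fineK// ge0_fin_numE ?pair_energy_ge0//.
  by case: (adm u Hu).
have E0_gt0 : 0 < E0.
  exact: (energy_gt0 p1 s0 s1 alpha0 N0 oO mf0 f0_ge0 (adm u Hu) u_gt0 f0_neq0 WF).
have Mu : mass Omega delta f0 u = E0%:E.
  exact: (mass_solution p1 s0 s1 alpha0 N0 oO mf0 f0_ge0 (adm u Hu) u_gt0 WF).
set r := p / (1 - delta); pose T := E0 `^ ((1 - delta - p) / (1 - delta)).
have sharp v : HW1_0 p Omega v ->
    (T%:E * weighted_mass Omega delta f v `^ r <= energy Omega p s alpha v)%E.
  move=> Hv; rewrite massE// EE.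
  exact: (sharp_inequality p1 s0 s1 alpha0 d0 d1 N0 oO mf0 f0_ge0 (adm u Hu)
    u_gt0 f0_neq0 WF (adm v Hv)).
(* c u has mass one *)
pose c := E0 `^ (- (1 - delta)^-1).
have [Huc ucE] := HW1_0Z s p1 alpha0 oO c Hu.
have c_gt0 : 0 < c by exact: powR_gt0.
have ucM : weighted_mass Omega delta f (fun x => c * u x) = 1%E.
  rewrite massE// massZ//; last exact: mv.
  rewrite Mu gtr0_norm// -EFinM; congr (_%:E).
  rewrite /c -powRrM mulNr mulVf ?gt_eqF// powR_inv1 ?ltW// mulVf// gt_eqF//.
have {}ucE : energy Omega p s alpha (fun x => c * u x) = T%:E.
  rewrite ucE uE gtr0_norm// -EFinM; congr (_%:E).
  rewrite /c -powRrM -{2}(powRr1 (ltW E0_gt0)) -powRD ?(gt_eqF E0_gt0) ?implybT//.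
  by rewrite /T; congr (_ `^ _); field; rewrite gt_eqF.
have ThetaE : Theta Omega p s alpha delta f = T%:E.
  apply/eqP; rewrite eq_le; apply/andP; split.
    apply: ereal_inf_lbound; exists (fun x => c * u x) => //; split => // uc0.
    have : weighted_mass Omega delta f (fun x => c * u x) = 0%E.
      rewrite massE// /mass (ae_eq_integral (cst 0%E)) ?integral0//.
      - exact: open_measurable_rV.
      - apply/measurable_EFinP; apply: measurable_funTS; apply: measurable_funM => //.
        exact: measurable_powR_norm (mv _ Huc).
      apply: filterS uc0 => x -> _; rewrite normr0 powR0 ?mul0r// gt_eqF//.
    by rewrite ucM => /eqP; rewrite eqe oner_eq0.
  apply: le_ereal_inf_tmp => _ [v [Hv _ Mv] <-].
  by have := sharp v Hv; rewrite Mv poweR1r mule1.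
split.
- by rewrite ThetaE uE poweR_EFin.
- move=> C; rewrite ThetaE; split=> [/(_ _ Huc)|CT v Hv].
    by rewrite ucM poweR1r mule1 ucE.
  apply: le_trans (sharp v Hv); apply: lee_wpmul2r => //; exact: poweR_ge0.
move=> w Hw; rewrite ThetaE massE// EE => Eq.
have w_off : {ae mu_heis, forall x, ~ Omega x -> w x = 0} by case: Hw.
have [Ew0|Ew] := eqVneq (pair_energy Omega p s alpha (fun j => weak_X j w) w) 0%E.
  exists 0; have := zero_energy p1 alpha0 oO bO (mv w Hw) w_off Ew0.
  by apply: filterS => x ->; rewrite mul0r.
have [k k0 gap0] := equality_gap p1 s0 s1 alpha0 d0 d1 N0 oO mf0 f0_ge0 (adm u Hu)
  u_gt0 f0_neq0 WF (adm w Hw) Eq Ew.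
have mkw : measurable_fun setT (fun x => k * w x).
  by apply: measurable_funM => //; exact: mv.
have kw_off : {ae mu_heis, forall x, ~ Omega x -> k * w x = 0}.
  by apply: filterS w_off => x h /h ->; rewrite mulr0.
have [k' H] := rigidity p1 alpha0 oO bO (adm u Hu) u_gt0 u_off f0_neq0 mkw kw_off gap0.
exists (k' / k); apply: filterS H => x H.
by rewrite mulrAC -H mulrAC divff ?gt_eqF// mul1r.
Qed.
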